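(* For every real number $\eta$ with $0<\eta<0.0527$ there exists an infinite Sidon set $\mathcal{S}\subset\mathbb{N}$ which is an asymptotic Sidon basis of order $3-\eta$; that is, there is an integer $m_0$ such that every integer $m\ge m_0$ can be represented as $$m=s_1+s_2+s_3,\qquad s_1,s_2,s_3\in\mathcal{S},$$ with $$\min\{s_1,s_2,s_3\}\le m^{1-\eta}.$$
   Context: $\mathbb{N}$ denotes the set of natural numbers (positive integers). A set $\mathcal{S}\subset\mathbb{N}$ is a Sidon set if all sums $s_1+s_2$ with $s_1,s_2\in\mathcal{S}$ and $s_1\le s_2$ are distinct. The elements $s_1,s_2,s_3$ in the representation of $m$ are not required to be distinct. *)

(* Defs.v *)
From HB Require Import structures.
From mathcomp Require Import all_boot all_order all_algebra.
From mathcomp Require Import all_classical all_reals all_analysis.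

Set Implicit Arguments.
Unset Strict Implicit.
Unset Printing Implicit Defensive.
Import Order.TTheory GRing.Theory Num.Theory.
Local Open Scope classical_set_scope.
Local Open Scope ring_scope.

(* The natural numbers are the positive integers, so a set of them is a subset
   of [posnat]. *)
Definition posnat : set nat := [set n : nat | (0 < n)%N].

Definition sidon_set (S : set nat) : Prop :=
  S `<=` posnat /\
  forall s1 s2 t1 t2 : nat, S s1 -> S s2 -> S t1 -> S t2 ->
    (s1 <= s2)%N -> (t1 <= t2)%N -> (s1 + s2 = t1 + t2)%N ->
    s1 = t1 /\ s2 = t2.

(* [asymptotic_basis_3sub eta S]: S is an asymptotic basis of order 3 - eta. *)
Definition asymptotic_basis_3sub (R : realType) (eta : R) (S : set nat) : Prop :=
  exists m0 : nat, forall m : nat, (m0 <= m)%N ->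
    exists s1 s2 s3 : nat,
      [/\ S s1, S s2, S s3, m = (s1 + s2 + s3)%N
        & (minn s1 (minn s2 s3))%:R <= powR m%:R (1 - eta)].

(* Main.v *)
Require Import Defs.
From HB Require Import structures.
From mathcomp Require Import all_boot all_order all_algebra all_fingroup all_solvable.
From mathcomp Require Import boolp.
From mathcomp Require Import zify ring lra.
Import Order.TTheory GRing.Theory Num.Theory.

Set Implicit Arguments.
Unset Strict Implicit.
Unset Printing Implicit Defensive.

(** Take a Sidon set A with about N^0.37 elements below N, at most C l^0.378 of
    them in any interval of length l, and all of them in {0, 1, 4, 13} mod 64.
    Add a random set C of density n^(-0.7) supported on the classes mod 64 that
    are not of the form a + a' - a'' with a, a', a'' in A, and delete from the
    union every element that takes part, as the largest relevant term, in a
    nontrivial equation x + y = z + t.  What is left is Sidon.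

    An integer m in [2^k, 2^(k+1)) should be written as a1 + a2 + d with a1, a2
    in A, d in C and a2 < 2^(15k/16) <= m^(15/16); as 0.37 (1 + 15/16) > 0.7 there
    are many such d.  If all the available d in C were useless, each would be
    destroyed by a small configuration of further points of C, and a bounded
    number K of these configurations could be taken with distinct heads.  The
    expected number of configurations, even conditioned on boundedly many points
    of C, decays exponentially in k, so that for K large this has probability
    less than 4^(-k).  A union bound over m < 2^Z gives one Sidon set that serves
    all m in [m0, 2^Z), with m0 independent of Z, and compactness gives an
    infinite one.

    The set A consists of integers whose i-th digits are the discrete logarithms
    of a prime p modulo primes q_i (a construction of Cilleruelo): sums of digits
    give the product of two such primes modulo all q_i. *)

(** * Primes in dyadic ranges *)

(** Let A have about N^c elements below N and let C have density n^(-b). Two conditions confine b.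
    The expected number of pairs w1, w2 of C with d + w1 = a + w2 for some a in A is about N^(1 - 2
    b + c), so deletions are rare only if b > (1 + c) / 2; having enough values d requires b < c (1
    + 15/16). With c between 0.37 and 0.378 this leaves roughly 0.69 < b < 0.716. Destruction by
    three points of C only asks for b > 2/3. Equations with three terms in A and one in C are the
    obstacle: below N there are about N^1.11 triples in A, so nearly every d could be some a + a' -
    a'', whatever b is. The classes mod 64 exclude these equations altogether. The exponent c is
    limited by c + c / (1 - c) < 1, that is c < (3 - sqrt 5) / 2 = 0.3819..., see [label_sidon]. The
    bound for A in short intervals is needed because the correlations of C are summed over the
    differences a1 - a. The destroying events overlap and are dependent. A chain reveals a few
    points of C at a time, so that first moments given these points suffice. *)

Lemma central_bin_ge n : 2 ^ n <= 'C(2 * n, n).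
Proof.
elim: n => [|n IH] //; have -> : 2 * n.+1 = (2 * n).+2 by lia.
rewrite binS expnS mul2n -addnn; apply: leq_add; last first.
  by apply: leq_trans IH (leq_bin2l _ _).
have <- : 'C((2 * n).+1, n) = 'C((2 * n).+1, n.+1).
  by rewrite -[RHS]bin_sub; [congr 'C(_, _) |]; lia.
by apply: leq_trans IH (leq_bin2l _ _).
Qed.

(** Legendre's formula: p^k contributes floor(2n / p^k) - 2 floor(n / p^k), which is 0 or 1, and it
    contributes 0 once p^k > 2n. The exponent of p is therefore at most log_p (2n). *)
Lemma pfactor_central_bin p n : prime p -> 0 < n ->
  p ^ logn p 'C(2 * n, n) <= 2 * n.
Proof.
move=> p_pr n_gt0; have p_gt1 := prime_gt1 p_pr.
have Cgt0 : 0 < 'C(2 * n, n) by rewrite bin_gt0; lia.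
have := bin_fact (_ : n <= 2 * n); move=> /(_ ltac:(lia)).
have -> : 2 * n - n = n by lia.
move=> /(congr1 (logn p)); rewrite !lognM ?muln_gt0 ?fact_gt0 //.
rewrite !logn_fact // (@big_nat_widen _ _ _ _ n.+1 (2 * n).+1); last by lia.
have -> : \sum_(1 <= k < (2 * n).+1 | true && (k < n.+1)) n %/ p ^ k
    = \sum_(1 <= k < (2 * n).+1) n %/ p ^ k.
  rewrite big_mkcond; apply: eq_big_nat => k /andP[k_gt0 k_le] /=.
  case: ltnP => // lt_nk; rewrite divn_small //.
  exact: leq_trans (ltn_expl n p_gt1) (leq_pexp2l (prime_gt0 p_pr) (ltnW lt_nk)).
set t := trunc_log p (2 * n).
have term k : (2 * n) %/ p ^ k <= n %/ p ^ k + n %/ p ^ k + (k <= t).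
  have pk : 0 < p ^ k by rewrite expn_gt0 prime_gt0.
  case: (leqP k t) => [_|lt_tk] /=.
    rewrite -ltnS ltn_divLR //.
    have := divn_eq n (p ^ k); have := ltn_pmod n pk.
    move: (n %/ p ^ k) (n %% p ^ k) => q r; move: (p ^ k) => u; nia.
  rewrite divn_small //; apply: leq_trans (trunc_log_ltn _ p_gt1) _.
  exact: leq_pexp2l (prime_gt0 p_pr) lt_tk.
have le_sum : \sum_(1 <= k < (2 * n).+1) (2 * n) %/ p ^ k <=
    \sum_(1 <= k < (2 * n).+1) (n %/ p ^ k + n %/ p ^ k + (k <= t)).
  by apply: leq_sum => k _; apply: term.
move: le_sum; rewrite !big_split /= => le_sum eqL.
have le_t : \sum_(1 <= k < (2 * n).+1) (k <= t) <= t.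
  have tn : t <= 2 * n.
    rewrite -ltnS -(@ltn_exp2l p) //; apply: leq_ltn_trans (trunc_logP _ _) _ => //; first lia.
    by apply: leq_trans (ltn_expl _ p_gt1) (leq_pexp2l _ _); lia.
  rewrite (@big_cat_nat _ _ _ t.+1) /=; [|lia|lia].
  have -> : \sum_(t.+1 <= i < (2 * n).+1) (i <= t) = 0.
    by apply: big1_seq => i /andP[_]; rewrite mem_index_iota => /andP[lt _]; rewrite leqNgt lt.
  rewrite addn0.
  apply: leq_trans (_ : \sum_(1 <= i < t.+1) 1 <= t).
    by apply: leq_sum => i _; case: (i <= t).
  by rewrite sum_nat_const_nat; lia.
apply: leq_trans (_ : p ^ t <= 2 * n); last by apply: trunc_logP; lia.
rewrite leq_exp2l //; lia.
Qed.

Definition prime_pi n := \sum_(0 <= p < n.+1 | prime p) 1.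

Lemma central_bin_le n : 0 < n -> 'C(2 * n, n) <= (2 * n) ^ prime_pi (2 * n).
Proof.
move=> n_gt0; have Cgt0 : 0 < 'C(2 * n, n) by rewrite bin_gt0; lia.
have logn0 p : prime p -> 2 * n < p -> logn p 'C(2 * n, n) = 0.
  move=> pp lt; case E: (logn _ _) => [|e] //.
  have := pfactor_central_bin pp n_gt0; rewrite E => le.
  have := leq_trans (leq_pexp2l (prime_gt0 pp) (ltn0Sn e)) le; rewrite expn1; lia.
rewrite -{1}(partnT Cgt0) (@widen_partn (maxn 'C(2 * n, n) (2 * n))) ?leq_maxl //.
rewrite (@big_cat_nat _ _ _ (2 * n).+1) /=; [|lia|lia].
rewrite [X in _ * X]big_nat_cond [X in _ * X]big1 ?muln1; last first.
  move=> p /andP[/andP[lt _] _]; case: (boolP (prime p)) => pp.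
    by rewrite logn0.
  by rewrite lognE (negbTE pp).
rewrite expn_sum /prime_pi [X in _ <= X]big_mkcond /=.
apply: leq_prod => p _; case: (boolP (prime p)) => pp.
  by rewrite expn1; apply: pfactor_central_bin.
by rewrite lognE (negbTE pp).
Qed.

(** Chebyshev's argument: for n = 2^j the central binomial coefficient is at least 2^n, and each
    prime up to 2n contributes a factor of at most 2n = 2^(j+1). *)
Lemma prime_pi_ge j : 2 ^ j <= j.+1 * prime_pi (2 ^ j.+1).
Proof.
have := leq_trans (central_bin_ge (2 ^ j)) (central_bin_le (expn_gt0 2 j)).
by rewrite -expnS -expnM leq_exp2l.
Qed.

Lemma prime_pi_split u v : u <= v ->
  prime_pi v <= u.+1 + \sum_(u.+1 <= p < v.+1 | prime p) 1.
Proof.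
move=> le_uv; rewrite /prime_pi (@big_cat_nat _ _ _ u.+1) //= leq_add2r.
apply: leq_trans (_ : \sum_(0 <= p < u.+1) 1 <= _); last by rewrite sum_nat_const_nat; lia.
by rewrite big_mkcond; apply: leq_sum => i _; case: ifP.
Qed.

Lemma dyadic_prime_count u v : u <= v ->
  2 ^ v <= v.+1 * (2 ^ u + 1 + \sum_((2 ^ u).+1 <= p < (2 ^ v.+1).+1 | prime p) 1).
Proof.
move=> le_uv; apply: leq_trans (prime_pi_ge v) _; rewrite leq_mul2l /= addn1.
by apply: prime_pi_split; rewrite leq_exp2l //; lia.
Qed.

(** This contradicts [dyadic_prime_count] at [u = (i + 2) ^ 2], [v.+1 = (i + 3) ^ 2] if no prime
    lies between the two powers of 2. *)
Lemma sqr_lt_exp4 i : (i + 3) ^ 2 * (2 ^ ((i + 2) ^ 2) + 1) < 2 ^ ((i + 3) ^ 2).-1.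
Proof.
case: i => [//|i]; have h : (i.+1 + 3) ^ 2 < 2 ^ (2 * i.+1 + 4).-1.
  elim: i => [//|j IH].
  have -> : (2 * j.+2 + 4).-1 = ((2 * j.+1 + 4).-1).+2 by lia.
  by rewrite !expnS; move: (2 ^ _) IH => u; nia.
move: i.+1 h => {}i h; have -> : ((i + 3) ^ 2).-1 = (i + 2) ^ 2 + 1 + (2 * i + 4).-1 by rewrite !expnS; nia.
rewrite !expnD expn1; have : 0 < 2 ^ (i + 2) ^ 2 by rewrite expn_gt0.
move: (2 ^ (i + 2) ^ 2) ((i + 3) ^ 2) (2 ^ (2 * i + 4).-1) h => U S W ltSW U_gt0.
by apply: (@leq_ltn_trans (S * (U * 2))); [rewrite leq_mul2l|rewrite mulnC ltn_mul2l]; lia.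
Qed.

(** Quadratic exponents make the width of one digit and the total [loss] of order k^2, negligible
    against the length of k digits, which is of order k^3. *)
Lemma ex_block_prime i :
  exists p, [&& prime p, 2 ^ ((i + 2) ^ 2) < p & p <= 2 ^ ((i + 3) ^ 2)].
Proof.
pose P p := [&& prime p, 2 ^ ((i + 2) ^ 2) < p & p <= 2 ^ ((i + 3) ^ 2)].
case: (boolP (has P (index_iota (2 ^ (i + 2) ^ 2).+1 (2 ^ (i + 3) ^ 2).+1))).
  by case/hasP => p _ Pp; exists p.
move/hasPn => none.
have := @dyadic_prime_count ((i + 2) ^ 2) ((i + 3) ^ 2).-1.
rewrite prednK ?expn_gt0 ?addn_gt0 ?orbT // big1_seq; last first.
  move=> p /andP[pp]; rewrite mem_index_iota => pi.
  have := none p; rewrite mem_index_iota => /(_ pi).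
  by rewrite /P pp; move: pi; rewrite ltnS => ->.
rewrite addn0 => /(_ ltac:(rewrite !expnS; nia)); have := sqr_lt_exp4 i.
lia.
Qed.

Lemma block_prime_ex : {q : nat -> nat | forall i, [/\ prime (q i),
  2 ^ ((i + 2) ^ 2) < q i & q i <= 2 ^ ((i + 3) ^ 2)]}.
Proof.
exists (fun i => ex_minn (ex_block_prime i)) => i.
by case: ex_minnP => p /and3P[].
Qed.

Definition block_prime := sval block_prime_ex.

Lemma block_primeP i : [/\ prime (block_prime i),
  2 ^ ((i + 2) ^ 2) < block_prime i & block_prime i <= 2 ^ ((i + 3) ^ 2)].
Proof. exact: (svalP block_prime_ex). Qed.

Lemma ex_primitive_root q : prime q ->
  exists g, forall p, ~~ (q %| p) -> exists2 d, d < q & g ^ d = p %[mod q].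
Proof.
move=> q_pr; have := field_unit_group_cyclic [set: {unit 'F_q}]%G.
case/cyclicP => g defG; exists (val (val g)) => p ndvd.
have pU : (p%:R : 'F_q)%R \is a GRing.unit.
  by rewrite unitfE -(dvdn_pcharf (pchar_Fp q_pr)).
have : FinRing.unit 'F_q pU \in <[g]>%g by rewrite -defG inE.
case/cyclePmin => d lt_d def_d; exists d.
  apply: leq_trans lt_d _; rewrite -[leqRHS](card_Fp q_pr) /order -defG cardsT.
  rewrite card_sub; exact: max_card.
have := congr1 (@FinRing.uval _) def_d; rewrite FinRing.val_unitX /=.
move=> /(congr1 (fun x : 'F_q => nat_of_ord x)).
by rewrite -[X in (X ^+ d)%R](natr_Zp (FinRing.uval g)) -natrX !val_Fp_nat.
Qed.

(** * A dense Sidon set *)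

Lemma block_prime_prime i : prime (block_prime i).
Proof. by case: (block_primeP i). Qed.

Lemma dlog_ex : {d : nat -> nat -> nat | forall i, exists g, forall p,
  d i p < block_prime i /\
  (~~ (block_prime i %| p) -> g ^ d i p = p %[mod block_prime i])}.
Proof.
pose g i := sval (cid (ex_primitive_root (block_prime_prime i))).
pose P i p d := g i ^ d == p %[mod block_prime i].
(* If the block prime divides p, [find] may fail and return the length [block_prime i]; the
   reduction keeps the digit bound in that case too. *)
exists (fun i p => find (P i p) (iota 0 (block_prime i)) %% block_prime i) => i.
exists (g i) => p; split; first by rewrite ltn_mod prime_gt0 ?block_prime_prime.
move=> ndvd; have [d lt_d def_d] := svalP (cid (ex_primitive_root (block_prime_prime i))) p ndvd.
have hasP : has (P i p) (iota 0 (block_prime i)).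
  by apply/hasP; exists d; rewrite ?mem_iota //; apply/eqP.
have lt_f : find (P i p) (iota 0 (block_prime i)) < block_prime i.
  by rewrite -[ltnRHS](size_iota 0) -has_find.
rewrite [find _ _ %% _]modn_small //; move: (nth_find 0 hasP).
by rewrite nth_iota // add0n => /eqP.
Qed.

Definition dlog := sval dlog_ex.

Lemma dlog_lt i p : dlog i p < 2 ^ ((i + 3) ^ 2).
Proof.
case: (block_primeP i) => _ _; apply: leq_trans.
by have [g /(_ p)[]] := svalP dlog_ex i.
Qed.

Lemma dlog_inj i p p' : ~~ (block_prime i %| p) -> ~~ (block_prime i %| p') ->
  dlog i p = dlog i p' -> p = p' %[mod block_prime i].
Proof.
have [g gP] := svalP dlog_ex i => n n'.
by rewrite -(proj2 (gP p) n) -(proj2 (gP p') n') => eqd; rewrite -/dlog eqd.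
Qed.

Lemma dlogD_inj i p1 p2 p3 p4 :
  ~~ (block_prime i %| p1) -> ~~ (block_prime i %| p2) ->
  ~~ (block_prime i %| p3) -> ~~ (block_prime i %| p4) ->
  dlog i p1 + dlog i p2 = dlog i p3 + dlog i p4 ->
  p1 * p2 = p3 * p4 %[mod block_prime i].
Proof.
have [g gP] := svalP dlog_ex i => n1 n2 n3 n4 eqd.
rewrite -modnMm -(proj2 (gP p1) n1) -(proj2 (gP p2) n2) modnMm -expnD.
rewrite -/dlog eqd expnD -modnMm (proj2 (gP p3) n3) (proj2 (gP p4) n4).
by rewrite modnMm.
Qed.

(* A digit is smaller than [2 ^ (blockw i - 1)], so adding two numbers never carries. *)
Definition blockw i := (i + 3) ^ 2 + 2.
Definition offset k := \sum_(i < k) blockw i.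
Definition num K (f : nat -> nat) := \sum_(i < K) f i * 2 ^ offset i.

Lemma offsetS k : offset k.+1 = offset k + blockw k.
Proof. by rewrite /offset big_ord_recr. Qed.

Lemma offset_mono j k : j <= k -> offset j <= offset k.
Proof.
move/subnKC <-; elim: (k - j) => [|i IH]; first by rewrite addn0.
by rewrite addnS offsetS; lia.
Qed.

Lemma numS K f : num K.+1 f = num K f + f K * 2 ^ offset K.
Proof. by rewrite /num big_ord_recr. Qed.

Lemma num_lt K f : (forall i, i < K -> f i < 2 ^ blockw i) -> num K f < 2 ^ offset K.
Proof.
elim: K => [|K IH] hf; first by rewrite /num /offset !big_ord0.
rewrite numS offsetS expnD; have := IH (fun i lt => hf i (ltnW lt)); have := hf K (ltnSn K).
move: (2 ^ offset K) (2 ^ blockw K) (f K) (num K f) => u v x y; nia.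
Qed.

Lemma num_guard K f : (forall i, i < K -> 2 * f i < 2 ^ blockw i) ->
  2 * num K f < 2 ^ offset K.
Proof.
elim: K => [|K IH] hf; first by rewrite /num /offset !big_ord0.
rewrite numS offsetS expnD; have := IH (fun i lt => hf i (ltnW lt)); have := hf K (ltnSn K).
have -> : 2 ^ blockw K = 2 * 2 ^ (blockw K).-1 by rewrite -expnS /blockw addn2.
move: (2 ^ offset K) (2 ^ (blockw K).-1) (f K) (num K f) => u v x y; nia.
Qed.

Lemma num_inj K f g : (forall i, i < K -> f i < 2 ^ blockw i) ->
  (forall i, i < K -> g i < 2 ^ blockw i) -> num K f = num K g ->
  forall i, i < K -> f i = g i.
Proof.
elim: K => [|K IH] hf hg //; rewrite !numS => eqN.
have hf' := fun i lt => hf i (leqW lt); have hg' := fun i lt => hg i (leqW lt).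
have := num_lt hf'; have := num_lt hg'; have u0 : 0 < 2 ^ offset K by rewrite expn_gt0.
move=> ltg ltf; have eqK : f K = g K.
  have := congr1 (divn^~ (2 ^ offset K)) eqN.
  by rewrite /= ![num K _ + _]addnC !divnMDl // !divn_small // !addn0.
have eqn : num K f = num K g by move: eqN; rewrite eqK => /addIn.
by move=> i; rewrite ltnS leq_eqVlt => /predU1P[->//|]; apply: IH.
Qed.

Lemma num_mod K f j : j <= K ->
  num K f = num j f + num K (fun i => if i < j then 0 else f i) /\
  2 ^ offset j %| num K (fun i => if i < j then 0 else f i).
Proof.
move/subnKC <-; elim: (K - j) => [|i [IH1 IH2]].
  rewrite addn0; have -> : num j (fun i => if i < j then 0 else f i) = 0.
    by rewrite /num big1 // => i _; rewrite ltn_ord.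
  by rewrite addn0 dvdn0.
rewrite addnS !numS ltnNge leq_addr /=; split; first by rewrite IH1 addnA.
rewrite dvdn_add // dvdn_mull // dvdn_exp2l // offset_mono //; lia.
Qed.

(** The parts above digit j are multiples of 2^(offset j). The numerals differ by less than half of
    this, and so do their low parts, thanks to the free top bit of each digit; hence the high parts
    coincide. *)
Lemma num_close K f g j : j <= K -> (forall i, i < K -> 2 * f i < 2 ^ blockw i) ->
  (forall i, i < K -> 2 * g i < 2 ^ blockw i) ->
  2 * num K f < 2 * num K g + 2 ^ offset j -> 2 * num K g < 2 * num K f + 2 ^ offset j ->
  forall i, j <= i < K -> f i = g i.
Proof.
move=> le_jK hf hg; have [ef /dvdnP[u eu]] := num_mod f le_jK.
have [eg /dvdnP[v ev]] := num_mod g le_jK; rewrite ef eg => lt1 lt2.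
have := num_guard (fun i lt => hf i (leq_trans lt le_jK)).
have := num_guard (fun i lt => hg i (leq_trans lt le_jK)) => gg gf.
have eq_uv : u = v.
  move: lt1 lt2; rewrite eu ev; move: (2 ^ offset j) gg gf => w.
  move: (num j f) (num j g) => x y; nia.
have := @num_inj K _ _ _ _ (etrans eu (etrans (congr1 (muln^~ _) eq_uv) (esym ev))).
move=> inj i /andP[le_ji lt_iK]; have := inj _ _ i lt_iK; rewrite ltnNge le_ji /=; apply.
  by move=> l /hf; case: ifP => _; rewrite ?expn_gt0 //; lia.
by move=> l /hg; case: ifP => _; rewrite ?expn_gt0 //; lia.
Qed.

(* The product of the first [k] block primes is at least [2 ^ (offset k - loss k)]. *)
Definition loss k := k ^ 2 + 6 * k.
Definition labsize k := (3 * offset k) %/ 8.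

Lemma offset_cubic k : k ^ 3 <= 3 * offset k.
Proof.
elim: k => [|k IH] //; rewrite offsetS /blockw; move: IH; rewrite !expnS expn0; nia.
Qed.

(** Each factor falls short of 2^(blockw i) by at most 2 i + 7 bits, and 2 i + 7 is the increment of
    [loss]. *)
Lemma block_prime_prod j k : j <= k ->
  2 ^ (offset k + loss j) <= (\prod_(j <= i < k) block_prime i) * 2 ^ (offset j + loss k).
Proof.
move/subnKC <-; elim: (k - j) => [|i IH].
  by rewrite addn0 big_geq // mul1n.
rewrite addnS big_nat_recr ?leq_addr //= offsetS.
have [_ /ltnW lt_q _] := block_primeP (j + i).
have -> : offset (j + i) + blockw (j + i) + loss j =
    offset (j + i) + loss j + (j + i + 2) ^ 2 + (2 * (j + i) + 7).
  by rewrite /blockw !expnS expn0; lia.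
have -> : offset j + loss (j + i).+1 = offset j + loss (j + i) + (2 * (j + i) + 7).
  by rewrite /loss !expnS expn0; lia.
rewrite 2!(expnD 2 _ (2 * (j + i) + 7)) (expnD 2 _ ((j + i + 2) ^ 2)).
apply: leq_trans (leq_mul (leq_mul IH lt_q) (leqnn _)) _.
by rewrite mulnA leq_mul2r mulnAC leqnn orbT.
Qed.

Lemma loss_small C k : 1 <= C -> 6 * C <= k -> C * loss k <= offset k.
Proof.
move=> C0 leCk; have := offset_cubic k; rewrite /loss !expnS expn0 !muln1 mulnA => h4.
have h1 : 6 * (C * k) <= k * k by rewrite mulnA leq_mul2r leCk orbT.
have h2 : 6 * (C * k * k) <= k * k * k by rewrite mulnA leq_mul2r h1 orbT.
have h3 : 6 * (k * k) <= k * k * k by rewrite -[k * k * k]mulnA leq_mul2r (_ : 6 <= k) ?orbT //; lia.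
have -> : C * (k * k + 6 * k) = C * k * k + 6 * (C * k) by rewrite mulnDr mulnA mulnCA.
move: h1 h2 h3 h4; move: (offset k) (k * k * k) (k * k) (C * k * k) (C * k) => o a b c d; lia.
Qed.

(* The ratio 3/8 in [labsize]: a product of two labels is well below the product of the
   block primes, hence determined by its residues, and intervals of length [2 ^ n] contain
   about [2 ^ (3 n / 8)] elements. *)
Definition label k p :=
  [&& (0 < k) && (128 * loss k <= offset k), prime p, 2 ^ labsize k.-1 < p, p <= 2 ^ labsize k &
    all (fun i => block_prime i != p) (iota 0 k)].

(* The summand [2 ^ ((i + 3) ^ 2)] counts, in a sum, how many terms have a digit [i]: the
   levels of the two terms can be read off. *)
Definition digit k p i := if i < k then 2 ^ ((i + 3) ^ 2) + dlog i p else 0.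
Definition elt k p := num k (digit k p).

Lemma digit_lt k p i : 2 * digit k p i < 2 ^ blockw i.
Proof.
rewrite /digit /blockw addn2 !(expnS 2); have := dlog_lt i p.
by case: ifP => _; move: (2 ^ (i + 3) ^ 2) => u; lia.
Qed.

Lemma elt_widen K k p : k <= K -> elt k p = num K (digit k p).
Proof.
move/subnKC <-; elim: (K - k) => [|i IH]; first by rewrite addn0.
by rewrite addnS numS -IH /digit ltnNge leq_addr mul0n addn0.
Qed.

Lemma elt_lt k p : 2 * elt k p < 2 ^ offset k.
Proof. by apply: num_guard => i _; apply: digit_lt. Qed.

Lemma elt_ge k p : 0 < k -> 2 ^ offset k <= 4 * elt k p.
Proof.
case: k => // k _; rewrite /elt numS /digit ltnSn offsetS /blockw addn2 expnD !(expnS 2).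
by move: (2 ^ offset k) (2 ^ (k + 3) ^ 2) (dlog _ _) (num _ _) => u v x y; nia.
Qed.

Lemma label_ndvd k p i : label k p -> i < k -> ~~ (block_prime i %| p).
Proof.
case/and5P => _ p_pr _ _ /allP ne lt_ik; rewrite dvdn_prime2 ?block_prime_prime //.
by apply: ne; rewrite mem_iota.
Qed.

Lemma labsize_mono j k : j <= k -> labsize j <= labsize k.
Proof. by move=> le_jk; rewrite /labsize leq_div2r // leq_mul2l offset_mono. Qed.

Lemma label_uniq k k' p : label k p -> label k' p -> k = k'.
Proof.
wlog: k k' / k <= k' => [hw l1 l2|le_kk'].
  by case/orP: (leq_total k k') => h; [apply: hw | apply/esym/hw].
move=> /and5P[_ _ _ le_p _] /and5P[_ _ gt_p _ _].
move: le_kk'; rewrite leq_eqVlt => /predU1P[//|lt].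
have := leq_trans gt_p le_p; rewrite ltn_exp2l // ltnNge labsize_mono //; lia.
Qed.

Lemma block_prime_inj i j : block_prime i = block_prime j -> i = j.
Proof.
wlog: i j / i <= j => [hw e|].
  by case/orP: (leq_total i j) => h; [apply: hw | apply/esym/hw].
rewrite leq_eqVlt => /predU1P[//|lt] e.
have [_ _ le_i] := block_primeP i; have [_ gt_j _] := block_primeP j.
have := leq_trans gt_j (leq_trans (eq_leq (esym e)) le_i).
rewrite ltn_exp2l // ltnNge leq_exp2r //; lia.
Qed.

Lemma dvdn_block_prod j k n : (forall i, j <= i < k -> block_prime i %| n) ->
  \prod_(j <= i < k) block_prime i %| n.
Proof.
case: (leqP j k) => [le_jk|lt_kj _]; last by rewrite big_geq ?dvd1n // ltnW.
rewrite -(subnKC le_jk); elim: (k - j) => [|i IH] h.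
  by rewrite addn0 big_geq // dvd1n.
rewrite addnS big_nat_recr ?leq_addr //= Gauss_dvd.
  rewrite IH => [|l /andP[le lt]]; last by apply: h; rewrite le addnS ltnW.
  by rewrite h // leq_addr addnS ltnSn.
rewrite coprime_sym prime_coprime ?block_prime_prime //.
rewrite Euclid_dvd_prod ?block_prime_prime //.
rewrite big_has_cond; apply/hasPn => l; rewrite mem_index_iota => /andP[_ lt].
rewrite /= dvdn_prime2 ?block_prime_prime //.
apply/eqP => /block_prime_inj e; by rewrite e ltnn in lt.
Qed.

Lemma eqn_mod_block_prod j k m n : (forall i, j <= i < k -> m = n %[mod block_prime i]) ->
  m = n %[mod \prod_(j <= i < k) block_prime i].
Proof.
wlog: m n / n <= m => [hw h|le_nm h].
  case/orP: (leq_total n m) => le; first exact: hw.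
  by apply/esym/hw => // i /h.
by apply/eqP; rewrite eqn_mod_dvd //; apply: dvdn_block_prod => i /h /eqP; rewrite eqn_mod_dvd.
Qed.

Lemma labsize_le k : 8 * labsize k <= 3 * offset k.
Proof. by rewrite /labsize mulnC leq_divM. Qed.

Lemma label_loss k p : label k p -> 128 * loss k <= offset k.
Proof. by case/and5P => /andP[]. Qed.

Lemma label_le k p : label k p -> p <= 2 ^ labsize k.
Proof. by case/and5P. Qed.

Lemma label_prime k p : label k p -> prime p.
Proof. by case/and5P. Qed.

Lemma label_gt0 k p : label k p -> 0 < k.
Proof. by case/and5P => /andP[]. Qed.

Lemma block_prod_ge j k n : j <= k -> n + offset j + loss k <= offset k + loss j ->
  2 ^ n <= \prod_(j <= i < k) block_prime i.
Proof.
move=> le_jk le_n; have := block_prime_prod le_jk.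
have : 2 ^ (n + offset j + loss k) <= 2 ^ (offset k + loss j) by rewrite leq_exp2l.
rewrite -addnA expnD => h1 h2; have := leq_trans h1 h2.
by rewrite leq_mul2r expn_eq0.
Qed.

Lemma mod_eq_small m n d : m < d -> n < d -> m = n %[mod d] -> m = n.
Proof. by move=> lm ln; rewrite !modn_small. Qed.

(** The digits from k2 on give p1 = p3 modulo the high block primes, the lower ones p1 p2 = p3 p4
    modulo the low block primes. If the high product exceeds the labels, p1 = p3 at once. Otherwise,
    up to losses, offset k2 > (5/8) offset k1, so that p1 p2 has at most 3/8 (8/5 + 1) offset k2 =
    (39/40) offset k2 bits and is determined by its residues; unique factorization concludes. With c
    for 3/8 this is the condition c + c / (1 - c) < 1. *)
Lemma label_sidon k1 k2 p1 p2 p3 p4 : k2 <= k1 ->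
  label k1 p1 -> label k2 p2 -> label k1 p3 -> label k2 p4 ->
  (forall i, i < k2 -> dlog i p1 + dlog i p2 = dlog i p3 + dlog i p4) ->
  (forall i, k2 <= i < k1 -> dlog i p1 = dlog i p3) ->
  p1 = p3 /\ p2 = p4 \/ [/\ k1 = k2, p1 = p4 & p2 = p3].
Proof.
move=> le_k l1 l2 l3 l4 low high.
have lo1 := label_loss l1; have lo2 := label_loss l2.
have x1 := labsize_le k1; have x2 := labsize_le k2.
have ofs := offset_mono le_k.
have small p k : label k p -> p < 2 ^ (labsize k).+1.
  by move/label_le => h; apply: leq_ltn_trans h _; rewrite ltn_exp2l.
have eq13_done : p1 = p3 -> p1 = p3 /\ p2 = p4.
  move=> e13; split=> //; apply: (@mod_eq_small _ _ (\prod_(0 <= i < k2) block_prime i)).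
  - apply: leq_trans (small _ _ l2) _; apply: block_prod_ge => //.
    by rewrite {1}/offset big_ord0 /loss /=; move: (label_gt0 l2) lo2; rewrite /loss; nia.
  - apply: leq_trans (small _ _ l4) _; apply: block_prod_ge => //.
    by rewrite {1}/offset big_ord0 /loss /=; move: (label_gt0 l2) lo2; rewrite /loss; nia.
  apply: eqn_mod_block_prod => i /= lt_i; apply: dlog_inj.
  - exact: label_ndvd l2 _.
  - exact: label_ndvd l4 _.
  by have := low i lt_i; rewrite e13 => /addnI.
case: (leqP ((labsize k1).+1 + offset k2 + loss k1) (offset k1 + loss k2)) => [far|near].
  left; apply: eq13_done; apply: (@mod_eq_small _ _ (\prod_(k2 <= i < k1) block_prime i)).
  - by apply: leq_trans (small _ _ l1) _; apply: block_prod_ge.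
  - by apply: leq_trans (small _ _ l3) _; apply: block_prod_ge.
  apply: eqn_mod_block_prod => i /andP[le_i lt_i]; apply: dlog_inj.
  - exact: label_ndvd l1 _.
  - exact: label_ndvd l3 _.
  by apply: high; rewrite le_i.
have eq_prod : p1 * p2 = p3 * p4.
  apply: (@mod_eq_small _ _ (\prod_(0 <= i < k2) block_prime i)).
  - apply: leq_trans (ltn_mul (small _ _ l1) (small _ _ l2)) _.
    rewrite -expnD; apply: block_prod_ge => //.
    rewrite {1}/offset big_ord0 {2}/loss /=; move: (label_gt0 l2) => k2_gt0.
    have : 2 <= loss k2 by rewrite /loss; nia.
    lia.
  - apply: leq_trans (ltn_mul (small _ _ l3) (small _ _ l4)) _.
    rewrite -expnD; apply: block_prod_ge => //.
    rewrite {1}/offset big_ord0 {2}/loss /=; move: (label_gt0 l2) => k2_gt0.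
    have : 2 <= loss k2 by rewrite /loss; nia.
    lia.
  apply: eqn_mod_block_prod => i /= lt_i; apply: dlogD_inj.
  - exact: label_ndvd l1 (leq_trans lt_i le_k).
  - exact: label_ndvd l2 _.
  - exact: label_ndvd l3 (leq_trans lt_i le_k).
  - exact: label_ndvd l4 _.
  exact: low.
have : p1 %| p3 * p4 by rewrite -eq_prod dvdn_mulr.
rewrite Euclid_dvdM ?(label_prime l1) // !dvdn_prime2 ?(label_prime l1, label_prime l3, label_prime l4) //.
case/orP => /eqP e; first by left; apply: eq13_done.
right; split=> //; first by apply: (label_uniq l1); rewrite e.
by apply/eqP; move/eqP: eq_prod; rewrite e mulnC eqn_pmul2r ?prime_gt0 ?(label_prime l4).
Qed.

Lemma elt_sidon k1 k2 k3 k4 p1 p2 p3 p4 :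
  label k1 p1 -> label k2 p2 -> label k3 p3 -> label k4 p4 ->
  elt k1 p1 + elt k2 p2 = elt k3 p3 + elt k4 p4 ->
  [/\ k1 = k3, p1 = p3, k2 = k4 & p2 = p4] \/ [/\ k1 = k4, p1 = p4, k2 = k3 & p2 = p3].
Proof.
pose K := maxn (maxn k1 k2) (maxn k3 k4) => l1 l2 l3 l4.
rewrite !(@elt_widen K); try by rewrite /K; lia.
have numD f g : num K f + num K g = num K (fun i => f i + g i).
  by rewrite /num -big_split; apply: eq_bigr => i _; rewrite mulnDl.
rewrite !numD => /num_inj eqd0.
have eqd i : digit k1 p1 i + digit k2 p2 i = digit k3 p3 i + digit k4 p4 i.
  case: (ltnP i K) => [lt|ge]; last by rewrite /digit; do ! (case: ltnP => ? /=); lia.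
  apply: eqd0 => // j _.
    by have := digit_lt k1 p1 j; have := digit_lt k2 p2 j; lia.
  by have := digit_lt k3 p3 j; have := digit_lt k4 p4 j; lia.
have eqc i : (i < k1) + (i < k2) = (i < k3) + (i < k4).
  have := eqd i; have := dlog_lt i p1; have := dlog_lt i p2.
  have := dlog_lt i p3; have := dlog_lt i p4; rewrite /digit.
  by do ! (case: ltnP => ? /=); lia.
have levels : k1 = k3 /\ k2 = k4 \/ k1 = k4 /\ k2 = k3.
  by have := eqc k1; have := eqc k2; have := eqc k3; have := eqc k4; lia.
have main a b q1 q2 q3 q4 : label a q1 -> label b q2 -> label a q3 -> label b q4 ->
    (forall i, digit a q1 i + digit b q2 i = digit a q3 i + digit b q4 i) ->
    q1 = q3 /\ q2 = q4 \/ [/\ a = b, q1 = q4 & q2 = q3].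
  wlog le_ba : a b q1 q2 q3 q4 / b <= a => [hw h1 h2 h3 h4 e|h1 h2 h3 h4 e].
    case/orP: (leq_total b a) => le; first exact: hw.
    case: (hw b a q2 q1 q4 q3 le) => // [i|[-> ->]|[-> -> ->]].
    - by rewrite ![digit b _ _ + _]addnC.
    - by left.
    - by right.
  apply: label_sidon => // i; first by move=> lt; have := e i; rewrite /digit lt (leq_trans lt le_ba); lia.
  by case/andP => ge lt; have := e i; rewrite /digit lt ltnNge ge /=; lia.
case: levels => [[e1 e2]|[e1 e2]]; subst.
  case: (main _ _ _ _ _ _ l1 l2 l3 l4 eqd) => [[-> ->]|[-> -> ->]]; [by left|by right].
have eqd' i : digit k4 p1 i + digit k3 p2 i = digit k4 p4 i + digit k3 p3 i.
  by rewrite eqd addnC.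
by case: (main _ _ _ _ _ _ l1 l2 l4 l3 eqd') => [[-> ->]|[-> -> ->]]; [right|left].
Qed.

(* Chosen so that every class mod 64 is [t1 + t2 + x] with tags [t1], [t2] and [x] not of the
   form [t + t' - t'']; see [free_tag_cover]. *)
Definition tags : seq nat := [:: 0; 1; 4; 13].
Definition tag k := nth 0 tags (k %% 4).

Definition dense_sidon : pred nat := fun n =>
  `[< exists k p, label k p /\ n = 64 * elt k p + tag k >].

Lemma dense_sidonP n :
  reflect (exists k p, label k p /\ n = 64 * elt k p + tag k) (dense_sidon n).
Proof. exact: asboolP. Qed.

Lemma tag_in k : tag k \in tags.
Proof. by rewrite mem_nth // ltn_mod. Qed.

Lemma tag_lt k : tag k < 32.
Proof. by have := tag_in k; rewrite !inE => /or4P[]/eqP->. Qed.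

Definition sidon_pred (A : pred nat) := forall a b c d, A a -> A b -> A c -> A d ->
  a + b = c + d -> a = c /\ b = d \/ a = d /\ b = c.

Lemma dense_sidon_sidon : sidon_pred dense_sidon.
Proof.
move=> a b c d /dense_sidonP[k1 [p1 [l1 ->]]] /dense_sidonP[k2 [p2 [l2 ->]]].
move=> /dense_sidonP[k3 [p3 [l3 ->]]] /dense_sidonP[k4 [p4 [l4 ->]]] eqs.
(* Two tags add up to less than 64, so the quotients by 64 can be compared. *)
have eqe : elt k1 p1 + elt k2 p2 = elt k3 p3 + elt k4 p4.
  move: eqs; have := tag_lt k1; have := tag_lt k2; have := tag_lt k3; have := tag_lt k4.
  lia.
by case: (elt_sidon l1 l2 l3 l4 eqe) => -[-> -> -> ->]; [left|right].
Qed.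

Lemma dense_sidon_gt0 n : dense_sidon n -> 0 < n.
Proof.
case/dense_sidonP => k [p [l ->]]; have := elt_ge p (label_gt0 l).
by have : 0 < 2 ^ offset k; [rewrite expn_gt0 | lia].
Qed.

Lemma dense_sidon_mod n : dense_sidon n -> n %% 64 \in tags.
Proof.
case/dense_sidonP => k [p [l ->]]; rewrite mulnC modnMDl modn_small ?tag_in //.
by apply: leq_trans (tag_lt k) _.
Qed.

(** * Local and global density of the Sidon set *)

Lemma eventually_small C : exists K, forall k, K <= k ->
  C * loss k <= offset k /\ C * blockw k <= offset k.
Proof.
exists (6 * (2 * C).+1) => k le_k; have := @loss_small (2 * C).+1 k isT le_k.
have : blockw k <= 2 * loss k by rewrite /blockw /loss !expnS expn0; nia.
move: (loss k) (blockw k) (offset k) => l b o h1 h2.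
have h3 : C * b <= C * (2 * l) by rewrite leq_mul2l h1 orbT.
by split; nia.
Qed.

(** Elements of one level within 2^(n+1) of each other share all digits beyond about n bits, hence
    their labels agree modulo the product of the corresponding block primes. This leaves 3/8 offset
    k0 - (offset k0 - n) <= 3 n / 8 free bits, up to losses. *)
Lemma label_count_near : exists n1, forall n k0 p0, n1 <= n -> label k0 p0 ->
  exists L : seq nat, size L <= 2 ^ ((151 * n) %/ 400).-1 /\
   forall p, label k0 p -> 2 * elt k0 p < 2 * elt k0 p0 + 2 ^ n.+2 ->
     2 * elt k0 p0 < 2 * elt k0 p + 2 ^ n.+2 -> p \in L.
Proof.
(* The slack 151/400 - 3/8 = 1/400 absorbs [loss] and one digit width, each at most 1/2000 of the
   length. *)
have [K hK] := eventually_small 2000; exists (offset K + 4000) => n k0 p0 le_n l0.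
have x0 := labsize_le k0; have pos m : 0 < 2 ^ m by rewrite expn_gt0.
case: (ltnP (offset k0) n.+2) => [lt_k0|ge_k0].
  exists (iota 0 (2 ^ labsize k0).+1); rewrite size_iota; split=> [|p /label_le le_p _ _].
    apply: leq_trans (_ : 2 ^ (labsize k0).+1 <= _); last by rewrite leq_exp2l //; lia.
    by rewrite expnS; have := pos (labsize k0); lia.
  by rewrite mem_iota.
have ex_i : exists i, n.+2 <= offset i by exists k0.
(* The digits from [i] on are forced; by minimality [offset i] exceeds n by little more than one
   digit width. *)
pose i := ex_minn ex_i; have [le_i min_i] : n.+2 <= offset i /\ forall j, n.+2 <= offset j -> i <= j.
  by rewrite /i; case: ex_minnP.
have le_ik : i <= k0 by apply: min_i.
have gt_iK : K < i.
  by rewrite ltnNge; apply/negP => /offset_mono; move: le_i; lia.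
case def_i : i gt_iK => [//|j]; rewrite ltnS => le_Kj.
have lt_j : offset j < n.+2 by rewrite ltnNge; apply/negP => /min_i; rewrite def_i ltnn.
have le_Kk : K <= k0 by move: le_ik; rewrite def_i; lia.
have [_ bj] := hK _ le_Kj; have [lossk _] := hK _ le_Kk.
have ofs_i : offset i = offset j + blockw j by rewrite def_i offsetS.
have ofs_ik := offset_mono le_ik.
set R := \prod_(i <= l < k0) block_prime l.
have modR p : label k0 p -> 2 * elt k0 p < 2 * elt k0 p0 + 2 ^ n.+2 ->
    2 * elt k0 p0 < 2 * elt k0 p + 2 ^ n.+2 -> p = p0 %[mod R].
  move=> lp lt1 lt2; apply: eqn_mod_block_prod => l /andP[ge_l lt_l].
  apply: dlog_inj; [exact: label_ndvd lp _ | exact: label_ndvd l0 _ | ].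
  have le2 : 2 ^ n.+2 <= 2 ^ offset i by rewrite leq_exp2l.
  have hd q m : m < k0 -> 2 * digit k0 q m < 2 ^ blockw m by move=> _; apply: digit_lt.
  have := num_close le_ik (hd p) (hd p0) (leq_trans lt1 _) (leq_trans lt2 _).
  rewrite !leq_add2l le2 => /(_ isT isT l).
  by rewrite ge_l lt_l /digit lt_l => /(_ isT) /addnI.
have R0 : 0 < R by rewrite /R big_seq prodn_cond_gt0 // => l _; rewrite prime_gt0 ?block_prime_prime.
case: (leqP ((labsize k0).+1 + offset i + loss k0) (offset k0 + loss i)) => [far|near].
  exists [:: p0]; split=> [|p lp lt1 lt2]; first exact: pos.
  have le_R : 2 ^ (labsize k0).+1 <= R by apply: block_prod_ge; rewrite //.
  have lt_R p' : label k0 p' -> p' < R.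
    by move/label_le => h; apply: leq_trans le_R; apply: leq_ltn_trans h _; rewrite ltn_exp2l.
  rewrite inE; apply/eqP; apply: (@mod_eq_small _ _ R); rewrite ?lt_R //; exact: modR.
(* A lower bound for the number of bits of [R]; subtraction is truncated, and D = 0 is harmless. *)
pose D := offset k0 + loss i - (offset i + loss k0).
exists [seq p0 %% R + R * l | l <- iota 0 (2 ^ labsize k0 %/ R).+1]; split; last first.
  move=> p lp lt1 lt2; apply/mapP; exists (p %/ R).
    by rewrite mem_iota /= add0n ltnS leq_div2r ?label_le.
  by rewrite -(modR p) // addnC mulnC -divn_eq.
rewrite size_map size_iota.
have le_DR : 2 ^ D <= R.
  rewrite /D; case: (leqP (offset i + loss k0) (offset k0 + loss i)) => [le|/ltnW].
    by apply: block_prod_ge; rewrite //; lia.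
  by rewrite -subn_eq0 => /eqP ->.
have le_q : 2 ^ labsize k0 %/ R <= 2 ^ (labsize k0 - D).
  rewrite -ltnS ltn_divLR // mulSn.
  apply: leq_ltn_trans (_ : 2 ^ (labsize k0 - D) * 2 ^ D < _).
    by rewrite -expnD leq_exp2l //; lia.
  apply: leq_ltn_trans (_ : 2 ^ (labsize k0 - D) * R < _).
    by rewrite leq_mul2l le_DR orbT.
  by rewrite -[ltnLHS]add0n ltn_add2r.
apply: leq_trans (_ : 2 ^ (labsize k0 - D).+1 <= _).
  by rewrite expnS; have := pos (labsize k0 - D); lia.
by rewrite leq_exp2l //; rewrite /D; lia.
Qed.

(** Elements of a higher level are larger by a constant factor, so two elements of different levels
    can be close only if both are as small as their distance. *)
Lemma elt_close_level k k0 p p0 n : label k p -> label k0 p0 -> k != k0 ->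
  2 * elt k p < 2 * elt k0 p0 + 2 ^ n.+2 -> 2 * elt k0 p0 < 2 * elt k p + 2 ^ n.+2 ->
  offset k <= n + 4.
Proof.
have step k' : 0 < k' -> 2 ^ offset k'.-1 * 4 <= 2 ^ offset k'.
  by case: k' => // k' _; rewrite offsetS (_ : 4 = 2 ^ 2) // -expnD leq_exp2l //= leq_add2l /blockw leq_addl.
have concl x a b : 4 * a <= x -> x <= 4 * b -> 2 * b < a + 2 ^ n.+2 -> x <= 2 ^ n.+4.
  by rewrite !(expnS 2); move: (2 ^ n) => u h1 h2 h3; lia.
move=> l l0 ne lt1 lt2; rewrite -(@leq_exp2l 2) // addn4.
have [e1 e2] := (elt_lt k p, elt_ge p (label_gt0 l)).
have [e3 e4] := (elt_lt k0 p0, elt_ge p0 (label_gt0 l0)).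
case: (ltnP k k0) => [lt|].
  have le : 2 ^ offset k <= 2 ^ offset k0.-1 by rewrite leq_exp2l // offset_mono; lia.
  apply: leq_trans (_ : 2 ^ offset k0 <= _); first by rewrite leq_exp2l // (offset_mono (ltnW lt)).
  apply: concl (leq_trans _ (step _ (label_gt0 l0))) e4 lt2.
  by rewrite mulnC leq_mul2r; lia.
rewrite leq_eqVlt eq_sym (negbTE ne) /= => lt.
have le : 2 ^ offset k0 <= 2 ^ offset k.-1 by rewrite leq_exp2l // offset_mono; lia.
apply: concl (leq_trans _ (step _ (label_gt0 l))) e2 lt1.
by rewrite mulnC leq_mul2r; lia.
Qed.

(** Everything is compared with one element of the list: those of the same level are counted by
    [label_count_near], those of other levels have labels of at most 3 (n + 4) / 8 bits. A label
    determines its element. *)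
Lemma dense_sidon_local : exists n1, forall n t (s : seq nat), n1 <= n -> uniq s ->
  (forall a, a \in s -> [/\ dense_sidon a, a < t + 2 ^ n & t < a + 2 ^ n]) ->
  size s <= 2 ^ ((151 * n) %/ 400).
Proof.
have [n1 near] := label_count_near; exists (n1 + 4000) => n t s le_n us hs.
case: s => [|a0 s'] in us hs *; first by [].
set s := a0 :: s' in us hs *.
have exf a : exists kp : nat * nat, dense_sidon a ->
    label kp.1 kp.2 /\ a = 64 * elt kp.1 kp.2 + tag kp.1.
  case: (pselect (dense_sidon a)) => [/dense_sidonP[k [p lp]]|]; first by exists (k, p).
  by exists (0, 0).
have [f fP] := choice exf.
have [A0 lt01 lt02] := hs a0 (mem_head _ _); have [l0 e0] := fP a0 A0.
have [L [sL inL]] := near n _ _ (leq_trans (leq_addr _ _) le_n) l0.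
pose L1 := iota 0 (2 ^ ((3 * (n + 4)) %/ 8)).+1.
have inj : {in s &, injective (fun a => (f a).2)}.
  move=> a b /hs[Aa _ _] /hs[Ab _ _] e; have [la ea] := fP a Aa.
  have [lb eb] := fP b Ab; rewrite e in la ea.
  by rewrite ea (label_uniq la lb) -eb.
have : {subset [seq (f a).2 | a <- s] <= L1 ++ L}.
  move=> _ /mapP[a sa ->]; have [Aa lt1 lt2] := hs a sa; have [la ea] := fP a Aa.
  rewrite mem_cat; have [te te0] := (tag_lt (f a).1, tag_lt (f a0).1).
  have close1 : 2 * elt (f a).1 (f a).2 < 2 * elt (f a0).1 (f a0).2 + 2 ^ n.+2.
    by rewrite !(expnS 2); move: ea e0 lt1 lt2 lt01 lt02 (ltn_expl n (ltnSn 1)) le_n; lia.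
  have close2 : 2 * elt (f a0).1 (f a0).2 < 2 * elt (f a).1 (f a).2 + 2 ^ n.+2.
    by rewrite !(expnS 2); move: ea e0 lt1 lt2 lt01 lt02 (ltn_expl n (ltnSn 1)) le_n; lia.
  case: (eqVneq (f a).1 (f a0).1) => [ek|ne].
    by apply/orP; right; rewrite ek in la close1 close2; apply: inL la _ _.
  apply/orP; left; rewrite mem_iota /= add0n ltnS; apply: leq_trans (label_le la) _.
  rewrite leq_exp2l //; have := elt_close_level la l0 ne close1 close2.
  by rewrite /labsize => h; apply: leq_div2r; rewrite leq_mul2l h orbT.
move=> sub; have us' : uniq [seq (f a).2 | a <- s] by rewrite map_inj_in_uniq.
have := uniq_leq_size us' sub; rewrite size_map => h; apply: leq_trans h _.
rewrite size_cat size_iota.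
have E : 2 ^ ((151 * n) %/ 400) = 2 ^ ((151 * n) %/ 400).-1 + 2 ^ ((151 * n) %/ 400).-1.
  by rewrite addnn -mul2n -expnS prednK // divn_gt0 //; lia.
rewrite E leq_add //; apply: leq_ltn_trans (_ : 2 ^ ((151 * n) %/ 400).-2 < _).
  by rewrite leq_exp2l //; lia.
by rewrite ltn_exp2l //; lia.
Qed.

Lemma offset_lt k : offset k < 2 ^ (3 * k + 7).
Proof.
have blk j : blockw j < 2 ^ (2 * j + 6).
  rewrite /blockw; elim: j => [//|j]; have -> : 2 * j.+1 + 6 = (2 * j + 6).+2 by lia.
  by rewrite !(expnS 2) !expnS !expn0; move: (2 ^ (2 * j + 6)) => u; nia.
elim: k => [|k IH]; first by rewrite /offset big_ord0.
rewrite offsetS; have -> : 3 * k.+1 + 7 = (3 * k + 7).+3 by lia.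
have : 2 ^ (2 * k + 6) <= 2 ^ (3 * k + 7) by rewrite leq_exp2l //; lia.
by have := blk k; rewrite !(expnS 2); lia.
Qed.

(** The logarithmic factor of the prime count is at most 2^(3 k + 7), and the primes below 2^u
    together with the k block primes are few; all this costs only 3 k + 9 bits. *)
Lemma label_count k u v : 0 < k -> 128 * loss k <= offset k ->
  u = labsize k.-1 -> v = labsize k -> u + 4 * k + 12 <= v ->
  2 ^ (v - (3 * k + 9)) <= size [seq p <- index_iota (2 ^ u).+1 (2 ^ v).+1 | label k p].
Proof.
move=> k_gt0 lossk eu ev le_uv; set Ls := seq.filter _ _.
have v0 : 0 < v by lia.
have := @dyadic_prime_count u v.-1 ltac:(lia); rewrite prednK // -big_filter sum1_size.
set Ps := seq.filter _ _ => count.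
have sub : {subset Ps <= Ls ++ [seq block_prime i | i <- iota 0 k]}.
  move=> p; rewrite mem_filter mem_cat => /andP[pp pi].
  case: (boolP (p \in map _ _)) => [_|nin]; rewrite ?orbT // orbF mem_filter pi andbT.
  move: pi; rewrite mem_index_iota ltnS => /andP[gt le].
  rewrite /label k_gt0 lossk pp -eu gt -ev le /=; apply/allP => i ii.
  by apply: contraNneq nin => <-; apply: map_f.
have := uniq_leq_size (filter_uniq _ (iota_uniq _ _)) sub.
rewrite size_cat size_map size_iota => szP.
have v_lt : v <= 2 ^ (3 * k + 7).
  by have := offset_lt k; have := labsize_le k; rewrite -ev; lia.
have : 2 ^ v.-1 <= 2 ^ (3 * k + 7) * (2 ^ u + 1 + k + size Ls).
  apply: leq_trans count _; apply: leq_mul => //.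
  by rewrite -[leqRHS]addnA leq_add2l [k + _]addnC.
have -> : v.-1 = 3 * k + 7 + (v - (3 * k + 9)).+1 by lia.
rewrite expnD leq_pmul2l ?expn_gt0 // expnS; move: (size Ls) => L.
have : 2 ^ u + 1 + k <= 2 ^ (v - (3 * k + 9)).
  have -> : v - (3 * k + 9) = (v - (3 * k + 10)).+1 by lia.
  have h1 : 2 ^ u.+2 <= 2 ^ (v - (3 * k + 10)) by rewrite leq_exp2l //; lia.
  have h2 : 2 ^ k <= 2 ^ (v - (3 * k + 10)).
    rewrite leq_exp2l //; lia.
  have := ltn_expl k (ltnSn 1); rewrite !(expnS 2) in h1 *.
  by have : 0 < 2 ^ u; [rewrite expn_gt0 | lia].
lia.
Qed.

(** One level already has enough elements. The tag depends on the level mod 4, and four consecutive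
    digits are short compared with the whole, so the largest fitting level can be taken in any
    residue class. The exponent 37/100 lies below 3/8. *)
Lemma dense_sidon_many r : r < 4 -> exists n0, forall n, n0 <= n ->
  exists s : seq nat, [/\ uniq s,
    forall a, a \in s -> [/\ dense_sidon a, a < 2 ^ n & a %% 64 = nth 0 tags r] &
    2 ^ ((37 * n) %/ 100) <= size s].
Proof.
move=> r_lt4; have [K hK] := eventually_small 2000.
have [k1 k1_mod k1_ge] : exists2 k1, k1 %% 4 = r & K + 100 <= k1.
  by exists ((K + 100) * 4 + r); [rewrite modnMDl modn_small | lia].
exists (offset k1 + 4000) => n le_n.
have ofs_ge k : k <= offset k.
  by elim: k => // k IH; rewrite offsetS /blockw; move: (_ ^ 2) => x; lia.
have exP : exists k, (k %% 4 == r) && (offset k + 6 <= n).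
  by exists k1; rewrite k1_mod eqxx; lia.
have ubP k : (k %% 4 == r) && (offset k + 6 <= n) -> k <= n.
  by case/andP => _ h; have := ofs_ge k; lia.
case: (ex_maxnP exP ubP) => k /andP[/eqP k_mod k_le] max_k.
have k_gt : n < offset (k + 4) + 6.
  rewrite ltnNge; apply/negP => h.
  by have := max_k (k + 4); rewrite modnDr k_mod eqxx h => /(_ isT); lia.
have k_ge : K + 100 <= k.
  by apply: leq_trans k1_ge (max_k _ _); rewrite k1_mod eqxx; lia.
have [lossk bk] := hK k ltac:(lia); have [_ bk4] := hK (k + 4) ltac:(lia).
have ofs4 : offset (k + 4) <= offset k + 4 * blockw (k + 4).
  have bm i j : i <= j -> blockw i <= blockw j.
    by move=> le_ij; rewrite leq_add2r leq_exp2r // leq_add2r.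
  rewrite (_ : k + 4 = k.+4) ?addn4 // !offsetS.
  have := bm k k.+4 ltac:(lia); have := bm k.+1 k.+4 ltac:(lia).
  have := bm k.+2 k.+4 ltac:(lia); have := bm k.+3 k.+4 ltac:(lia).
  by move: (blockw k.+4) (blockw k.+3) (blockw k.+2) (blockw k.+1) => b4' b3 b2 b1' *; lia.
have big : 500 + 40 * k <= blockw k by rewrite /blockw !expnS expn0; nia.
have ofs1 : offset k = offset k.-1 + blockw k.-1 by rewrite -offsetS prednK //; lia.
have b1 : 100 + 12 * k <= blockw k.-1 by case: (k) k_ge => [|j] h; [lia|rewrite /blockw !expnS expn0 /=; nia].
pose Ls := [seq p <- index_iota (2 ^ labsize k.-1).+1 (2 ^ labsize k).+1 | label k p].
have inLs p : p \in Ls -> label k p by rewrite mem_filter => /andP[].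
exists [seq 64 * elt k p + tag k | p <- Ls]; split.
- rewrite map_inj_in_uniq ?filter_uniq ?iota_uniq // => p p' /inLs lp /inLs lp' /addIn e.
  have {}e : elt k p = elt k p' by lia.
  have e2 : elt k p + elt k p = elt k p' + elt k p' by rewrite e.
  by case: (elt_sidon lp lp lp' lp' e2) => -[].
- move=> _ /mapP[p /inLs lp ->]; split; first by apply/dense_sidonP; exists k, p.
    apply: leq_trans (_ : 2 ^ (offset k + 6) <= _); last by rewrite leq_exp2l.
    by rewrite expnD; have := elt_lt k p; have := tag_lt k; lia.
  rewrite mulnC modnMDl modn_small; last by apply: leq_trans (tag_lt k) _.
  by rewrite /tag k_mod.
rewrite size_map; apply: leq_trans (label_count _ _ erefl erefl _).
- by rewrite leq_exp2l //; rewrite /labsize; lia.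
- by lia.
- by lia.
- by rewrite /labsize; lia.
Qed.

Local Open Scope ring_scope.

(** * Random sets and chains of configurations *)

Section RandomSet.
Variables (R : realFieldType) (T : finType) (p : T -> R).
Hypothesis p01 : forall i, 0 <= p i <= 1.

Definition set_wt (C : {set T}) := \prod_i (if i \in C then p i else 1 - p i).
Definition Pr (E : pred {set T}) := \sum_(C | E C) set_wt C.

Let p_ge0 i : 0 <= p i. Proof. by case/andP: (p01 i). Qed.

Lemma set_wt_ge0 C : 0 <= set_wt C.
Proof.
by apply: prodr_ge0 => i _; case: ifP => _ //; rewrite subr_ge0; case/andP: (p01 i).
Qed.

Lemma Pr_le (E F : pred {set T}) : (forall C, E C -> F C) -> Pr E <= Pr F.
Proof.
move=> sEF; rewrite /Pr [leLHS]big_mkcond [leRHS]big_mkcond; apply: ler_sum => C _.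
by case: ifP => [/sEF->//|_]; case: ifP => _ //; apply: set_wt_ge0.
Qed.

Lemma Pr_true : Pr predT = 1.
Proof.
rewrite /Pr /set_wt -(bigA_distr _ _ p (fun i => 1 - p i)) big1 // => i _.
by rewrite /= addrC subrK.
Qed.

Lemma Pr_supset (H : {set T}) : Pr (fun C => H \subset C) = \prod_(i in H) p i.
Proof.
rewrite /Pr big_mkcond; pose g i := if i \in H then 0 else 1 - p i.
transitivity (\sum_(C : {set T}) \prod_i (if i \in C then p i else g i)).
  apply: eq_bigr => C _; case: ifPn => [/subsetP sHC|/subsetPn[i iH niC]].
    apply: eq_bigr => i _; case: ifPn => // niC; rewrite /g.
    by case: ifPn => // /sHC; rewrite (negbTE niC).
  by rewrite (bigD1 i) //= (negbTE niC) /g iH mul0r.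
rewrite -(bigA_distr _ _ p g) [RHS]big_mkcond; apply: eq_bigr => i _; rewrite /g.
by case: ifP => _; rewrite /= ?addr0 // addrC subrK.
Qed.

Lemma Pr_or (E F : pred {set T}) : Pr (fun C => E C || F C) <= Pr E + Pr F.
Proof.
rewrite /Pr [leLHS]big_mkcond [X in X + _]big_mkcond [X in _ + X]big_mkcond -big_split.
apply: ler_sum => C _ /=; have := set_wt_ge0 C; case: (E C); case: (F C) => /=; lra.
Qed.

Lemma Pr_has (I : Type) (s : seq I) (E : I -> pred {set T}) :
  Pr (fun C => has (E^~ C) s) <= \sum_(F <- s) Pr (E F).
Proof.
elim: s => [|F s IH]; first by rewrite big_nil /Pr big_pred0.
by rewrite big_cons; apply: le_trans (Pr_or _ _) (lerD (lexx _) IH).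
Qed.

(* A configuration [(d, W)] stands for the event that [d] is destroyed by the points of [W]. *)
Variable confs : seq (T * {set T}).

Fixpoint chain K (H C : {set T}) : bool :=
  if K is K'.+1 then
    has (fun F : T * {set T} => [&& F.1 \notin H, F.1 \in C, F.2 \subset C &
                   chain K' (F.1 |: F.2 :|: H) C]) confs
  else true.

(** For a head outside H, the conditional probability that the configuration lies in C, given that H
    does. Points of W already in H cost nothing; only the head has to be new. *)
Definition conf_wt (H : {set T}) (F : T * {set T}) := p F.1 * \prod_(w in F.2 :\: (F.1 |: H)) p w.

Hypothesis small_confs : forall F, F \in confs -> (#|F.2| <= 3)%N.

Lemma card_conf (F : T * {set T}) (H : {set T}) : F \in confs -> (#|F.1 |: F.2 :|: H| <= #|H| + 4)%N.
Proof.
move=> /small_confs le3; rewrite addnC -setUA (leq_trans (leq_card_setU _ _)) //.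
rewrite cards1 add1n (leq_trans _ (_ : (3 + #|H|).+1 <= _)%N) // ltnS.
by rewrite (leq_trans (leq_card_setU _ _)) // leq_add2r.
Qed.

(** Union bound over the next configuration. Including its new points multiplies the probability of
    H by [conf_wt], and H grows by at most 4 points, so each of the K steps contributes a factor rho
    as long as the hypothesis covers sets of size h. *)
Lemma Pr_chain h rho : 0 <= rho ->
  (forall H : {set T}, (#|H| <= h)%N ->
    \sum_(F <- confs | F.1 \notin H) conf_wt H F <= rho) ->
  forall K (H : {set T}), (#|H| + 4 * K <= h + 4)%N ->
  Pr (fun C => (H \subset C) && chain K H C) <= (\prod_(i in H) p i) * rho ^+ K.
Proof.
move=> rho_ge0 hrho; elim=> [|K IH] H leH.
  rewrite expr0 mulr1 -Pr_supset; apply: Pr_le => C /andP[] //.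
pose E (F : T * {set T}) (C : {set T}) := [&& F.1 \notin H, (F.1 |: F.2 :|: H) \subset C & chain K (F.1 |: F.2 :|: H) C].
apply: le_trans (_ : Pr (fun C => has (E^~ C) confs) <= _).
  apply: Pr_le => C /andP[sHC /= /hasP[F Fin /and4P[nF F1 F2 ch]]].
  by apply/hasP; exists F => //; rewrite /E nF ch !subUset sub1set F1 F2 sHC.
apply: le_trans (Pr_has _ _) _; rewrite exprS mulrCA.
apply: le_trans (_ : (\sum_(F <- confs | F.1 \notin H) conf_wt H F) *
    ((\prod_(i in H) p i) * rho ^+ K) <= _); last first.
  rewrite ler_wpM2r ?mulr_ge0 ?exprn_ge0 ?prodr_ge0 //; apply: hrho; lia.
rewrite mulr_suml [leRHS]big_mkcond big_seq [leRHS]big_seq; apply: ler_sum => F Fin.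
case: ifPn => nF; last first.
  by rewrite /Pr big1 // => C; rewrite /E (negbTE nF).
apply: le_trans (_ : Pr (fun C => (F.1 |: F.2 :|: H \subset C) && chain K (F.1 |: F.2 :|: H) C) <= _).
  by apply: Pr_le => C /and3P[_ -> ->].
apply: le_trans (IH _ _) _; first by rewrite (leq_trans (leq_add (card_conf H Fin) (leqnn _))) // -addnA -mulnS.
rewrite mulrA ler_wpM2r ?exprn_ge0 // le_eqVlt; apply/orP; left; apply/eqP.
rewrite /conf_wt [LHS](bigID (mem H)) /= mulrC; congr (_ * _); last first.
  by apply: eq_bigl => i; rewrite !inE andbC; case: (i \in H); rewrite ?orbT.
rewrite (bigD1 F.1) /=; last by rewrite !inE eqxx nF.
by congr (_ * _); apply: eq_bigl => i; rewrite !inE negb_or; case: (i == _); case: (i \in H); rewrite ?andbF ?andbT ?orbF.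
Qed.

Lemma chain_of_destroyed (C D : {set T}) K :
  (forall d, d \in C :&: D -> exists2 F, F \in confs & F.1 = d /\ F.2 \subset C) ->
  (4 * K <= #|C :&: D|)%N -> chain K set0 C.
Proof.
move=> destr leK; suff gen : forall K (H : {set T}), (#|H| + 4 * K <= #|C :&: D|)%N -> chain K H C.
  by apply: gen; rewrite cards0.
elim=> [//|{leK}K IH] H leH /=.
have /subsetPn[d dCD ndH] : ~~ (C :&: D \subset H).
  by apply/negP => /subset_leq_card; move: leH; rewrite mulnS; move: #|_| #|H| => a b; lia.
have [F Fin [F1 F2]] := destr d dCD; apply/hasP; exists F => //.
rewrite F1 ndH F2; move: dCD; rewrite inE => /andP[-> _] /=.
rewrite -F1; apply: IH; apply: leq_trans leH.
by rewrite mulnS addnA leq_add2r card_conf.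
Qed.

(** Markov's inequality for 2^(-|C :&: D|), whose expectation is the product on the right by
    independence. *)
Lemma Pr_few (D : {set T}) n :
  Pr (fun C => (#|C :&: D| <= n)%N) <= 2 ^+ n * \prod_(i in D) (1 - p i / 2).
Proof.
have -> : \prod_(i in D) (1 - p i / 2) = \sum_(C : {set T}) set_wt C * 2^-1 ^+ #|C :&: D|.
  pose f i := if i \in D then p i / 2 else p i.
  transitivity (\prod_i (f i + (1 - p i))).
    rewrite big_mkcond; apply: eq_bigr => i _; rewrite /f; case: ifP => _; lra.
  rewrite (bigA_distr _ _ f (fun i => 1 - p i)); apply: eq_bigr => C _.
  rewrite -prodr_const [X in _ * X]big_mkcond -big_split; apply: eq_bigr => i _ /=.
  by rewrite inE /f; case: (i \in C); case: (i \in D) => //=; rewrite mulr1.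
rewrite mulr_sumr /Pr big_mkcond; apply: ler_sum => C _.
have w0 := set_wt_ge0 C; case: ifP => [le_n|_]; last first.
  by rewrite mulr_ge0 ?exprn_ge0 // mulr_ge0 ?exprn_ge0 ?invr_ge0.
rewrite mulrCA -[leLHS]mulr1 ler_wpM2l // -(subnK le_n) exprD.
rewrite -mulrA -exprMn mulfV ?pnatr_eq0 // expr1n mulr1 exprn_ege1 //; lra.
Qed.

End RandomSet.

(** Follows from (1 - y)^n (1 + n y) <= 1. *)
Lemma bernoulli_half (R : realFieldType) (y : R) n : 0 <= y <= 1 -> 1 <= n%:R * y -> (1 - y) ^+ n <= 2^-1.
Proof.
case/andP=> y0 y1 ny; have gen m : (1 - y) ^+ m * (1 + m%:R * y) <= 1.
  elim: m => [|m IH]; first by rewrite mul0r addr0 mulr1.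
  apply: le_trans IH; rewrite exprSr -mulrA ler_wpM2l ?exprn_ge0 ?subr_ge0 //.
  rewrite -natr1; have : 0 <= m%:R * y by rewrite mulr_ge0.
  by move: (m%:R) => x; nra.
have := gen n; have : 0 <= (1 - y) ^+ n by rewrite exprn_ge0 ?subr_ge0.
by move: (_ ^+ n) (n%:R * y) ny => a b; nra.
Qed.

(** * The random intensity *)

Definition free_tag (n : nat) :=
  ~~ has (fun a => has (fun b => has (fun c =>
    (n + c == a + b %[mod 64])%N) tags) tags) tags.

Lemma blocked_sum a b c n : (a %% 64)%N \in tags -> (b %% 64)%N \in tags ->
  (c %% 64)%N \in tags -> (n + c = a + b)%N -> ~~ free_tag n.
Proof.
move=> ha hb hc e; rewrite negbK; apply/hasP; exists (a %% 64)%N => //.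
apply/hasP; exists (b %% 64)%N => //; apply/hasP; exists (c %% 64)%N => //.
by rewrite modnDmr e modnDm.
Qed.

Lemma free_tag_mod m n : (m = n %[mod 64])%N -> free_tag m = free_tag n.
Proof.
move=> e; congr (~~ _); apply: eq_has => a; apply: eq_has => b; apply: eq_has => c.
by rewrite -(modnDml m) e modnDml.
Qed.

Lemma free_tag_cover (t : nat) : exists t1 t2, [/\ t1 \in tags, t2 \in tags &
  forall x, (x + t1 + t2 = t %[mod 64])%N -> free_tag x].
Proof.
(* A finite check over the 64 classes; [64 - u] stands for -u mod 64. *)
have : all (fun t => has (fun u => has (fun v => free_tag (t + (64 - u) + (64 - v))%N) tags) tags)
   (iota 0 64) by vm_compute.
move/allP => /(_ (t %% 64)%N); rewrite mem_iota leq0n add0n ltn_mod => /(_ isT).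
case/hasP => u u_in /hasP[v v_in ft]; exists u, v; split=> // x e.
have lt w : w \in tags -> (w < 64)%N by rewrite !inE => /or4P[]/eqP->.
have := lt _ u_in; have := lt _ v_in => lv lu.
by rewrite -(@free_tag_mod (t %% 64 + (64 - u) + (64 - v))%N) //; lia.
Qed.

Section Intensity.
Variable R : realFieldType.

Definition lev n := trunc_log 2 n.
(* [2 * theta ^ 2 * (13 / 10) = 64 / 65 < 1] makes the sums of correlations over the Sidon set
   converge, while [theta ^- k = (13 / 8) ^ k] stays below the number of available pairs. *)
Definition theta : R := 8%:R / 13%:R.
(** Depends only on the dyadic range, apart from the class mod 64, so that all sums become geometric
    series; [theta] is about 2^(-0.7004). *)
Definition pr (n : nat) : R := if (0 < n)%N && free_tag n then theta ^+ lev n else 0.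

Lemma theta_gt0 : 0 < theta. Proof. rewrite /theta; lra. Qed.

Lemma theta_le1 : theta <= 1. Proof. rewrite /theta; lra. Qed.

Hint Resolve theta_gt0 theta_le1 : core.

Lemma theta_ge0 : 0 <= theta. Proof. exact: ltW. Qed.
Hint Resolve theta_ge0 : core.

Lemma theta2 : theta * 2%:R = 16%:R / 13%:R. Proof. rewrite /theta; lra. Qed.

Lemma theta2t : theta * theta * 2%:R = 128%:R / 169%:R. Proof. rewrite /theta; lra. Qed.

Lemma theta_corr : 16%:R / 13%:R * theta = 128%:R / 169%:R. Proof. rewrite /theta; lra. Qed.

Lemma theta_mono i j : (i <= j)%N -> theta ^+ j <= theta ^+ i.
Proof. by move=> le; rewrite ler_wiXn2l. Qed.

Lemma levP n : (0 < n)%N -> (2 ^ lev n <= n < 2 ^ (lev n).+1)%N.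
Proof. by move=> n0; rewrite trunc_logP // trunc_log_ltn. Qed.

Lemma lev_ge n j : (2 ^ j <= n)%N -> (j <= lev n)%N.
Proof. exact: trunc_log_max. Qed.

Lemma lev_lt n j : (0 < n)%N -> (n < 2 ^ j)%N -> (lev n < j)%N.
Proof.
by move=> n0 lt; rewrite -(@ltn_exp2l 2) //; apply: leq_ltn_trans lt; case/andP: (levP n0).
Qed.

Lemma pr_ge0 n : 0 <= pr n.
Proof. by rewrite /pr; case: ifP => // _; rewrite exprn_ge0. Qed.

Lemma pr_le n j : (2 ^ j <= n)%N -> pr n <= theta ^+ j.
Proof.
move=> le; rewrite /pr; case: ifP => _; last by rewrite exprn_ge0.
exact/theta_mono/lev_ge.
Qed.

Lemma pr_le1 n : pr n <= 1.
Proof. by rewrite /pr; case: ifP => // _; rewrite exprn_ile1. Qed.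

Lemma pr01 n : 0 <= pr n <= 1. Proof. by rewrite pr_ge0 pr_le1. Qed.

Lemma sum_pr k : \sum_(0 <= w < 2 ^ k) pr w <= (13%:R / 3%:R) * (16%:R / 13%:R) ^+ k.
Proof.
elim: k => [|k IH]; first by rewrite big_nat1 (_ : pr 0 = 0) // expr0 mulr1 divr_ge0.
rewrite (@big_cat_nat _ _ _ (2 ^ k)) //; last by rewrite leq_exp2l.
have top : \sum_(2 ^ k <= w < 2 ^ k.+1) pr w <= (16%:R / 13%:R) ^+ k.
  apply: le_trans (_ : \sum_(2 ^ k <= w < 2 ^ k.+1) theta ^+ k <= _).
    by apply: ler_sum_nat => w /andP[le _]; apply: pr_le.
  rewrite sumr_const_nat (_ : 2 ^ k.+1 - 2 ^ k = 2 ^ k)%N; last by rewrite expnS; lia.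
  by rewrite -[_ *+ (2 ^ _)]mulr_natr natrX -exprMn theta2.
apply: le_trans (lerD IH top) _; rewrite exprS; lra.
Qed.

Lemma sum_pr_lt n k : (n <= 2 ^ k)%N ->
  \sum_(0 <= w < n) pr w <= (13%:R / 3%:R) * (16%:R / 13%:R) ^+ k.
Proof.
move=> le; apply: le_trans (sum_pr k); rewrite [leRHS](@big_cat_nat _ _ _ n) //=.
by rewrite lerDl sumr_ge0 // => i _; apply: pr_ge0.
Qed.

Lemma sum_range_le (f : nat -> R) n s t : (forall w, 0 <= f w) ->
  \sum_(0 <= w < n | (s <= w < t)%N) f w <= \sum_(s <= w < t) f w.
Proof.
move=> f0; rewrite (@big_nat_widenl _ _ _ s 0) // (@big_nat_widen _ _ _ 0 t (maxn n t)) ?leq_maxr //.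
rewrite (@big_nat_widen _ _ _ 0 n (maxn n t)) ?leq_maxl //.
rewrite [leLHS]big_mkcond [leRHS]big_mkcond; apply: ler_sum => w _.
by case: (s <= w)%N; case: (w < t)%N; case: (w < n)%N => //=.
Qed.

(** Points below 2^j are bounded by the initial segment and every other point weighs at most
    theta^j, so the position s of the interval does not matter. *)
Lemma sum_pr_interval n s j :
  \sum_(0 <= w < n | (s <= w < s + 2 ^ j)%N) pr w <= (16%:R / 3%:R) * (16%:R / 13%:R) ^+ j.
Proof.
apply: le_trans (_ : \sum_(0 <= w < n | (s <= w < s + 2 ^ j)%N)
   ((if (w < 2 ^ j)%N then pr w else 0) + theta ^+ j) <= _).
  apply: ler_sum => w _; case: ltnP => [_|/pr_le]; last by rewrite add0r.
  by rewrite lerDl exprn_ge0.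
rewrite big_split /=; apply: le_trans (_ : (13%:R / 3%:R) * (16%:R / 13%:R) ^+ j + (16%:R / 13%:R) ^+ j <= _); last lra.
apply: lerD.
  apply: le_trans (sum_pr_lt (leqnn (2 ^ j))); rewrite -big_mkcondr /=.
  apply: le_trans (sum_range_le n 0 (2 ^ j) pr_ge0).
  rewrite [leLHS]big_mkcond [leRHS]big_mkcond; apply: ler_sum => w _.
  by case: (_ <= w < _)%N; case: (w < 2 ^ j)%N => //=; rewrite pr_ge0.
apply: le_trans (sum_range_le n s (s + 2 ^ j) (fun=> _)) _; first by rewrite exprn_ge0.
rewrite sumr_const_nat addKn -[_ *+ (2 ^ _)]mulr_natr natrX -exprMn theta2 //.
Qed.

(** The two geometric factors in [corr_le]: 1 / (2 theta - 1) for w below the scale of d and 1 / (1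
    - 2 theta^2) for w above it. *)
Definition corr_const : R := 13%:R / 3%:R + 169%:R / 41%:R.

Lemma sum_theta2_tail j n :
  \sum_(0 <= w < n | (2 ^ j <= w)%N) theta ^+ lev w * theta ^+ lev w
    <= (169%:R / 41%:R) * (128%:R / 169%:R) ^+ j.
Proof.
have gen i : \sum_(2 ^ j <= w < 2 ^ (j + i)) theta ^+ lev w * theta ^+ lev w
    <= (169%:R / 41%:R) * ((128%:R / 169%:R) ^+ j - (128%:R / 169%:R) ^+ (j + i)).
  elim: i => [|i IH]; first by rewrite addn0 big_geq // subrr mulr0.
  rewrite (@big_cat_nat _ _ _ (2 ^ (j + i)))  /=; [|by rewrite leq_exp2l ?leq_addr //|by rewrite leq_exp2l // leq_add2l].
  have top : \sum_(2 ^ (j + i) <= w < 2 ^ (j + i.+1)) theta ^+ lev w * theta ^+ lev w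
      <= (128%:R / 169%:R) ^+ (j + i).
    apply: le_trans (_ : \sum_(2 ^ (j + i) <= w < 2 ^ (j + i.+1)) theta ^+ (j + i) * theta ^+ (j + i) <= _).
      apply: ler_sum_nat => w /andP[/lev_ge/theta_mono le _].
      by rewrite ler_pM ?exprn_ge0.
    rewrite sumr_const_nat addnS (_ : 2 ^ (j + i).+1 - 2 ^ (j + i) = 2 ^ (j + i))%N; last by rewrite expnS; lia.
    by rewrite -[_ *+ (2 ^ _)]mulr_natr natrX -!exprMn theta2t.
  apply: le_trans (lerD IH top) _; rewrite addnS exprS.
  by move: ((_ / _) ^+ (j + i)) ((_ / _) ^+ j) => x y; lra.
apply: le_trans (_ : \sum_(2 ^ j <= w < 2 ^ (j + n)) theta ^+ lev w * theta ^+ lev w <= _).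
  have n_lt : (n <= 2 ^ (j + n))%N by apply: leq_trans (ltnW (ltn_expl n (ltnSn 1))) _; rewrite leq_exp2l // leq_addl.
  have f0 w : 0 <= theta ^+ lev w * theta ^+ lev w by rewrite mulr_ge0 ?exprn_ge0.
  apply: le_trans (sum_range_le n (2 ^ j) (2 ^ (j + n)) f0).
  rewrite big_nat_cond [leRHS]big_nat_cond le_eqVlt; apply/orP; left; apply/eqP.
  by apply: eq_bigl => w; case: (ltnP w n) => //= lt; rewrite (leq_trans lt n_lt) andbT.
apply: le_trans (gen n) _; rewrite ler_wpM2l ?divr_ge0 ?ler0n // gerBl exprn_ge0 // divr_ge0 ?ler0n //.
Qed.

Lemma corr_le n d : (0 < d)%N ->
  \sum_(0 <= w < n) pr w * pr (w + d) <= corr_const * (128%:R / 169%:R) ^+ lev d.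
Proof.
move=> d0; have /andP[le_d _] := levP d0; set j := lev d.
apply: le_trans (_ : \sum_(0 <= w < n) ((if (w < 2 ^ j)%N then pr w else 0) * theta ^+ j +
   (if (2 ^ j <= w)%N then theta ^+ lev w * theta ^+ lev w else 0)) <= _).
  apply: ler_sum_nat => w _; case: ltnP => [lt|le].
    rewrite addr0 ler_wpM2l ?pr_ge0 //; apply: pr_le; apply: leq_trans le_d (leq_addl _ _).
  rewrite mul0r add0r; have w0 : (0 < w)%N by apply: leq_trans le; rewrite expn_gt0.
  have /andP[le_w _] := levP w0.
  by rewrite ler_pM ?pr_ge0 //; apply: pr_le => //; apply: leq_trans le_w (leq_addr _ _).
rewrite big_split -mulr_suml -!big_mkcond /= mulrDl; apply: lerD; last exact: sum_theta2_tail.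
apply: le_trans (_ : (13%:R / 3%:R) * (16%:R / 13%:R) ^+ j * theta ^+ j <= _).
  rewrite ler_wpM2r ?exprn_ge0 //; apply: le_trans (sum_pr_lt (leqnn (2 ^ j))).
  apply: le_trans (sum_range_le n 0 (2 ^ j) pr_ge0).
  by rewrite le_eqVlt; apply/orP; left; apply/eqP/eq_bigl => w.
by rewrite -mulrA -exprMn theta_corr.
Qed.

(** One of w and t - w is at least t / 2, with weight at most theta^(lev t - 1); the other one is
    summed by [sum_pr_lt]. The constant 18 rounds up 2 (13/8) (13/3) (16/13) = 52/3. *)
Lemma conv_le t : (0 < t)%N ->
  \sum_(0 <= w < t.+1) pr w * pr (t - w) <= 18%:R * (128%:R / 169%:R) ^+ lev t.
Proof.
move=> t0; have /andP[le_t lt_t] := levP t0; set j := lev t in le_t lt_t *.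
have half x : (t <= 2 * x)%N -> pr x <= 13%:R / 8%:R * theta ^+ j.
  case: j le_t lt_t => [|i] le_t lt_t le_x; first by apply: le_trans (pr_le1 x) _; rewrite expr0; lra.
  rewrite exprS mulrA (_ : 13%:R / 8%:R * theta = 1) ?mul1r; last by rewrite /theta; lra.
  by apply: pr_le; rewrite expnS in le_t; lia.
apply: le_trans (_ : \sum_(0 <= w < t.+1) (13%:R / 8%:R * theta ^+ j * pr w + 13%:R / 8%:R * theta ^+ j * pr (t - w)) <= _).
  apply: ler_sum_nat => w /andP[_ le_w]; have [a b] := (pr_ge0 w, pr_ge0 (t - w)).
  have c : 0 <= 13%:R / 8%:R * theta ^+ j by rewrite mulr_ge0 ?exprn_ge0 // divr_ge0 ?ler0n.
  case: (leqP t (2 * w)) => [/half h|lt].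
    apply: le_trans (_ : 13%:R / 8%:R * theta ^+ j * pr (t - w) <= _); first by rewrite ler_wpM2r.
    by rewrite lerDr mulr_ge0.
  have /half h : (t <= 2 * (t - w))%N by lia.
  apply: le_trans (_ : pr w * (13%:R / 8%:R * theta ^+ j) <= _); first by rewrite ler_wpM2l.
  by rewrite mulrC lerDl mulr_ge0.
rewrite big_split /= -!mulr_sumr.
have -> : \sum_(0 <= w < t.+1) pr (t - w) = \sum_(0 <= w < t.+1) pr w.
  by rewrite big_nat_rev /=; apply: eq_big_nat => w /andP[_ lt]; congr pr; lia.
have := sum_pr_lt lt_t; rewrite exprS.
have : 0 <= 13%:R / 8%:R * theta ^+ j by rewrite mulr_ge0 ?exprn_ge0 // divr_ge0 ?ler0n.
have -> : (128%:R / 169%:R) ^+ j = theta ^+ j * (16%:R / 13%:R) ^+ j by rewrite -theta_corr exprMn mulrC.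
have : 0 <= (16%:R / 13%:R : R) ^+ j by rewrite exprn_ge0 // divr_ge0 ?ler0n.
have := exprn_ge0 j theta_ge0.
move: (theta ^+ j) ((_ / _) ^+ j) (\sum_(_ <= _ < _) _) => x y z; nra.
Qed.

End Intensity.

(** * Sums over solutions of equations through injective parameters *)

Lemma sum_inj_le (R : realFieldType) (S J : finType) (P : pred S) (Q : pred J) (g : S -> J) (F : J -> R) :
  (forall j, 0 <= F j) -> (forall s s', P s -> P s' -> g s = g s' -> s = s') -> (forall s, P s -> Q (g s)) ->
  \sum_(s | P s) F (g s) <= \sum_(j | Q j) F j.
Proof.
move=> F0 inj PQ; have -> : \sum_(s | P s) F (g s) = \sum_(j in [set g s | s in P]) F j.
  rewrite big_imset // => s s'; exact: inj.
rewrite big_mkcond [leRHS]big_mkcond; apply: ler_sum => j _; case: ifP => [|_].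
  by case/imsetP => s Ps ->; rewrite PQ.
by case: ifP => _.
Qed.

(** For solutions determined by three parameters: a counted one, then two weighted ones, each
    contributing its largest possible total. *)
Lemma inj3_le (R : realFieldType) (S X Y Z : finType) (P : pred S) (PX : pred X) (Q : pred (X * Y * Z))
    (F : Y -> R) (G : Z -> R) (g : S -> X * Y * Z) (SF SG : R) :
  (forall y, 0 <= F y) -> (forall z, 0 <= G z) -> 0 <= SG ->
  (forall s s', P s -> P s' -> g s = g s' -> s = s') -> (forall s, P s -> PX (g s).1.1 && Q (g s)) ->
  \sum_y F y <= SF -> (forall x y, \sum_(z | Q (x, y, z)) G z <= SG) ->
  \sum_(s | P s) F (g s).1.2 * G (g s).2 <= #|PX|%:R * SF * SG.
Proof.
move=> F0 G0 SG0 inj PR hF hG.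
apply: le_trans (sum_inj_le (Q := fun t => PX t.1.1 && Q t)
  (F := fun t => F t.1.2 * G t.2) _ inj PR) _.
  by move=> t; rewrite mulr_ge0.
have -> : \sum_(t : X * Y * Z | PX t.1.1 && Q t) F t.1.2 * G t.2 =
    \sum_(u : X * Y | PX u.1) \sum_(z | Q (u, z)) F u.2 * G z.
  by rewrite pair_big_dep /=; apply: eq_big => [[[x y] z]|[[x y] z] _].
have -> : \sum_(u : X * Y | PX u.1) \sum_(z | Q (u, z)) F u.2 * G z =
    \sum_(x | PX x) \sum_y \sum_(z | Q (x, y, z)) F y * G z.
  rewrite [RHS]pair_big_dep /=; apply: eq_big => [[x y]|[x y] _] //=.
  by rewrite andbT.
apply: le_trans (_ : \sum_(x | PX x) SF * SG <= _); last first.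
  by rewrite sumr_const -mulrA mulr_natl.
apply: ler_sum => x _; apply: le_trans (_ : \sum_y F y * SG <= _).
  by apply: ler_sum => y _; rewrite -mulr_sumr ler_wpM2l.
by rewrite -mulr_suml ler_wpM2r.
Qed.

Section Weights.
Variables (R : realFieldType) (T : finType) (p : T -> R).
Hypothesis p01 : forall i, 0 <= p i <= 1.
Variable H : {set T}.

(** An upper bound for the cost of w that also holds for known points, which have cost 1. *)
Definition plus_known w := p w + (w \in H)%:R.
Local Notation q := plus_known.

Let p_ge0 i : 0 <= p i. Proof. by case/andP: (p01 i). Qed.

Lemma plus_known_ge0 w : 0 <= q w.
Proof. by rewrite addr_ge0. Qed.

Lemma plus_known_ge w : p w <= q w. Proof. by rewrite lerDl. Qed.

Lemma plus_known1 w : w \in H -> 1 <= q w.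
Proof. by rewrite /q => ->; rewrite lerDr. Qed.

Lemma prod_set1 d w : w != d ->
  \prod_(v in [set w] :\: (d |: H)) p v <= q w.
Proof.
move=> ne; case: (boolP (w \in H)) => wH.
  rewrite (_ : _ :\: _ = set0) ?big_set0 ?plus_known1 //.
  by apply/setP => v; rewrite !inE; case: (eqVneq v w) => [->|_]; rewrite ?wH ?orbT ?andbF.
rewrite (_ : _ :\: _ = [set w]) ?big_set1 ?plus_known_ge //.
by apply/setP => v; rewrite !inE; case: (eqVneq v w) => [->|_]; rewrite ?(negbTE wH) ?(negbTE ne) ?andbF.
Qed.

Lemma prod_setD_known (W : {set T}) d w : w \in d |: H ->
  \prod_(v in (w |: W) :\: (d |: H)) p v = \prod_(v in W :\: (d |: H)) p v.
Proof.
move=> wH; apply: eq_bigl => v; move: wH; rewrite !inE.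
by case: (eqVneq v w) => [->|_] //= ->.
Qed.

Lemma prod_setD_new (W : {set T}) d w : w \notin d |: H -> w \notin W ->
  \prod_(v in (w |: W) :\: (d |: H)) p v = p w * \prod_(v in W :\: (d |: H)) p v.
Proof.
move=> wH wW; rewrite (bigD1 w) ?inE ?eqxx ?andbT //=; last first.
  by move: wH; rewrite !inE.
congr (_ * _); apply: eq_bigl => v; rewrite !inE.
by case: (eqVneq v w) => [->|_]; rewrite ?(negbTE wW) ?andbF ?andbT.
Qed.

(** The term with two new points keeps the exact product of intensities, since it is summed by
    correlations or convolutions; the terms with a point of H are few and bear the cruder weight
    [q]. *)
Lemma prod_set2 d w1 w2 : w1 != w2 -> w1 != d -> w2 != d ->
  \prod_(v in [set w1; w2] :\: (d |: H)) p v <=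
  p w1 * p w2 + (w1 \in H)%:R * q w2 + (w2 \in H)%:R * q w1.
Proof.
move=> ne n1 n2; have [a1 a2] := (plus_known_ge0 w1, plus_known_ge0 w2).
case: (boolP (w1 \in H)) => h1.
  rewrite prod_setD_known ?inE ?h1 ?orbT // mul1r.
  apply: le_trans (prod_set1 n2) _; rewrite -[leLHS]addr0 lerD ?mulr_ge0 // lerDr mulr_ge0 //.
rewrite mul0r addr0 prod_setD_new ?inE ?negb_or ?n1 //.
case: (boolP (w2 \in H)) => h2.
  rewrite (_ : [set w2] :\: _ = set0) ?big_set0.
    by rewrite mulr1 mul1r -[leLHS]add0r lerD ?mulr_ge0 ?plus_known_ge.
  by apply/setP => v; rewrite !inE; case: (eqVneq v w2) => [->|_]; rewrite ?h2 ?orbT ?andbF.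
rewrite mul0r addr0 (_ : [set w2] :\: _ = [set w2]) ?big_set1 //.
by apply/setP => v; rewrite !inE; case: (eqVneq v w2) => [->|_]; rewrite ?(negbTE h2) ?(negbTE n2) ?andbF.
Qed.

Lemma prod_set2_any d w1 w2 : w1 != w2 ->
  \prod_(v in [set w1; w2] :\: (d |: H)) p v <=
  p w1 * p w2 + (w1 \in H)%:R * q w2 + (w2 \in H)%:R * q w1 +
  (w1 == d)%:R * q w2 + (w2 == d)%:R * q w1.
Proof.
move=> ne; have [a1 a2] := (plus_known_ge0 w1, plus_known_ge0 w2).
have b w u : 0 <= (w \in H)%:R * q u by rewrite mulr_ge0 ?plus_known_ge0.
case: (eqVneq w1 d) => [e1|n1].
  rewrite prod_setD_known ?inE ?e1 ?eqxx //= mul1r.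
  apply: le_trans (prod_set1 _) _; first by rewrite eq_sym -e1.
  rewrite -e1 eq_sym (negbTE ne) mul0r addr0 lerDr !addr_ge0 ?mulr_ge0 //.
case: (eqVneq w2 d) => [e2|n2].
  rewrite setUC prod_setD_known ?inE ?e2 ?eqxx //= mul1r.
  apply: le_trans (prod_set1 n1) _; rewrite -e2 mul0r addr0 lerDr !addr_ge0 ?mulr_ge0 //.
by rewrite !mul0r !addr0; apply: prod_set2.
Qed.

Lemma prod_set2_le d w1 w2 : w1 != w2 -> w1 != d -> w2 != d ->
  \prod_(v in [set w1; w2] :\: (d |: H)) p v <= q w1 * q w2.
Proof.
move=> ne n1 n2; case: (boolP (w1 \in H)) => h1.
  rewrite prod_setD_known ?inE ?h1 ?orbT //; apply: le_trans (prod_set1 n2) _.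
  by rewrite -[leLHS]mul1r ler_wpM2r ?plus_known_ge0 ?plus_known1.
rewrite prod_setD_new ?inE ?negb_or ?n1 // ler_pM ?plus_known_ge ?prod_set1 //.
by rewrite prodr_ge0.
Qed.

Lemma prod_set3 d w1 w2 w3 : w1 != w2 -> w1 != w3 -> w2 != w3 -> w1 != d -> w2 != d -> w3 != d ->
  \prod_(v in (w1 |: [set w2; w3]) :\: (d |: H)) p v <=
  p w1 * (p w2 * p w3) + (w1 \in H)%:R * (q w2 * q w3) + (w2 \in H)%:R * (q w1 * q w3)
    + (w3 \in H)%:R * (q w1 * q w2).
Proof.
move=> n12 n13 n23 n1 n2 n3.
have [[a1 a2] a3] := (plus_known_ge0 w1, plus_known_ge0 w2, plus_known_ge0 w3).
have b (w u v : T) : 0 <= (w \in H)%:R * (q u * q v) by rewrite !mulr_ge0 ?plus_known_ge0.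
case: (boolP (w1 \in H)) => h1.
  rewrite prod_setD_known ?inE ?h1 ?orbT // mul1r.
  apply: le_trans (prod_set2_le n23 n2 n3) _.
  by rewrite -addrA -addrA addrCA lerDl !addr_ge0 ?mulr_ge0.
rewrite mul0r addr0 prod_setD_new ?inE ?negb_or ?n1 ?n12 ?n13 //.
apply: le_trans (ler_wpM2l (p_ge0 w1) (prod_set2 n23 n2 n3)) _.
have := plus_known_ge w1; have := p_ge0 w1.
move: (p w1) (q w1) (q w2) (q w3) a1 a2 a3 (p w2 * p w3) => x y1 y2 y3 ge1 ge2 ge3 z x0 le1.
have m3 : x * y3 <= y1 * y3 by rewrite ler_wpM2r.
have m2 : x * y2 <= y1 * y2 by rewrite ler_wpM2r.
by case: (w2 \in H); case: (w3 \in H); rewrite ?mul1r ?mul0r; lra.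
Qed.
End Weights.

(** * Weights of the destroying configurations *)

Section LocalSums.
Variables (R : realFieldType) (A : pred nat) (CA : R).
Hypothesis CA_ge1 : 1 <= CA.
Hypothesis A_local : forall t n (s : seq nat), uniq s ->
  (forall a, a \in s -> [/\ A a, (a < t + 2 ^ n)%N & (t < a + 2 ^ n)%N]) ->
  (size s)%:R <= CA * (13%:R / 10%:R) ^+ n.
Variable N : nat.
Local Notation I := 'I_N.+1.
Local Notation kappa := (128%:R / 169%:R : R).
Local Notation rr := (64%:R / 65%:R : R).

Lemma card_local (P : pred I) t n :
  (forall a : I, P a -> [/\ A a, (a < t + 2 ^ n)%N & (t < a + 2 ^ n)%N]) ->
  #|P|%:R <= CA * (13%:R / 10%:R) ^+ n.
Proof.
move=> hP; rewrite cardE -(size_map val); apply: (@A_local t).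
  by rewrite map_inj_uniq ?enum_uniq //; apply: val_inj.
by move=> v /mapP[a]; rewrite mem_enum => /hP hPa ->.
Qed.

Lemma CA_ge0 : 0 <= CA. Proof. exact: le_trans ler01 CA_ge1. Qed.

Definition gap (s t : nat) := ((s - t) + (t - s))%N.

Lemma kappa_ge0 : 0 <= kappa. Proof. by rewrite divr_ge0 ?ler0n. Qed.
Lemma s_ge0 : 0 <= 13%:R / 10%:R :> R. Proof. by rewrite divr_ge0 ?ler0n. Qed.
Lemma rr_ge0 : 0 <= rr. Proof. by rewrite divr_ge0 ?ler0n. Qed.
Lemma s_kappa n : (13%:R / 10%:R) ^+ n * kappa ^+ n = rr ^+ n.
Proof. by rewrite -exprMn; congr (_ ^+ n); lra. Qed.

(** Dyadic decomposition by the distance from t: at distance about 2^n there are O((13/10)^n)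
    elements of A, each contributing kappa^n, and (13/10) kappa = 64/65. The constant 85 rounds up
    65 (13/10). *)
Lemma sum_gap t j0 :
  \sum_(a : I | A a && (2 ^ j0 <= gap t a)%N) kappa ^+ lev (gap t a) <= 85%:R * CA * rr ^+ j0.
Proof.
pose J := (t + N).+2.
have levJ (a : I) : (2 ^ j0 <= gap t a)%N -> (j0 <= lev (gap t a) < J)%N.
  move=> le; rewrite lev_ge //= lev_lt //; first by apply: leq_trans le; rewrite expn_gt0.
  apply: leq_ltn_trans (ltn_expl J (ltnSn 1)); rewrite /gap /J; have := ltn_ord a; lia.
apply: le_trans (_ : \sum_(a : I | A a && (2 ^ j0 <= gap t a)%N)
   \sum_(j0 <= j < J | j == lev (gap t a)) kappa ^+ j <= _).
  by apply: ler_sum => a /andP[_ /levJ h]; rewrite big_nat1_eq h.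
under eq_bigr => a _ do rewrite big_mkcond.
rewrite exchange_big /=.
apply: le_trans (_ : \sum_(j0 <= j < J) CA * (13%:R / 10%:R) * rr ^+ j <= _).
  apply: ler_sum => j _; rewrite -big_mkcondr /= sumr_const -[_ *+ _]mulr_natr -s_kappa.
  rewrite mulrC mulrA ler_wpM2r ?exprn_ge0 ?kappa_ge0 // -mulrA -exprS.
  apply: (@card_local _ t) => a /andP[/andP[Aa le_a] /eqP ej].
  have gap0 : (0 < gap t a)%N by apply: leq_trans le_a; rewrite expn_gt0.
  have /andP[_] := levP gap0; rewrite -ej /gap => lt; split=> //; lia.
have geo n : \sum_(j0 <= j < j0 + n) rr ^+ j <= 65%:R * (rr ^+ j0 - rr ^+ (j0 + n)).
  elim: n => [|n IH]; first by rewrite addn0 big_geq // subrr mulr0.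
  rewrite addnS big_nat_recr ?leq_addr //= exprS.
  by move: IH; move: (\sum_(_ <= _ < _) _) (rr ^+ j0) (rr ^+ (j0 + n)) => x y z; lra.
rewrite -mulr_sumr; apply: le_trans (_ : CA * (13%:R / 10%:R) * (65%:R * rr ^+ j0) <= _).
  rewrite ler_wpM2l ?(mulr_ge0 CA_ge0 s_ge0) //.
  case: (leqP j0 J) => [le|/ltnW le].
    have := geo (J - j0)%N; rewrite subnKC // => h; apply: le_trans h _; rewrite ler_wpM2l ?ler0n // gerBl exprn_ge0 ?rr_ge0 //.
  by rewrite big_geq // mulr_ge0 ?ler0n ?exprn_ge0 ?rr_ge0.
have : 0 <= CA * rr ^+ j0 by rewrite mulr_ge0 ?CA_ge0 ?exprn_ge0 ?rr_ge0.
move: (rr ^+ j0) => x h.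
nra.
Qed.

Lemma sum_low_conv (t : nat) (P : pred I) : (0 < t)%N ->
  (forall a, P a -> A a && (a <= t)%N) ->
  \sum_(a | P a) kappa ^+ lev (t + a) <= 2%:R * CA * rr ^+ lev t.
Proof.
move=> t0 hP; apply: le_trans (_ : \sum_(a | P a) kappa ^+ lev t <= _).
  apply: ler_sum => a /hP/andP[_ le_a]; apply: ler_wiXn2l; rewrite ?kappa_ge0 //; first by lra.
  by apply: leq_trunc_log; apply: leq_addr.
rewrite sumr_const -[_ *+ _]mulr_natr -s_kappa mulrC.
rewrite -mulrA mulrCA [leRHS]mulrCA mulrA [leRHS]mulrA ler_wpM2r ?exprn_ge0 ?kappa_ge0 //.
apply: le_trans (@card_local P t (lev t).+1 _) _.
  move=> a /hP/andP[Aa le_a]; split=> //; first by rewrite (leq_ltn_trans le_a) // -addn1 leq_add2l expn_gt0.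
  by rewrite (leq_trans _ (leq_addl _ _)) //; case/andP: (levP t0).
rewrite exprS; have : 0 <= CA * (13%:R / 10%:R) ^+ lev t.
  by rewrite mulr_ge0 ?CA_ge0 ?exprn_ge0 ?s_ge0.
by move: ((13%:R / 10%:R) ^+ lev t) => x; nra.
Qed.
End LocalSums.

Lemma inj3_dep_le (R : realFieldType) (S X Y Z : finType) (P : pred S) (PX : {set X})
    (QY : X -> pred Y) (QZ : pred (X * Y * Z)) (F : X * Y * Z -> R) (G : X -> Y -> R)
    (g : S -> X * Y * Z) (B : R) :
  (forall t, 0 <= F t) -> (forall s s', P s -> P s' -> g s = g s' -> s = s') ->
  (forall s, P s -> [&& (g s).1.1 \in PX, QY (g s).1.1 (g s).1.2 & QZ (g s)]) ->
  (forall x y, x \in PX -> QY x y -> \sum_(z | QZ (x, y, z)) F (x, y, z) <= G x y) ->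
  (forall x, x \in PX -> \sum_(y | QY x y) G x y <= B) ->
  \sum_(s | P s) F (g s) <= #|PX|%:R * B.
Proof.
move=> F0 inj PQ hG hB.
apply: le_trans (sum_inj_le (Q := fun t => [&& t.1.1 \in PX, QY t.1.1 t.1.2 & QZ t]) F0 inj PQ) _.
have -> : \sum_(t : X * Y * Z | [&& t.1.1 \in PX, QY t.1.1 t.1.2 & QZ t]) F t =
    \sum_(u : X * Y | (u.1 \in PX) && QY u.1 u.2) \sum_(z | QZ (u, z)) F (u, z).
  by rewrite [RHS]pair_big_dep /=; apply: eq_big => [[[x y] z]|[[x y] z] _] //=; rewrite andbA.
have -> : \sum_(u : X * Y | (u.1 \in PX) && QY u.1 u.2) \sum_(z | QZ (u, z)) F (u, z) =
    \sum_(x in PX) \sum_(y | QY x y) \sum_(z | QZ (x, y, z)) F (x, y, z).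
  by rewrite [RHS]pair_big_dep /=; apply: eq_big => [[x y]|[x y] _].
apply: le_trans (_ : \sum_(x in PX) B <= _); last by rewrite sumr_const mulr_natl.
apply: ler_sum => x xP; apply: le_trans (hB x xP); apply: ler_sum => y; exact: hG.
Qed.

(** Eliminating d shows that 2 x1 + x2 - a = m - w depends on w only. *)
Lemma swap_sum x1 x2 w a d x1' x2' a' d' m : (x1 + w = a + d)%N -> (d + x1 + x2 = m)%N ->
  (x1' + w = a' + d')%N -> (d' + x1' + x2' = m)%N -> (2 * x1 + x2 + a' = 2 * x1' + x2' + a)%N.
Proof. lia. Qed.

Lemma sidon_diff (A : pred nat) e a e' a' : sidon_pred A -> A e -> A a -> A e' -> A a' -> (a < e)%N ->
  (e + a' = e' + a)%N -> e = e' /\ a = a'.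
Proof. by move=> A_sidon Ae Aa Ae' Aa' lt eqs; case: (A_sidon _ _ _ _ Ae Aa' Ae' Aa eqs); lia. Qed.

Lemma sidon_sum (A : pred nat) e f e' f' : sidon_pred A -> A e -> A f -> A e' -> A f' -> (e + f = e' + f')%N ->
  (e <= f)%N = (e' <= f')%N -> e = e' /\ f = f'.
Proof. by move=> A_sidon Ae Af Ae' Af' eqs; case: (A_sidon _ _ _ _ Ae Af Ae' Af' eqs); lia. Qed.

Section Families.
Variables (R : realFieldType) (A : pred nat) (CA : R).
Hypothesis CA_ge1 : 1 <= CA.
Hypothesis A_sidon : sidon_pred A.
Hypothesis A_local : forall t n (s : seq nat), uniq s ->
  (forall a, a \in s -> [/\ A a, (a < t + 2 ^ n)%N & (t < a + 2 ^ n)%N]) ->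
  (size s)%:R <= CA * (13%:R / 10%:R) ^+ n.
Variables N k j0 m : nat.
Local Notation I := 'I_N.+1.
Local Notation kappa := (128%:R / 169%:R : R).
Local Notation rr := (64%:R / 65%:R : R).
Hypothesis m_lev : (2 ^ k <= m < 2 ^ k.+1)%N.
Hypothesis m_leN : (m <= N)%N.
Hypothesis j0_lt : (j0 < k)%N.
Variable PP : {set I * I}.
Definition fst_val (x : I * I) : nat := x.1.
Definition snd_val (x : I * I) : nat := x.2.
Definition third (x : I * I) : nat := (m - (fst_val x) - (snd_val x))%N.
Arguments fst_val : simpl never.
Arguments snd_val : simpl never.
Arguments third : simpl never.
Hypothesis PP_A : forall x, x \in PP ->
  [/\ A (fst_val x), A (snd_val x), (8 * (fst_val x) <= m)%N, (8 * (snd_val x) <= m)%N & (2 ^ j0 <= (fst_val x))%N].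
Hypothesis PP_gap : forall x a, x \in PP -> A a -> (a != (fst_val x) :> nat) -> (2 ^ j0 <= gap (fst_val x) a)%N.
Hypothesis PP_gapd : forall x a, x \in PP -> A a -> (2 ^ j0 <= gap (third x) a)%N.

Definition third_ord x : I := inord (third x).
Definition prI (w : I) : R := pr R w.
Variable H : {set I}.
Local Notation q := (plus_known prI H).
Local Notation h := (#|H|%:R : R).

Definition PA (a : I) := A a && (a < 2 ^ k.+2)%N.
Local Notation aA := (#|PA|%:R : R).
(** Bounds the total [q]-weight of any window of length 2^(k+2): the intensity of the window plus
    the known points. *)
Definition low_mass : R := (16%:R / 3%:R) * (16%:R / 13%:R) ^+ k.+2 + h.
Definition prod_new (x : I * I) (W : {set I}) : R :=
  \prod_(v in W :\: (third_ord x |: H)) prI v.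

Lemma prI01 w : 0 <= prI w <= 1. Proof. exact: pr01. Qed.
Lemma q_ge0 w : 0 <= q w. Proof. exact: plus_known_ge0 prI01 _ _. Qed.

Lemma third_eq x : x \in PP -> (third x + (fst_val x) + (snd_val x) = m)%N /\ (3 * m <= 4 * third x)%N.
Proof.
move/PP_A => [_ _]; rewrite /third; move: ((fst_val x) : nat) ((snd_val x) : nat) => a b h1 h2 _.
by split; lia.
Qed.

Lemma third_ord_val x : x \in PP -> third_ord x = third x :> nat.
Proof. by move=> /third_eq[e _]; rewrite inordK // ltnS; lia. Qed.

Lemma third_lev x : x \in PP -> (2 ^ k.-1 <= third x)%N.
Proof.
move=> /third_eq[_ h1]; case/andP: m_lev => h2 _.
have : (2 ^ k = 2 * 2 ^ k.-1)%N by rewrite -expnS prednK //; lia.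
lia.
Qed.

Lemma low_mass_ge0 : 0 <= low_mass.
Proof. by rewrite addr_ge0 ?ler0n // mulr_ge0 ?exprn_ge0 ?divr_ge0 ?ler0n. Qed.

Lemma sum_H : \sum_(w : I) (w \in H)%:R <= h.
Proof. by rewrite -natr_sum ler_nat -sum1_card [leqRHS]big_mkcond; apply: leq_sum => w _; case: (w \in H). Qed.

Lemma sum_q (s : nat) (P : pred I) : (forall w, P w -> (s <= w < s + 2 ^ k.+2)%N) ->
  \sum_(w | P w) q w <= low_mass.
Proof.
move=> hP; rewrite big_split /= lerD //; last first.
  apply: le_trans sum_H; rewrite big_mkcond; apply: ler_sum => w _; case: ifP => //.
apply: le_trans (sum_pr_interval R N.+1 s k.+2); rewrite big_mkord.
rewrite big_mkcond [leRHS]big_mkcond; apply: ler_sum => w _; case: ifP => [/hP->//|_].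
by case: ifP => // _; apply: pr_ge0.
Qed.

Lemma pair_val_eq (x y : I * I) : fst_val x = fst_val y -> snd_val x = snd_val y -> x = y.
Proof. by case: x y => [x1 x2] [y1 y2]; rewrite /fst_val /snd_val /= => /val_inj-> /val_inj->. Qed.

Lemma PP_eq x y : x \in PP -> y \in PP -> third x = third y ->
  ((fst_val x) <= (snd_val x))%N = ((fst_val y) <= (snd_val y))%N -> x = y.
Proof.
move=> xP yP; have [e1 _] := third_eq xP; have [e2 _] := third_eq yP.
have [A1 A2 _ _ _] := PP_A xP; have [A3 A4 _ _ _] := PP_A yP => ed eb.
have es : ((fst_val x) + (snd_val x) = (fst_val y) + (snd_val y))%N by lia.
have [h1 h2] := sidon_sum A_sidon A1 A2 A3 A4 es eb.
exact: pair_val_eq.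
Qed.

Lemma PP_small x : x \in PP -> ((fst_val x) < 2 ^ k.-1)%N /\ ((snd_val x) < 2 ^ k.-1)%N.
Proof.
move=> /PP_A[_ _ h1 h2 _]; case/andP: m_lev => _.
have : (2 ^ k.+1 = 4 * 2 ^ k.-1)%N by rewrite -(expnD 2 2) //; congr (_ ^ _)%N; lia.
lia.
Qed.

Lemma PA_small (a : I) : A a -> (a < 2 * m)%N -> PA a.
Proof.
move=> Aa lt; rewrite /PA Aa /= (leq_trans lt) //; case/andP: m_lev => _ /ltnW h1.
by rewrite expnS leq_mul2l.
Qed.

Lemma pow_k2 : (m < 2 ^ k.+2 /\ 2 * m < 2 ^ k.+2)%N.
Proof. by case/andP: m_lev => _; rewrite (expnS 2 k.+1); lia. Qed.

Lemma corr_const_ge0 : 0 <= corr_const R.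
Proof. by rewrite addr_ge0 ?divr_ge0 ?ler0n. Qed.

(* For [x = (a1, a2)] in [PP] and [d = m - a1 - a2], the families list the equations that
   can remove [a1] or [a2] ([fam1], [fam2]) or [d] ([fam3] to [fam5]); a primed family
   collects the cases with a repeated random term.  In the bounds below, the weight is split
   according to whether a random term is new, already known (in [H]), or equal to [d]; in the
   last two cases the Sidon property makes the equation determined by few parameters. *)
Definition quint : finType := ((I * I) * I * I * I)%type.

Definition fam1 (s : quint) := let: (x, a, w1, w2) := s in
  [&& x \in PP, A a, (a < (fst_val x))%N & ((fst_val x) + w1 == a + w2)%N].

Lemma corr_gap (t : nat) (a : I) : (2 ^ j0 <= gap t a)%N ->
  \sum_(w : I) pr R w * pr R (w + gap t a) <= corr_const R * kappa ^+ lev (gap t a).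
Proof.
move=> le; rewrite -(big_mkord xpredT (fun w => pr R w * pr R (w + gap t a))).
by apply: corr_le; apply: leq_trans le; rewrite expn_gt0.
Qed.

(** For fixed x and a the two random points differ by a1 - a, so the sum over them is a correlation;
    [PP_gap] keeps the differences at least 2^j0 and makes the sum over a small. *)
Lemma fam1_new : \sum_(s | fam1 s) prI s.1.2 * prI s.2 <=
  #|PP|%:R * (corr_const R * (85%:R * CA * rr ^+ j0)).
Proof.
pose F (t : (I * I) * I * I) := pr R t.2 * pr R (t.2 + gap (fst_val t.1.1) t.1.2).
apply: le_trans (_ : \sum_(s | fam1 s) F s.1 <= _).
  rewrite le_eqVlt; apply/orP; left; apply/eqP; apply: eq_bigr => -[[[x a] w1] w2] /=.
  case/and4P => _ _ lt /eqP e; rewrite /prI /F /=; congr (_ * pr _ _); rewrite /gap; lia.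
apply: (inj3_dep_le (PX := PP) (QY := fun x (a : I) => A a && (a < (fst_val x))%N) (QZ := xpredT)
  (G := fun x (a : I) => corr_const R * kappa ^+ lev (gap (fst_val x) a)) (g := fun s : quint => s.1)).
- by move=> t; rewrite mulr_ge0 ?pr_ge0.
- move=> [[[x a] w1] w2] [t w2'] /= + + e; rewrite -{t}e.
  move=> /and4P[_ _ _ /eqP e1] /and4P[_ _ _ /eqP e2].
  by congr pair; apply: val_inj => /=; lia.
- by move=> [[[x a] w1] w2] /and4P[/= -> -> ->].
- move=> x a xP /andP[Aa lt] /=; apply: corr_gap; apply: PP_gap => //; lia.
move=> x xP; rewrite -mulr_sumr ler_wpM2l ?corr_const_ge0 //.
apply: le_trans (sum_gap CA_ge1 A_local N (fst_val x) j0).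
rewrite big_mkcond [leRHS]big_mkcond; apply: ler_sum => a _.
case: ifP => [/andP[Aa lt]|_]; first by rewrite Aa PP_gap //; lia.
by case: ifP => // _; rewrite exprn_ge0 // divr_ge0 ?ler0n.
Qed.

Definition quad : finType := ((I * I) * I * I)%type.

Definition fam2 (s : quint) := let: (x, a, w1, w2) := s in
  [&& x \in PP, A a, (a <= (fst_val x))%N, ((fst_val x) + a == w1 + w2)%N & (w1 < w2)%N].
Definition fam2' (s : quad) := let: (x, a, w) := s in
  [&& x \in PP, A a, (a <= (fst_val x))%N & ((fst_val x) + a == 2 * w)%N].
Definition fam3 (s : quint) := let: (x, a, w1, w2) := s in
  [&& x \in PP, A a, (third x + a == w1 + w2)%N, (w1 < w2)%N & (w2 < third x)%N].
Definition fam3' (s : quad) := let: (x, a, w) := s in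
  [&& x \in PP, A a, (third x + a == 2 * w)%N & (w < third x)%N].
Definition fam4 (s : quint) := let: (x, a, w1, w2) := s in
  [&& x \in PP, A a, (third x + w1 == a + w2)%N, (w1 < third x)%N & (w2 < third x)%N].
Definition fam4' (s : quad) := let: (x, a, w) := s in
  [&& x \in PP, A a, (2 * third x == a + w)%N & (w < third x)%N].
Definition fam5 (s : quint) := let: (x, w1, w2, w3) := s in
  [&& x \in PP, (third x + w1 == w2 + w3)%N, (w1 < w2)%N, (w2 < w3)%N & (w3 < third x)%N].
Definition fam5' (s : quad) := let: (x, w1, w2) := s in
  [&& x \in PP, (third x + w1 == 2 * w2)%N, (w1 < w2)%N & (w2 < third x)%N].

Definition low (n : nat) := (n < 2 ^ k.+2)%N.
Lemma sum_low (P : pred I) : (forall w, P w -> low w) -> \sum_(w | P w) q w <= low_mass.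
Proof. by move=> hP; apply: (@sum_q 0) => w /hP; rewrite add0n. Qed.

Lemma third_low x : x \in PP -> (third x <= m)%N.
Proof. by case/third_eq=> e _; lia. Qed.

(** One parameter ranges over H, the other over the points within 2^(k+2) of it, that is two windows
    of mass [low_mass]. *)
Lemma known2_le (S X : finType) (P : pred S) (PX : pred X) (g : S -> X * I * I) :
  (forall s s', P s -> P s' -> g s = g s' -> s = s') ->
  (forall s, P s -> PX (g s).1.1 && ((g s).1.2 <= (g s).2 + 2 ^ k.+2)%N && ((g s).2 < (g s).1.2 + 2 ^ k.+2)%N) ->
  \sum_(s | P s) ((g s).1.2 \in H)%:R * q (g s).2 <= #|PX|%:R * h * (2%:R * low_mass).
Proof.
move=> inj hP.
apply: (inj3_le (PX := PX) (Q := fun t : X * I * I => (t.1.2 <= t.2 + 2 ^ k.+2)%N && (t.2 < t.1.2 + 2 ^ k.+2)%N)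
  (F := fun w => (w \in H)%:R) (G := q) (g := g)) => //.
- exact: q_ge0.
- by rewrite mulr_ge0 ?ler0n ?low_mass_ge0.
- by move=> s /hP; rewrite -andbA.
- exact: sum_H.
move=> x y /=; rewrite (bigID (fun w : I => (w < y)%N)) /= mulrDl mul1r lerD //.
  by apply: (@sum_q (y - 2 ^ k.+2)) => w; move: (2 ^ _)%N => z; lia.
by apply: (@sum_q y) => w; move: (2 ^ _)%N => z; lia.
Qed.

(** The bit resolves the order of the two summands that the Sidon property leaves undetermined. *)
Lemma known1_le (S X : finType) (P : pred S) (PX : pred X) (g : S -> X * bool * I) :
  (forall s s', P s -> P s' -> g s = g s' -> s = s') ->
  (forall s, P s -> PX (g s).1.1 && low (g s).2) ->
  \sum_(s | P s) q (g s).2 <= #|PX|%:R * 2%:R * low_mass.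
Proof.
move=> inj hP; apply: le_trans (_ : \sum_(s | P s) 1 * q (g s).2 <= _).
  by apply: ler_sum => s _; rewrite mul1r.
apply: (inj3_le (PX := PX) (Q := fun t : X * bool * I => low t.2)
  (F := fun=> 1) (G := q) (g := g)) => //.
- exact: q_ge0.
- exact: low_mass_ge0.
- by rewrite big_bool.
by move=> x y; apply: sum_low.
Qed.

Lemma known3_le (S X : finType) (P : pred S) (PX : pred X) (g : S -> X * I * I) :
  (forall s s', P s -> P s' -> g s = g s' -> s = s') ->
  (forall s, P s -> [&& PX (g s).1.1, low (g s).1.2 & low (g s).2]) ->
  \sum_(s | P s) q (g s).1.2 * q (g s).2 <= #|PX|%:R * low_mass * low_mass.
Proof.
move=> inj hP; pose F (w : I) := if low w then q w else 0.
apply: le_trans (_ : \sum_(s | P s) F (g s).1.2 * q (g s).2 <= _).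
  by apply: ler_sum => s /hP/and3P[_ l _]; rewrite /F l.
apply: (inj3_le (PX := PX) (Q := fun t : X * I * I => low t.2) (F := F) (G := q) (g := g)) => //.
- by move=> w; rewrite /F; case: ifP => // _; apply: q_ge0.
- exact: q_ge0.
- exact: low_mass_ge0.
- by move=> s /hP/and3P[-> _ ->].
- by rewrite /F -big_mkcond; apply: sum_low.
by move=> x y; apply: sum_low.
Qed.

(** The points w1, w2 fix the nonzero difference a1 - a, hence a1 and a; only a2 remains to be
    counted. *)
Lemma fam1_H1 : \sum_(s | fam1 s) (s.1.2 \in H)%:R * q s.2 <= aA * h * (2%:R * low_mass).
Proof.
apply: (known2_le (PX := PA) (g := fun s : quint => (s.1.1.1.2, s.1.2, s.2))).
  move=> [[[x a] w1] w2] [[[x' a'] w1'] w2'] /= + + [ex ? ?]; subst w1' w2'.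
  move=> /and4P[xP Aa lt /eqP e] /and4P[xP' Aa' lt' /eqP e'].
  have [A1 _ _ _ _] := PP_A xP; have [A1' _ _ _ _] := PP_A xP'.
  have eq1 : ((fst_val x) + a' = (fst_val x') + a)%N by lia.
  have [h1 h2] := sidon_diff A_sidon A1 Aa A1' Aa' lt eq1.
  by rewrite (val_inj h2) (@pair_val_eq x x') // /snd_val ex.
move=> [[[x a] w1] w2] /and4P[xP Aa lt /eqP e] /=; have [_ A2 l1 l2 _] := PP_A xP.
rewrite PA_small //; last by have := third_eq xP; rewrite /snd_val; lia.
by have := pow_k2; have := PP_small xP; lia.
Qed.

Lemma fam1_H2 : \sum_(s | fam1 s) (s.2 \in H)%:R * q s.1.2 <= aA * h * (2%:R * low_mass).
Proof.
apply: (known2_le (PX := PA) (g := fun s : quint => (s.1.1.1.2, s.2, s.1.2))).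
  move=> [[[x a] w1] w2] [[[x' a'] w1'] w2'] /= + + [ex ? ?]; subst w1' w2'.
  move=> /and4P[xP Aa lt /eqP e] /and4P[xP' Aa' lt' /eqP e'].
  have [A1 _ _ _ _] := PP_A xP; have [A1' _ _ _ _] := PP_A xP'.
  have eq1 : ((fst_val x) + a' = (fst_val x') + a)%N by lia.
  have [h1 h2] := sidon_diff A_sidon A1 Aa A1' Aa' lt eq1.
  by rewrite (val_inj h2) (@pair_val_eq x x') // /snd_val ex.
move=> [[[x a] w1] w2] /and4P[xP Aa lt /eqP e] /=; have [_ A2 l1 l2 _] := PP_A xP.
rewrite PA_small //; last by have := third_eq xP; rewrite /snd_val; lia.
by have := pow_k2; have := PP_small xP; lia.
Qed.

Lemma m_gt0 : (0 < m)%N.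
Proof. by case/andP: m_lev => h _; apply: leq_trans h; rewrite expn_gt0. Qed.

Lemma PP_PA x : x \in PP -> PA x.1 /\ PA x.2.
Proof.
move=> xP; have [A1 A2 l1 l2 _] := PP_A xP; have [e h] := third_eq xP.
have m0 := m_gt0; split; apply: PA_small.
- exact: A1.
- by change (fst_val x < 2 * m)%N; lia.
- exact: A2.
- by change (snd_val x < 2 * m)%N; lia.
Qed.

(** With w1 = d the equation becomes a2 + a = m - w2, so w2 and one bit give a2 and a; a1 is
    counted. *)
Lemma fam1_d1 : \sum_(s | fam1 s && (s.1.2 == third_ord s.1.1.1)) q s.2 <= aA * 2%:R * low_mass.
Proof.
apply: (known1_le (PX := PA) (g := fun s : quint => (s.1.1.1.1, (snd_val s.1.1.1 <= s.1.1.2)%N, s.2))).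
  move=> [[[x a] w1] w2] [[[x' a'] w1'] w2'] /= + + [ex eb ?]; subst w2'.
  case/andP=> /and4P[xP Aa lt /eqP e] /eqP/= d1 /andP[/and4P[xP' Aa' lt' /eqP e'] /eqP/= d1'].
  have [_ A2 _ _ _] := PP_A xP; have [_ A2' _ _ _] := PP_A xP'.
  have [E _] := third_eq xP; have [E' _] := third_eq xP'.
  have w1E : nat_of_ord w1 = third x by rewrite d1 third_ord_val.
  have w1E' : nat_of_ord w1' = third x' by rewrite d1' third_ord_val.
  have e1 : fst_val x = fst_val x' by rewrite /fst_val ex.
  have eq1 : (snd_val x + a = snd_val x' + a')%N by lia.
  have [h1 h2] := sidon_sum A_sidon A2 Aa A2' Aa' eq1 eb.
  by rewrite (val_inj h2) d1 d1' (@pair_val_eq x x').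
move=> [[[x a] w1] w2] /andP[/and4P[xP Aa lt /eqP e] /eqP/= d1] /=.
have [-> _] := PP_PA xP; have [E _] := third_eq xP.
have w1E : nat_of_ord w1 = third x by rewrite d1 third_ord_val.
by have := pow_k2; rewrite /low; lia.
Qed.

(** With w2 = d the point w1 fixes 2 a1 + a2 - a. If a differs from a2, counting a1 leaves a nonzero
    difference a2 - a, which determines both; if a = a2, then a1 is determined and a2 is counted
    instead. *)
Lemma fam1_d2 : \sum_(s | fam1 s && (s.2 == third_ord s.1.1.1)) q s.1.2 <= aA * 2%:R * low_mass.
Proof.
apply: (known1_le (PX := PA) (g := fun s : quint =>
  (if s.1.1.2 == s.1.1.1.2 then s.1.1.1.2 else s.1.1.1.1, s.1.1.2 == s.1.1.1.2, s.1.2))).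
  move=> [[[x a] w1] w2] [[[x' a'] w1'] w2'] /= + + [+ eb ?]; subst w1'; rewrite -eb.
  case/andP=> /and4P[xP Aa lt /eqP e] /eqP/= d1 /andP[/and4P[xP' Aa' lt' /eqP e'] /eqP/= d1'].
  have [A1 A2 _ _ _] := PP_A xP; have [A1' A2' _ _ _] := PP_A xP'.
  have [E _] := third_eq xP; have [E' _] := third_eq xP'.
  have w2E : nat_of_ord w2 = third x by rewrite d1 third_ord_val.
  have w2E' : nat_of_ord w2' = third x' by rewrite d1' third_ord_val.
  rewrite w2E in e; rewrite w2E' in e'; have K := swap_sum e E e' E'.
  have done_ : x = x' -> a = a' -> (x, a, w1, w2) = (x', a', w1, w2').
    by move=> ex -> ; have -> : w2 = w2' by [apply: val_inj; rewrite /= w2E w2E' ex]; rewrite ex.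
  move: eb; case: eqP => [ea|ne] /esym; last first.
    move=> /eqP ne' ex; have e1 : fst_val x = fst_val x' by rewrite /fst_val ex.
    have ne1 : snd_val x != a by apply/eqP => E1; apply: ne; apply: val_inj.
    have eq1 : (snd_val x + a' = snd_val x' + a)%N by clear -K e1; lia.
    have [h1 h2] : snd_val x = snd_val x' /\ a = a' :> nat.
      by case: (A_sidon A2 Aa' A2' Aa eq1) => -[E1 E2]; [clear -E1 E2; lia | rewrite E1 eqxx in ne1].
    by apply: done_; [apply: pair_val_eq | apply: val_inj].
  move=> /eqP ea' ex; have e2 : snd_val x = snd_val x' by rewrite /snd_val ex.
  have a2 : a = snd_val x :> nat by rewrite ea.
  have a2' : a' = snd_val x' :> nat by rewrite ea'.
  by apply: done_; [apply: pair_val_eq; clear -K e2 a2 a2'; lia | apply: val_inj => /=; clear -e2 a2 a2'; lia].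
move=> [[[x a] w1] w2] /andP[/and4P[xP Aa lt /eqP e] /eqP/= d1] /=.
have [h1 h2] := PP_PA xP; have [E _] := third_eq xP.
have w1E : nat_of_ord w2 = third x by rewrite d1 third_ord_val.
have -> /= : PA (if a == x.2 then x.2 else x.1) by case: ifP.
by have := pow_k2; rewrite /low; lia.
Qed.

Lemma conv_sum (t : nat) : (0 < t)%N ->
  \sum_(w : I | (w <= t)%N) pr R w * pr R (t - w) <= 18%:R * kappa ^+ lev t.
Proof.
move=> t0; apply: le_trans (conv_le R t0).
pose f w := pr R w * pr R (t - w).
rewrite -(big_mkord (fun w => (w <= t)%N) f).
apply: le_trans (sum_range_le N.+1 0 t.+1 _) => //.
by move=> w; rewrite mulr_ge0 ?pr_ge0.
Qed.

Lemma kappa18_ge0 n : 0 <= 18%:R * kappa ^+ n.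
Proof. by rewrite mulr_ge0 ?ler0n // exprn_ge0 // divr_ge0 ?ler0n. Qed.

Lemma rr_le i j : (i <= j)%N -> rr ^+ j <= rr ^+ i.
Proof. by move=> le; apply: ler_wiXn2l; rewrite ?rr_ge0 //; lra. Qed.

Lemma conv_new (P : pred quint) (t : I * I -> nat) : (forall x, x \in PP -> (2 ^ j0 <= t x)%N) ->
  (forall x a w1 w2, P (x, a, w1, w2) ->
    [/\ x \in PP, A a, (a <= t x)%N & (t x + a = w1 + w2)%N]) ->
  \sum_(s | P s) prI s.1.2 * prI s.2 <= #|PP|%:R * (18%:R * (2%:R * CA * rr ^+ j0)).
Proof.
move=> ht hP; pose F (u : (I * I) * I * I) := pr R u.2 * pr R (t u.1.1 + u.1.2 - u.2).
apply: le_trans (_ : \sum_(s | P s) F s.1 <= _).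
  rewrite le_eqVlt; apply/orP; left; apply/eqP; apply: eq_bigr => -[[[x a] w1] w2] /= /hP[_ _ _ e].
  by rewrite /prI /F /=; congr (_ * pr _ _); rewrite e addKn.
apply: (inj3_dep_le (PX := PP) (QY := fun x (a : I) => A a && (a <= t x)%N)
  (QZ := fun u : (I * I) * I * I => (u.2 <= t u.1.1 + u.1.2)%N) (F := F)
  (G := fun x (a : I) => 18%:R * kappa ^+ lev (t x + a)) (g := fun s : quint => s.1)).
- by move=> u; rewrite mulr_ge0 ?pr_ge0.
- move=> [[[x a] w1] w2] [u w2'] /= + + e; rewrite -{u}e.
  move=> /hP[_ _ _ e1] /hP[_ _ _ e2]; congr pair; apply: val_inj => /=.
  by apply: (@addnI w1); rewrite -e1 -e2.
- by move=> [[[x a] w1] w2] /hP[/= -> -> -> ->]; rewrite leq_addr.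
- move=> x a xP /andP[Aa lt] /=; apply: conv_sum.
  by rewrite addn_gt0 (leq_trans _ (ht _ xP)) ?expn_gt0.
move=> x xP; rewrite -mulr_sumr ler_wpM2l ?ler0n //.
have t0 : (0 < t x)%N by rewrite (leq_trans _ (ht _ xP)) ?expn_gt0.
have := sum_low_conv CA_ge1 A_local t0 (P := fun a : I => A a && (a <= t x)%N) => /(_ _)/le_trans; apply => //.
rewrite ler_wpM2l //; first by rewrite mulr_ge0 ?ler0n // (le_trans ler01).
exact/rr_le/lev_ge/ht.
Qed.

Lemma fam2_new : \sum_(s | fam2 s) prI s.1.2 * prI s.2 <= #|PP|%:R * (18%:R * (2%:R * CA * rr ^+ j0)).
Proof.
apply: (conv_new (t := fst_val)) => [x /PP_A[]//|x a w1 w2 /and5P[-> -> -> /eqP-> _]//].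
Qed.

Lemma third_ge_j0 x : x \in PP -> (2 ^ j0 <= third x)%N.
Proof. by move=> /third_lev; apply: leq_trans; rewrite leq_exp2l //; lia. Qed.

Lemma fam3_new : \sum_(s | fam3 s) prI s.1.2 * prI s.2 <= #|PP|%:R * (18%:R * (2%:R * CA * rr ^+ j0)).
Proof.
apply: (conv_new (t := third)) => [|x a w1 w2 /and5P[-> -> /eqP e lt1 lt2]]; first exact: third_ge_j0.
by split=> //; lia.
Qed.

Lemma fam2_inj x a x' a' : x \in PP -> x' \in PP -> A a -> A a' -> (a <= fst_val x)%N -> (a' <= fst_val x')%N ->
  x.2 = x'.2 -> (fst_val x + a = fst_val x' + a')%N -> x = x' /\ a = a'.
Proof.
move=> xP xP' Aa Aa' l l' ex e; have [A1 _ _ _ _] := PP_A xP; have [A1' _ _ _ _] := PP_A xP'.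
have [|h1 h2] := sidon_sum A_sidon Aa A1 Aa' A1' _ (etrans l (esym l')); first lia.
by split=> //; apply: pair_val_eq; rewrite // /snd_val ex.
Qed.

Lemma fam2_low x a w1 w2 : fam2 (x, a, w1, w2) -> PA x.2 && low w1 && low w2.
Proof.
case/and5P=> xP Aa la /eqP e lt; have [_ ->] := PP_PA xP; have := pow_k2; have [E _] := third_eq xP.
by have [_ _ l1 _ _] := PP_A xP; rewrite /low; lia.
Qed.

Lemma low_near w1 w2 : low w1 -> low w2 -> (w1 <= w2 + 2 ^ k.+2)%N && (w2 < w1 + 2 ^ k.+2)%N.
Proof. by rewrite /low; lia. Qed.

Lemma fam2_H1 : \sum_(s | fam2 s) (s.1.2 \in H)%:R * q s.2 <= aA * h * (2%:R * low_mass).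
Proof.
apply: (known2_le (PX := PA) (g := fun s : quint => (s.1.1.1.2, s.1.2, s.2))).
  move=> [[[x a] w1] w2] [[[x' a'] w1'] w2'] /= + + [ex ? ?]; subst w1' w2'.
  move=> /and5P[xP Aa lt /eqP e _] /and5P[xP' Aa' lt' /eqP e' _].
  by have [-> /val_inj->] := fam2_inj xP xP' Aa Aa' lt lt' ex (etrans e (esym e')).
by move=> [[[x a] w1] w2] /fam2_low/andP[/andP[/= -> l1] l2]; apply: low_near.
Qed.

Lemma fam2_H2 : \sum_(s | fam2 s) (s.2 \in H)%:R * q s.1.2 <= aA * h * (2%:R * low_mass).
Proof.
apply: (known2_le (PX := PA) (g := fun s : quint => (s.1.1.1.2, s.2, s.1.2))).
  move=> [[[x a] w1] w2] [[[x' a'] w1'] w2'] /= + + [ex ? ?]; subst w1' w2'.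
  move=> /and5P[xP Aa lt /eqP e _] /and5P[xP' Aa' lt' /eqP e' _].
  by have [-> /val_inj->] := fam2_inj xP xP' Aa Aa' lt lt' ex (etrans e (esym e')).
by move=> [[[x a] w1] w2] /fam2_low/andP[/andP[/= -> l1] l2]; apply: low_near.
Qed.

Lemma fam2'_le : \sum_(s | fam2' s) q s.2 <= aA * 2%:R * low_mass.
Proof.
apply: (known1_le (PX := PA) (g := fun s : quad => (s.1.1.2, true, s.2))).
  move=> [[x a] w] [[x' a'] w'] /= + + [ex ?]; subst w'.
  move=> /and4P[xP Aa lt /eqP e] /and4P[xP' Aa' lt' /eqP e'].
  by have [-> /val_inj->] := fam2_inj xP xP' Aa Aa' lt lt' ex (etrans e (esym e')).
move=> [[x a] w] /and4P[xP Aa lt /eqP e] /=; have [_ ->] := PP_PA xP.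
by have := pow_k2; have [E _] := third_eq xP; rewrite /low; lia.
Qed.

Definition ord12 (x : I * I) := (fst_val x <= snd_val x)%N.

Lemma card_pairb (X : finType) (P : pred X) : #|[pred u : X * bool | P u.1]|%:R = #|P|%:R * 2%:R :> R.
Proof.
rewrite -natrM -card_bool -cardX; congr (_%:R); apply: eq_card => -[x b].
by rewrite !inE /= andbT.
Qed.

Definition PAb := [pred u : I * bool | PA u.1].

Lemma fam3_low x a w1 w2 : fam3 (x, a, w1, w2) -> [/\ PA a, low w1 & low w2].
Proof.
case/and5P=> xP Aa /eqP e lt1 lt2; have := pow_k2; have [E _] := third_eq xP.
by rewrite PA_small //; [rewrite /low; split=> //; lia | lia].
Qed.

(** The other terms fix d, hence a1 + a2 = m - d, hence the pair up to order. *)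
Lemma fam3_inj x a w1 w2 x' : fam3 (x, a, w1, w2) -> fam3 (x', a, w1, w2) -> ord12 x = ord12 x' -> x = x'.
Proof.
by case/and5P=> xP _ /eqP e _ _ /and5P[xP' _ /eqP e' _ _]; apply: PP_eq => //; clear -e e'; lia.
Qed.

Lemma fam3_H1 : \sum_(s | fam3 s) (s.1.2 \in H)%:R * q s.2 <= aA * 2%:R * h * (2%:R * low_mass).
Proof.
rewrite -card_pairb.
apply: (known2_le (PX := PAb) (g := fun s : quint => ((s.1.1.2, ord12 s.1.1.1), s.1.2, s.2))).
  move=> [[[x a] w1] w2] [[[x' a'] w1'] w2'] /= + + [? eb ? ?]; subst a' w1' w2'.
  by move=> F1 F2; rewrite (fam3_inj F1 F2 eb).
by move=> [[[x a] w1] w2] /fam3_low[/= h1 l1 l2]; rewrite h1; apply: low_near.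
Qed.

Lemma fam3_H2 : \sum_(s | fam3 s) (s.2 \in H)%:R * q s.1.2 <= aA * 2%:R * h * (2%:R * low_mass).
Proof.
rewrite -card_pairb.
apply: (known2_le (PX := PAb) (g := fun s : quint => ((s.1.1.2, ord12 s.1.1.1), s.2, s.1.2))).
  move=> [[[x a] w1] w2] [[[x' a'] w1'] w2'] /= + + [? eb ? ?]; subst a' w1' w2'.
  by move=> F1 F2; rewrite (fam3_inj F1 F2 eb).
by move=> [[[x a] w1] w2] /fam3_low[/= h1 l1 l2]; rewrite h1; apply: low_near.
Qed.

Lemma fam3'_le : \sum_(s | fam3' s) q s.2 <= aA * 2%:R * low_mass.
Proof.
apply: (known1_le (PX := PA) (g := fun s : quad => (s.1.2, ord12 s.1.1, s.2))).
  move=> [[x a] w] [[x' a'] w'] /= + + [? eb ?]; subst a' w'.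
  move=> /and4P[xP _ /eqP e _] /and4P[xP' _ /eqP e' _].
  by rewrite (@PP_eq x x') //; clear -e e'; lia.
move=> [[x a] w] /and4P[xP Aa /eqP e lt] /=.
by have := pow_k2; have [E _] := third_eq xP; rewrite PA_small //; [rewrite /low; lia | lia].
Qed.

Lemma fam4_low x a w1 w2 : fam4 (x, a, w1, w2) -> [/\ PA a, low w1 & low w2].
Proof.
case/and5P=> xP Aa /eqP e lt1 lt2; have := pow_k2; have [E _] := third_eq xP.
by rewrite PA_small //; [rewrite /low; split=> //; lia | lia].
Qed.

Lemma fam4_inj x a w1 w2 x' : fam4 (x, a, w1, w2) -> fam4 (x', a, w1, w2) -> ord12 x = ord12 x' -> x = x'.
Proof.
by case/and5P=> xP _ /eqP e _ _ /and5P[xP' _ /eqP e' _ _]; apply: PP_eq => //; clear -e e'; lia.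
Qed.

Lemma fam4_H1 : \sum_(s | fam4 s) (s.1.2 \in H)%:R * q s.2 <= aA * 2%:R * h * (2%:R * low_mass).
Proof.
rewrite -card_pairb.
apply: (known2_le (PX := PAb) (g := fun s : quint => ((s.1.1.2, ord12 s.1.1.1), s.1.2, s.2))).
  move=> [[[x a] w1] w2] [[[x' a'] w1'] w2'] /= + + [? eb ? ?]; subst a' w1' w2'.
  by move=> F1 F2; rewrite (fam4_inj F1 F2 eb).
by move=> [[[x a] w1] w2] /fam4_low[/= h1 l1 l2]; rewrite h1; apply: low_near.
Qed.

Lemma fam4_H2 : \sum_(s | fam4 s) (s.2 \in H)%:R * q s.1.2 <= aA * 2%:R * h * (2%:R * low_mass).
Proof.
rewrite -card_pairb.
apply: (known2_le (PX := PAb) (g := fun s : quint => ((s.1.1.2, ord12 s.1.1.1), s.2, s.1.2))).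
  move=> [[[x a] w1] w2] [[[x' a'] w1'] w2'] /= + + [? eb ? ?]; subst a' w1' w2'.
  by move=> F1 F2; rewrite (fam4_inj F1 F2 eb).
by move=> [[[x a] w1] w2] /fam4_low[/= h1 l1 l2]; rewrite h1; apply: low_near.
Qed.

Lemma fam4'_le : \sum_(s | fam4' s) q s.2 <= aA * 2%:R * low_mass.
Proof.
apply: (known1_le (PX := PA) (g := fun s : quad => (s.1.2, ord12 s.1.1, s.2))).
  move=> [[x a] w] [[x' a'] w'] /= + + [? eb ?]; subst a' w'.
  move=> /and4P[xP _ /eqP e _] /and4P[xP' _ /eqP e' _].
  by rewrite (@PP_eq x x') //; clear -e e'; lia.
move=> [[x a] w] /and4P[xP Aa /eqP e lt] /=.
have := m_gt0; have := pow_k2; have [E E'] := third_eq xP; have [_ _ l1 _ l2] := PP_A xP.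
have x10 : (0 < fst_val x)%N by apply: leq_trans l2; rewrite expn_gt0.
by rewrite PA_small //; [rewrite /low; lia | lia].
Qed.

Lemma fam4_new : \sum_(s | fam4 s) prI s.1.2 * prI s.2 <=
  #|PP|%:R * (corr_const R * (85%:R * CA * rr ^+ j0)).
Proof.
pose F (t : (I * I) * I * I) := pr R t.2 * pr R (t.2 + gap (third t.1.1) t.1.2).
(* Keeps the smaller of the two random points, as [corr_gap] is stated for w and w + gap. *)
pose g (s : quint) := (s.1.1, if (s.1.1.2 <= third s.1.1.1)%N then s.1.2 else s.2).
apply: le_trans (_ : \sum_(s | fam4 s) F (g s) <= _).
  rewrite le_eqVlt; apply/orP; left; apply/eqP; apply: eq_bigr => -[[[x a] w1] w2] /=.
  case/and5P => _ _ /eqP e _ _; rewrite /prI /F /g /=; case: leqP => [le|lt]; last rewrite mulrC.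
    by congr (_ * pr _ _); rewrite /gap; clear -e le; lia.
  by congr (_ * pr _ _); rewrite /gap; clear -e lt; lia.
apply: (inj3_dep_le (PX := PP) (QY := fun x (a : I) => A a) (QZ := xpredT) (F := F)
  (G := fun x (a : I) => corr_const R * kappa ^+ lev (gap (third x) a)) (g := g)).
- by move=> t; rewrite mulr_ge0 ?pr_ge0.
- move=> [[[x a] w1] w2] [[[x' a'] w1'] w2'] + + []; rewrite /= => + + ? ?; subst x' a'.
  move=> /and5P[_ _ /eqP e1 _ _] /and5P[_ _ /eqP e2 _ _].
  case: leqP => le ?; [subst w1' | subst w2'].
    by congr pair; apply: val_inj => /=; clear -e1 e2; lia.
  by congr (_, _, _, _); apply: val_inj => /=; clear -e1 e2; lia.
- by move=> [[[x a] w1] w2] /and5P[/= -> ->].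
- by move=> x a xP Aa; rewrite /F /=; apply: corr_gap; apply: PP_gapd.
move=> x xP; rewrite -mulr_sumr ler_wpM2l ?corr_const_ge0 //.
apply: le_trans (sum_gap CA_ge1 A_local N (third x) j0).
rewrite big_mkcond [leRHS]big_mkcond; apply: ler_sum => a _.
case: ifP => [Aa|_]; first by rewrite PP_gapd.
exact: lexx.
Qed.

Lemma low_sum_pr : \sum_(w : I | low w) pr R w <= (16%:R / 3%:R) * (16%:R / 13%:R) ^+ k.+2.
Proof.
apply: le_trans (sum_pr_interval R N.+1 0 k.+2); rewrite big_mkord.
by rewrite le_eqVlt; apply/orP; left; apply/eqP/eq_bigl => w; rewrite add0n.
Qed.

(** Three random points with one linear relation: the ratio kappa (16/13) = 4 theta^3 is below
    64/65. *)
Lemma rr_fam5 : 18%:R * kappa ^+ k.-1 * ((16%:R / 3%:R) * (16%:R / 13%:R) ^+ k.+2) <= 179%:R * rr ^+ j0.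
Proof.
have -> : k.+2 = (k.-1 + 3)%N by lia.
apply: le_trans (_ : 179%:R * rr ^+ k.-1 <= _); last by rewrite ler_wpM2l ?ler0n // rr_le //; lia.
apply: le_trans (_ : 179%:R * (2048%:R / 2197%:R) ^+ k.-1 <= _); last first.
  by rewrite ler_wpM2l ?ler0n //; apply: lerXn2r; rewrite ?nnegrE ?divr_ge0 ?ler0n //; lra.
have -> : 2048%:R / 2197%:R = kappa * (16%:R / 13%:R) by lra.
have : 0 <= kappa ^+ k.-1 * (16%:R / 13%:R) ^+ k.-1.
  by rewrite mulr_ge0 ?exprn_ge0 ?kappa_ge0 // divr_ge0 ?ler0n.
rewrite (exprMn k.-1 kappa) exprD; move: (kappa ^+ _) ((16%:R / 13%:R) ^+ k.-1) => x y xy.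
rewrite [leLHS](_ : _ = (18%:R * (16%:R / 3%:R) * (16%:R / 13%:R) ^+ 3) * (x * y)); last by ring.
by rewrite ler_wpM2r //; lra.
Qed.

Lemma fam5_new : \sum_(s | fam5 s) prI s.1.1.2 * (prI s.1.2 * prI s.2) <= #|PP|%:R * (179%:R * rr ^+ j0).
Proof.
pose F (t : (I * I) * I * I) := pr R t.1.2 * (pr R t.2 * pr R (third t.1.1 + t.1.2 - t.2)).
apply: le_trans (_ : \sum_(s | fam5 s) F s.1 <= _).
  rewrite le_eqVlt; apply/orP; left; apply/eqP; apply: eq_bigr => -[[[x w1] w2] w3] /=.
  by case/and5P=> _ /eqP e _ _ _; rewrite /prI /F /= e addKn.
apply: (inj3_dep_le (PX := PP) (QY := fun x (w1 : I) => low w1)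
  (QZ := fun u : (I * I) * I * I => (u.2 <= third u.1.1 + u.1.2)%N) (F := F)
  (G := fun x (w1 : I) => pr R w1 * (18%:R * kappa ^+ k.-1)) (g := fun s : quint => s.1)).
- by move=> t; rewrite !mulr_ge0 ?pr_ge0.
- move=> [[[x a] w1] w2] [t w2'] /= + + e; rewrite -{t}e.
  move=> /and5P[_ /eqP e1 _ _ _] /and5P[_ /eqP e2 _ _ _].
  by congr pair; apply: val_inj => /=; clear -e1 e2; lia.
- move=> [[[x w1] w2] w3] /and5P[/= xP /eqP e l1 l2 l3]; rewrite xP e leq_addr andbT.
  by have := third_low xP; have := pow_k2; rewrite /low; lia.
- move=> x w1 xP lw1; rewrite /F /= -mulr_sumr ler_wpM2l ?pr_ge0 //.
  have d0 : (0 < third x)%N by rewrite (leq_trans _ (third_lev xP)) ?expn_gt0.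
  apply: le_trans (conv_sum _) _; first by rewrite addn_gt0 d0.
  rewrite ler_wpM2l ?ler0n //; apply: ler_wiXn2l; rewrite ?kappa_ge0 //; first by lra.
  by apply/lev_ge/(leq_trans (third_lev xP))/leq_addr.
move=> x xP; rewrite -mulr_suml mulrC; apply: le_trans rr_fam5.
by rewrite ler_wpM2l ?kappa18_ge0 // low_sum_pr.
Qed.

Definition Hb := [pred u : I * bool | u.1 \in H].

Lemma fam5_low x w1 w2 w3 : fam5 (x, w1, w2, w3) -> [/\ low w1, low w2 & low w3].
Proof.
case/and5P=> xP _ l1 l2 l3; have := third_low xP; have := pow_k2; rewrite /low => h1 h2.
by split; lia.
Qed.

Lemma fam5_inj x w1 w2 w3 x' : fam5 (x, w1, w2, w3) -> fam5 (x', w1, w2, w3) -> ord12 x = ord12 x' -> x = x'.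
Proof.
by case/and5P=> xP /eqP e _ _ _ /and5P[xP' /eqP e' _ _ _]; apply: PP_eq => //; clear -e e'; lia.
Qed.

Lemma fam5_H1 : \sum_(s | fam5 s) (s.1.1.2 \in H)%:R * (q s.1.2 * q s.2) <= h * 2%:R * low_mass * low_mass.
Proof.
rewrite -card_pairb.
apply: le_trans (_ : \sum_(s | fam5 s && (s.1.1.2 \in H)) q s.1.2 * q s.2 <= _).
  rewrite big_mkcondr; apply: ler_sum => s _; case: (_ \in H); last by rewrite mul0r.
  by rewrite mul1r.
apply: (known3_le (PX := Hb) (g := fun s : quint => ((s.1.1.2, ord12 s.1.1.1), s.1.2, s.2))).
  move=> [[[x a] w1] w2] [[[x' a'] w1'] w2'] /= + + [? eb ? ?]; subst a' w1' w2'.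
  by move=> /andP[F1 _] /andP[F2 _]; rewrite (fam5_inj F1 F2 eb).
by move=> [[[x w1] w2] w3] /andP[/fam5_low[/= h1 l1 l2] ->]; rewrite /= l1 l2.
Qed.

Lemma fam5_H2 : \sum_(s | fam5 s) (s.1.2 \in H)%:R * (q s.1.1.2 * q s.2) <= h * 2%:R * low_mass * low_mass.
Proof.
rewrite -card_pairb.
apply: le_trans (_ : \sum_(s | fam5 s && (s.1.2 \in H)) q s.1.1.2 * q s.2 <= _).
  rewrite big_mkcondr; apply: ler_sum => s _; case: (_ \in H); last by rewrite mul0r.
  by rewrite mul1r.
apply: (known3_le (PX := Hb) (g := fun s : quint => ((s.1.2, ord12 s.1.1.1), s.1.1.2, s.2))).
  move=> [[[x a] w1] w2] [[[x' a'] w1'] w2'] /= + + [? eb ? ?]; subst a' w1' w2'.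
  by move=> /andP[F1 _] /andP[F2 _]; rewrite (fam5_inj F1 F2 eb).
by move=> [[[x w1] w2] w3] /andP[/fam5_low[/= l1 h1 l2] ->]; rewrite /= l1 l2.
Qed.

Lemma fam5_H3 : \sum_(s | fam5 s) (s.2 \in H)%:R * (q s.1.1.2 * q s.1.2) <= h * 2%:R * low_mass * low_mass.
Proof.
rewrite -card_pairb.
apply: le_trans (_ : \sum_(s | fam5 s && (s.2 \in H)) q s.1.1.2 * q s.1.2 <= _).
  rewrite big_mkcondr; apply: ler_sum => s _; case: (_ \in H); last by rewrite mul0r.
  by rewrite mul1r.
apply: (known3_le (PX := Hb) (g := fun s : quint => ((s.2, ord12 s.1.1.1), s.1.1.2, s.1.2))).
  move=> [[[x a] w1] w2] [[[x' a'] w1'] w2'] /= + + [? eb ? ?]; subst a' w1' w2'.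
  by move=> /andP[F1 _] /andP[F2 _]; rewrite (fam5_inj F1 F2 eb).
by move=> [[[x w1] w2] w3] /andP[/fam5_low[/= l1 l2 h1] ->]; rewrite /= l1 l2.
Qed.

Lemma fam5'_le : \sum_(s | fam5' s) q s.1.2 * q s.2 <= 2%:R * low_mass * low_mass.
Proof.
have -> : 2%:R = #|(xpredT : pred bool)|%:R :> R by rewrite card_bool.
apply: (known3_le (PX := xpredT) (g := fun s : quad => (ord12 s.1.1, s.1.2, s.2))).
  move=> [[x w1] w2] [[x' w1'] w2'] /= + + [eb ? ?]; subst w1' w2'.
  move=> /and4P[xP /eqP e _ _] /and4P[xP' /eqP e' _ _].
  by rewrite (@PP_eq x x') //; clear -e e'; lia.
move=> [[x w1] w2] /and4P[/= xP /eqP e l1 l2].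
by have := third_low xP; have := pow_k2; rewrite /low; lia.
Qed.

Lemma prod_new_ge0 x W : 0 <= prod_new x W.
Proof. by apply: prodr_ge0 => v _; apply: pr_ge0. Qed.

Lemma fam1_total : \sum_(s | fam1 s) prod_new s.1.1.1 [set s.1.2; s.2] <=
  #|PP|%:R * (corr_const R * (85%:R * CA * rr ^+ j0)) + aA * h * (2%:R * low_mass) + aA * h * (2%:R * low_mass)
    + aA * 2%:R * low_mass + aA * 2%:R * low_mass.
Proof.
apply: le_trans (lerD (lerD (lerD (lerD fam1_new fam1_H1) fam1_H2) fam1_d1) fam1_d2).
rewrite [X in _ + X + _]big_mkcondr [X in _ <= _ + X]big_mkcondr -!big_split /=.
apply: ler_sum => -[[[x a] w1] w2] /= /and4P[xP _ lt /eqP e].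
have ne : w1 != w2 by apply/eqP => E1; move: e lt; rewrite E1; clear; lia.
apply: le_trans (prod_set2_any prI01 H (third_ord x) ne) _.
by rewrite le_eqVlt; apply/orP; left; apply/eqP; congr (_ + _ + _);
  case: (_ == third_ord x); rewrite ?mul1r ?mul0r.
Qed.

Lemma lt_neq (v w : I) : (v < w)%N -> v != w.
Proof. by apply: contraTneq => ->; rewrite ltnn. Qed.

Lemma third_ord_neq x (w : I) : x \in PP -> (w < third x)%N -> w != third_ord x.
Proof. by move=> xP lt; apply: lt_neq; rewrite third_ord_val. Qed.

Lemma fam2_total : \sum_(s | fam2 s) prod_new s.1.1.1 [set s.1.2; s.2] <=
  #|PP|%:R * (18%:R * (2%:R * CA * rr ^+ j0)) + aA * h * (2%:R * low_mass) + aA * h * (2%:R * low_mass).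
Proof.
apply: le_trans (lerD (lerD fam2_new fam2_H1) fam2_H2); rewrite -!big_split /=.
apply: ler_sum => -[[[x a] w1] w2] /= /and5P[xP _ la /eqP e lt].
have [E E'] := third_eq xP; have [_ _ l1 _ _] := PP_A xP; have m0 := m_gt0.
have [b1 b2] : (w1 < third x)%N /\ (w2 < third x)%N by clear -E E' l1 e la m0; lia.
by apply: (prod_set2 prI01); [exact: lt_neq|exact: third_ord_neq|exact: third_ord_neq].
Qed.

Lemma fam2'_total : \sum_(s | fam2' s) prod_new s.1.1 [set s.2] <= aA * 2%:R * low_mass.
Proof.
apply: le_trans fam2'_le; apply: ler_sum => -[[x a] w] /= /and4P[xP _ la /eqP e].
have [E E'] := third_eq xP; have [_ _ l1 _ _] := PP_A xP; have m0 := m_gt0.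
by apply: (prod_set1 prI01); apply: third_ord_neq => //; clear -E E' l1 e la m0; lia.
Qed.

Lemma fam3_total : \sum_(s | fam3 s) prod_new s.1.1.1 [set s.1.2; s.2] <=
  #|PP|%:R * (18%:R * (2%:R * CA * rr ^+ j0)) + aA * 2%:R * h * (2%:R * low_mass) + aA * 2%:R * h * (2%:R * low_mass).
Proof.
apply: le_trans (lerD (lerD fam3_new fam3_H1) fam3_H2); rewrite -!big_split /=.
apply: ler_sum => -[[[x a] w1] w2] /= /and5P[xP _ _ lt lt2].
have lt1 := ltn_trans lt lt2.
by apply: (prod_set2 prI01); [exact: lt_neq|exact: third_ord_neq|exact: third_ord_neq].
Qed.

Lemma fam3'_total : \sum_(s | fam3' s) prod_new s.1.1 [set s.2] <= aA * 2%:R * low_mass.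
Proof.
apply: le_trans fam3'_le; apply: ler_sum => -[[x a] w] /= /and4P[xP _ _ lt].
by apply: (prod_set1 prI01); apply: third_ord_neq.
Qed.

Lemma fam4_total : \sum_(s | fam4 s) prod_new s.1.1.1 [set s.1.2; s.2] <=
  #|PP|%:R * (corr_const R * (85%:R * CA * rr ^+ j0)) + aA * 2%:R * h * (2%:R * low_mass) + aA * 2%:R * h * (2%:R * low_mass).
Proof.
apply: le_trans (lerD (lerD fam4_new fam4_H1) fam4_H2); rewrite -!big_split /=.
apply: ler_sum => -[[[x a] w1] w2] /= /and5P[xP Aa /eqP e lt lt2].
have ne : w1 != w2.
  apply/eqP => E; have := PP_gapd xP Aa; have : third x = a by move: e; rewrite E; clear; lia.
  by move=> ->; rewrite /gap subnn leqn0 expn_eq0.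
by apply: (prod_set2 prI01); [exact: ne|exact: third_ord_neq|exact: third_ord_neq].
Qed.

Lemma fam4'_total : \sum_(s | fam4' s) prod_new s.1.1 [set s.2] <= aA * 2%:R * low_mass.
Proof.
apply: le_trans fam4'_le; apply: ler_sum => -[[x a] w] /= /and4P[xP _ _ lt].
by apply: (prod_set1 prI01); apply: third_ord_neq.
Qed.

Lemma fam5_total : \sum_(s | fam5 s) prod_new s.1.1.1 (s.1.1.2 |: [set s.1.2; s.2]) <=
  #|PP|%:R * (179%:R * rr ^+ j0) + h * 2%:R * low_mass * low_mass + h * 2%:R * low_mass * low_mass + h * 2%:R * low_mass * low_mass.
Proof.
apply: le_trans (lerD (lerD (lerD fam5_new fam5_H1) fam5_H2) fam5_H3); rewrite -!big_split /=.
apply: ler_sum => -[[[x w1] w2] w3] /= /and5P[xP _ lt1 lt2 lt3].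
have lt2' := ltn_trans lt2 lt3; have lt13 := ltn_trans lt1 lt2; have lt1' := ltn_trans lt1 lt2'.
by apply: (prod_set3 prI01); [exact: lt_neq|exact: lt_neq|exact: lt_neq|exact: third_ord_neq|exact: third_ord_neq|exact: third_ord_neq].
Qed.

Lemma fam5'_total : \sum_(s | fam5' s) prod_new s.1.1 [set s.1.2; s.2] <= 2%:R * low_mass * low_mass.
Proof.
apply: le_trans fam5'_le; apply: ler_sum => -[[x w1] w2] /= /and4P[xP _ lt1 lt2].
have lt := ltn_trans lt1 lt2.
by apply: (prod_set2_le prI01); [exact: lt_neq|exact: third_ord_neq|exact: third_ord_neq].
Qed.

(** * The list of configurations and its total weight *)

Definition pair_conf (s : quint) := (third_ord s.1.1.1, [set s.1.2; s.2]).
Definition single_conf (s : quad) := (third_ord s.1.1, [set s.2]).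
Definition triple_conf (s : quint) := (third_ord s.1.1.1, s.1.1.2 |: [set s.1.2; s.2]).
Definition pair_conf' (s : quad) := (third_ord s.1.1, [set s.1.2; s.2]).

Definition confs : seq (I * {set I}) :=
  [seq pair_conf s | s in fam1] ++ [seq pair_conf s | s in fam2] ++
  [seq single_conf s | s in fam2'] ++ [seq pair_conf s | s in fam3] ++
  [seq single_conf s | s in fam3'] ++ [seq pair_conf s | s in fam4] ++
  [seq single_conf s | s in fam4'] ++ [seq triple_conf s | s in fam5] ++
  [seq pair_conf' s | s in fam5'].

Lemma confs_small F : F \in confs -> (#|F.2| <= 3)%N.
Proof.
have c2 (v w : I) : (#|[set v; w]| <= 2)%N by rewrite cards2; case: (_ == _).
rewrite !mem_cat; do 8 ?[case/orP]; case/imageP => s _ -> /=; rewrite ?cards1 ?(leq_trans (c2 _ _)) //.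
by rewrite (leq_trans (leq_card_setU _ _)) // cards1 add1n ltnS c2.
Qed.

(** The factor theta^(k-1) bounds the intensity of the head d, which is at least 2^(k-1). *)
Lemma confs_wt : \sum_(F <- confs | F.1 \notin H) conf_wt prI H F <=
  theta R ^+ k.-1 * (1700%:R * CA * #|PP|%:R * rr ^+ j0 + 24%:R * (h + 1) * low_mass * (aA + low_mass)).
Proof.
have th0 : 0 <= theta R ^+ k.-1 by rewrite exprn_ge0 // theta_ge0.
have wt_le x W : x \in PP -> (if third_ord x \notin H then conf_wt prI H (third_ord x, W) else 0) <= theta R ^+ k.-1 * prod_new x W.
  move=> xP; case: ifP => _; last by rewrite mulr_ge0 ?prod_new_ge0.
  by rewrite ler_wpM2r ?prod_new_ge0 // /prI third_ord_val //; apply/pr_le/third_lev.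
rewrite big_mkcond !big_cat !big_image /=.
have sum_wt (S : finType) (P : pred S) (x : S -> I * I) (W : S -> {set I}) B : (forall s, P s -> x s \in PP) ->
    \sum_(s | P s) prod_new (x s) (W s) <= B ->
    \sum_(s in P) (if third_ord (x s) \notin H then conf_wt prI H (third_ord (x s), W s) else 0) <= theta R ^+ k.-1 * B.
  move=> hP hB; apply: le_trans (ler_wpM2l th0 hB); rewrite mulr_sumr.
  by apply: ler_sum => s Ps; apply/wt_le/hP.
have P1 (s : quint) : fam1 s -> s.1.1.1 \in PP by case: s => [[[x a] w1] w2] /and4P[].
have P2 (s : quint) : fam2 s -> s.1.1.1 \in PP by case: s => [[[x a] w1] w2] /and5P[].
have P2' (s : quad) : fam2' s -> s.1.1 \in PP by case: s => [[x a] w] /and4P[].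
have P3 (s : quint) : fam3 s -> s.1.1.1 \in PP by case: s => [[[x a] w1] w2] /and5P[].
have P3' (s : quad) : fam3' s -> s.1.1 \in PP by case: s => [[x a] w] /and4P[].
have P4 (s : quint) : fam4 s -> s.1.1.1 \in PP by case: s => [[[x a] w1] w2] /and5P[].
have P4' (s : quad) : fam4' s -> s.1.1 \in PP by case: s => [[x a] w] /and4P[].
have P5 (s : quint) : fam5 s -> s.1.1.1 \in PP by case: s => [[[x a] w1] w2] /and5P[].
have P5' (s : quad) : fam5' s -> s.1.1 \in PP by case: s => [[x a] w] /and4P[].
apply: le_trans (lerD (sum_wt _ _ _ _ _ P1 fam1_total) (lerD (sum_wt _ _ _ _ _ P2 fam2_total)
  (lerD (sum_wt _ _ _ _ _ P2' fam2'_total) (lerD (sum_wt _ _ _ _ _ P3 fam3_total)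
  (lerD (sum_wt _ _ _ _ _ P3' fam3'_total) (lerD (sum_wt _ _ _ _ _ P4 fam4_total)
  (lerD (sum_wt _ _ _ _ _ P4' fam4'_total) (lerD (sum_wt _ _ _ _ _ P5 fam5_total)
  (sum_wt _ _ _ _ _ P5' fam5'_total))))))))) _.
rewrite -!mulrDr ler_wpM2l //.
have [a0 h0 u0] : [/\ 0 <= aA, 0 <= h & 0 <= low_mass] by rewrite !ler0n low_mass_ge0.
have J0 : 0 <= #|PP|%:R * rr ^+ j0 by rewrite mulr_ge0 ?ler0n ?exprn_ge0 ?rr_ge0.
have cJ : #|PP|%:R * rr ^+ j0 <= CA * (#|PP|%:R * rr ^+ j0) by rewrite ler_peMl.
have au : 0 <= aA * low_mass by rewrite mulr_ge0.
have hau : 0 <= h * (aA * low_mass) by rewrite mulr_ge0.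
have uu : 0 <= low_mass * low_mass by rewrite mulr_ge0.
have huu : 0 <= h * (low_mass * low_mass) by rewrite mulr_ge0.
(* The new terms add up to 2 * 85 * corr_const + 72 + 179 < 1700; the coefficient of h * aA *
   low_mass is 4 + 4 + 8 + 8 = 24. *)
rewrite /corr_const; move: J0 cJ au hau uu huu.
move: (#|PP|%:R : R) (rr ^+ j0) aA h low_mass => P J a h' u; lra.
Qed.

Lemma card_PA_le : aA <= CA * (13%:R / 10%:R) ^+ k.+2.
Proof.
apply: (card_local A_local (t := 0)) => a /andP[Aa lt]; rewrite add0n; split=> //.
by rewrite addn_gt0 expn_gt0 orbT.
Qed.

Lemma theta_growth :
  theta R ^+ k.-1 * ((16%:R / 13%:R) ^+ k.+2 * (13%:R / 10%:R) ^+ k.+2) <= 5%:R * rr ^+ j0.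
Proof.
apply: le_trans (_ : 5%:R * rr ^+ k.-1 <= _); last by rewrite ler_wpM2l ?ler0n // rr_le //; lia.
have -> : k.+2 = (k.-1 + 3)%N by lia.
have -> : rr = theta R * (16%:R / 13%:R) * (13%:R / 10%:R) by rewrite /theta; lra.
rewrite (exprMn k.-1 (theta R * _)) (exprMn k.-1 (theta R)) !(exprD _ k.-1 3).
have : 0 <= theta R ^+ k.-1 * (16%:R / 13%:R) ^+ k.-1 * (13%:R / 10%:R) ^+ k.-1.
  by rewrite !mulr_ge0 ?exprn_ge0 ?s_ge0 ?theta_ge0 // divr_ge0 ?ler0n.
move: (theta R ^+ _) ((16%:R / 13%:R) ^+ k.-1) ((13%:R / 10%:R) ^+ k.-1) => x y z xyz.
rewrite [leLHS](_ : _ = ((16%:R / 13%:R) ^+ 3 * (13%:R / 10%:R) ^+ 3) * (x * y * z)); last by ring.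
by rewrite ler_wpM2r //; lra.
Qed.

(** The terms with known points also decay, since theta (16/13) (13/10) = 64/65; B bounds the
    expected number of available d up to a constant. *)
Lemma confs_rho (h0 : nat) (B : R) : (#|H| <= h0)%N -> #|PP|%:R * theta R ^+ k.-1 <= B ->
  \sum_(F <- confs | F.1 \notin H) conf_wt prI H F <=
  (1700%:R * CA * B + 120%:R * (h0%:R + 1) * (h0%:R + 6%:R) * (CA + h0%:R + 6%:R)) * rr ^+ j0.
Proof.
move=> leh leB; apply: le_trans confs_wt _; rewrite [leLHS]mulrDr [leRHS]mulrDl; apply: lerD.
  rewrite [leLHS](_ : _ = 1700%:R * CA * (#|PP|%:R * theta R ^+ k.-1) * rr ^+ j0); last by ring.
  have c0 : 0 <= 1700%:R * CA by rewrite mulr_ge0 ?ler0n // (le_trans ler01 CA_ge1).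
  by rewrite ler_wpM2r ?exprn_ge0 ?rr_ge0 // ler_wpM2l.
have hh : h <= h0%:R by rewrite ler_nat.
have gn : (1 : R) <= (16%:R / 13%:R) ^+ k.+2 by rewrite exprn_ege1 //; lra.
have gs : (16%:R / 13%:R) ^+ k.+2 <= (13%:R / 10%:R) ^+ k.+2 :> R.
  by apply: lerXn2r; rewrite ?nnegrE ?divr_ge0 ?ler0n //; lra.
have hp : 0 <= h by rewrite ler0n.
have U0 := low_mass_ge0; have th0 : 0 <= theta R ^+ k.-1 by rewrite exprn_ge0 ?theta_ge0.
have leU : low_mass <= (h0%:R + 6%:R) * (16%:R / 13%:R) ^+ k.+2.
  by rewrite /low_mass; move: gn hh hp; move: h (h0%:R : R) (_ ^+ k.+2) => x y z; nra.
have leAU : aA + low_mass <= (CA + h0%:R + 6%:R) * (13%:R / 10%:R) ^+ k.+2.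
  have : (h0%:R + 6%:R) * (16%:R / 13%:R) ^+ k.+2 <= (h0%:R + 6%:R) * (13%:R / 10%:R) ^+ k.+2 :> R.
    by apply: ler_wpM2l => //; rewrite addr_ge0 ?ler0n.
  move=> le; rewrite -addrA mulrDl; exact: lerD card_PA_le (le_trans leU le).
have := theta_growth; move: gn gs leU leAU.
move: ((16%:R / 13%:R : R) ^+ k.+2) ((13%:R / 10%:R : R) ^+ k.+2) => g sg gn gs leU leAU grow.
have aU0 : 0 <= aA + low_mass by rewrite addr_ge0 ?ler0n.
have step : low_mass * (aA + low_mass) <= ((h0%:R + 6%:R) * g) * ((CA + h0%:R + 6%:R) * sg) by apply: ler_pM.
have step2 : 24%:R * (h + 1) * (low_mass * (aA + low_mass)) <=
    24%:R * (h0%:R + 1) * (((h0%:R + 6%:R) * g) * ((CA + h0%:R + 6%:R) * sg)).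
  apply: ler_pM => //.
  - by rewrite mulr_ge0 ?ler0n // addr_ge0.
  - by rewrite mulr_ge0.
  - by rewrite ler_wpM2l ?ler0n // lerD2r.
apply: le_trans (_ : theta R ^+ k.-1 * (24%:R * (h0%:R + 1) * (((h0%:R + 6%:R) * g) * ((CA + h0%:R + 6%:R) * sg))) <= _).
  by rewrite ler_wpM2l // -mulrA.
rewrite [leLHS](_ : _ = 24%:R * (h0%:R + 1) * (h0%:R + 6%:R) * (CA + h0%:R + 6%:R) * (theta R ^+ k.-1 * (g * sg))); last by ring.
rewrite [leRHS](_ : _ = 24%:R * (h0%:R + 1) * (h0%:R + 6%:R) * (CA + h0%:R + 6%:R) * (5%:R * rr ^+ j0)); last by ring.
rewrite ler_wpM2l // !mulr_ge0 ?addr_ge0 ?ler0n ?ler01 //.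
by rewrite (le_trans ler01 CA_ge1).
Qed.
End Families.

Local Close Scope ring_scope.

(** * Selection of the representations *)

Lemma card_code (T J : finType) (B : {set T}) (P : pred J) (c : T -> J) :
  {in B &, injective c} -> (forall x, x \in B -> P (c x)) -> #|B| <= #|P|.
Proof.
move=> inj hP; rewrite -(card_in_imset inj); apply/subset_leq_card/subsetP => j.
by case/imsetP => x xB ->; apply: hP.
Qed.

Lemma gap_eq a b c d : gap a b = gap c d -> (a <= b) = (c <= d) -> a + d = c + b.
Proof. by rewrite /gap; lia. Qed.

(** In a Sidon set a nonzero signed difference determines the pair, so few elements have a close
    neighbour. *)
Lemma card_crowded (A : pred nat) N (B : {set 'I_N.+1}) j : sidon_pred A ->
  (forall a, a \in B -> A a /\ exists b, [/\ A b, b != a & gap a b < 2 ^ j]) -> #|B| <= 4 * 2 ^ j.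
Proof.
move=> sA hB.
have exf (a : 'I_N.+1) : exists b, a \in B -> [/\ A a, A b, b != a & gap a b < 2 ^ j].
  case: (boolP (a \in B)) => [/hB[Aa [b [Ab ne lt]]]|_]; last by exists 0.
  by exists b.
have [f fP] := choice exf.
pose c (a : 'I_N.+1) : bool * 'I_(2 ^ j).+1 := (a <= f a, inord (gap a (f a))).
apply: leq_trans (card_code (P := xpredT) (c := c) _ _) _ => //; last first.
  rewrite (eq_card (B := [predX predT & predT])) ?cardX ?cardT ?size_enum_ord -?cardT ?card_bool //.
  by have := expn_gt0 2 j; lia.
move=> a b aB bB [eb /(congr1 val)].
have [Aa Af ne lt] := fP a aB; have [Ab Af' ne' lt'] := fP b bB.
rewrite /= !inordK; [|lia|lia] => eg; have e := gap_eq eg eb.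
by apply: val_inj => /=; case: (sA _ _ _ _ Aa Af' Ab Af e) => -[e1 e2] //; rewrite e1 eqxx in ne.
Qed.

Lemma third_sum m N (x y : 'I_N.+1 * 'I_N.+1) : fst_val x + snd_val x <= m -> fst_val y + snd_val y <= m ->
  third m x = third m y -> fst_val x + snd_val x = fst_val y + snd_val y.
Proof. by rewrite /third; lia. Qed.

(** The nearby element a and the signed gap give d, hence a1 + a2, hence the pair up to order. *)
Lemma card_pairs_near (A : pred nat) N (B : {set 'I_N.+1 * 'I_N.+1}) m k j c : sidon_pred A ->
  (forall s : seq nat, uniq s -> (forall a, a \in s -> A a && (a < 2 ^ k.+2)) -> size s <= c) ->
  (forall x, x \in B -> [/\ A (fst_val x), A (snd_val x), fst_val x + snd_val x <= m &
     exists2 a, A a && (a < 2 ^ k.+2) & gap (third m x) a < 2 ^ j]) ->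
  #|B| <= c * (8 * 2 ^ j).
Proof.
move=> sA hc hB; set I := 'I_N.+1.
have exf (x : I * I) : exists a, x \in B -> [/\ A a, a < 2 ^ k.+2 & gap (third m x) a < 2 ^ j].
  case: (boolP (x \in B)) => [/hB[_ _ _ [a /andP[Aa lt] lt2]]|_]; last by exists 0.
  by exists a.
have [f fP] := choice exf.
pose code (x : I * I) : 'I_(2 ^ k.+2).+1 * (bool * bool * 'I_(2 ^ j).+1) :=
  (inord (f x), (third m x <= f x, ord12 x, inord (gap (third m x) (f x)))).
apply: leq_trans (card_code (P := [predX [pred a : 'I_(2 ^ k.+2).+1 | A a && (a < 2 ^ k.+2)] & predT]) (c := code) _ _) _.
- move=> x y xB yB [/(congr1 val) ea eb eo /(congr1 val) eg].
  have [_ ltx gx] := fP x xB; have [_ lty gy] := fP y yB.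
  move: ea eg; rewrite /= !inordK; [|lia..] => ea eg.
  have := gap_eq eg eb; rewrite ea => /addIn ed.
  have [A1 A2 lx _] := hB x xB; have [A1' A2' ly _] := hB y yB.
  have es := third_sum lx ly ed.
  have [h1 h2] := sidon_sum sA A1 A2 A1' A2' es eo.
  exact: pair_val_eq.
- by move=> x /fP[Aa lt _]; rewrite !inE /= !inordK ?Aa ?lt // ltnW.
rewrite cardX leq_mul //; last first.
  rewrite (eq_card (B := [predX [predX predT & predT] & predT])) ?cardX; last by move=> [[? ?] ?].
  by rewrite !card_bool card_ord; have := expn_gt0 2 j; lia.
rewrite cardE -(size_map val); apply: hc.
  by rewrite map_inj_uniq ?enum_uniq //; apply: val_inj.
by move=> v /mapP[a]; rewrite mem_enum => ha ->.
Qed.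
Lemma lin_le_exp2 k : 4 * 4096 <= k -> 3 * k <= 2 ^ (k %/ 300).
Proof.
move=> le_k; have gen q : 900 * (q + 15) <= 2 ^ (q + 14).
  elim: q => [|q IH]; first by rewrite add0n; lia.
  by rewrite !addSn expnS; lia.
have := gen (k %/ 300 - 14); rewrite subnK; last by lia.
by move=> le; apply: leq_trans le; lia.
Qed.

(** 12/17 = 0.7059 is slightly above log2 (13/8) = 0.7004 and still below 0.37 (1 + 15/16) =
    0.7168. *)
Lemma pow13_17 : 13 ^ 17 <= 8 ^ 17 * 2 ^ 12.
Proof.
have : ((13%:R : rat) ^+ 17 <= 8%:R ^+ 17 * 2%:R ^+ 12)%R by lra.
by rewrite -!natrX -natrM ler_nat.
Qed.

Lemma pow13_div k : 13 ^ k %/ 8 ^ k <= 2 ^ (12 * (k %/ 17) + 16).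
Proof.
have h : 13 ^ k <= 2 ^ (12 * (k %/ 17) + 16) * 8 ^ k.
  have [q [r [-> lt ->]]] : exists q r, [/\ k = q * 17 + r, r <= 16 & k %/ 17 = q].
    by exists (k %/ 17), (k %% 17); split=> //; [exact: divn_eq | lia].
  have e1 : 13 ^ (q * 17) <= (8 ^ 17 * 2 ^ 12) ^ q.
    have gen (x y : nat) : x <= y -> x ^ q <= y ^ q.
      by case: (posnP q) => [->|q0 le] //; rewrite leq_exp2r.
    by rewrite mulnC expnM; apply: gen; exact: pow13_17.
  have e2 : 13 ^ r <= 2 ^ 16 * 8 ^ r.
    apply: leq_trans (_ : 16 ^ r <= _).
      by case: (posnP r) => [->|r0] //; rewrite leq_exp2r.
    by rewrite (expnMn 2 8) leq_mul2r leq_exp2l // lt orbT.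
  rewrite (expnD 13 (q * 17) r); apply: leq_trans (leq_mul e1 e2) _.
  rewrite expnMn -(expnM 8 17 q) -(expnM 2 12 q) (expnD 2 (12 * q) 16) (expnD 8 (q * 17) r) (mulnC q 17).
  by rewrite (mulnC (8 ^ (17 * q)) (2 ^ (12 * q))) mulnACA.
by apply: leq_trans (leq_div2r _ h) _; rewrite mulnK ?expn_gt0.
Qed.
Lemma dense_sidon_tagged : exists n0, forall t n N, t \in tags -> n0 <= n -> 2 ^ n <= N.+1 ->
  2 ^ ((37 * n) %/ 100) <= #|[set a : 'I_N.+1 | [&& dense_sidon a, a < 2 ^ n & a %% 64 == t]]|.
Proof.
have exf r : exists n0, r < 4 -> forall n, n0 <= n -> exists s : seq nat,
    [/\ uniq s, forall a, a \in s -> [/\ dense_sidon a, a < 2 ^ n & a %% 64 = nth 0 tags r]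
      & 2 ^ ((37 * n) %/ 100) <= size s].
  by case: (ltnP r 4) => [/dense_sidon_many[n0 h]|_]; [exists n0 | exists 0].
have [f fP] := choice exf.
exists (f 0 + f 1 + f 2 + f 3) => t n N /(nthP 0)[r lt_r <-] le_n le_N.
have le_fr : f r <= n by case: r lt_r => [|[|[|[|//]]]] _; lia.
have [s [us hs le_s]] := fP r lt_r n le_fr; apply: leq_trans le_s _.
rewrite cardE -(size_map val); apply: uniq_leq_size => // a /hs[Aa lt e].
have ia : (inord a : 'I_N.+1) = a :> nat by rewrite inordK // (leq_trans lt).
apply/mapP; exists (inord a); last by rewrite /= ia.
by rewrite mem_enum inE ia Aa lt e eqxx.
Qed.

Definition isolated j a := `[< forall b, dense_sidon b -> b != a -> 2 ^ j <= gap a b >].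

Definition spread_out N t n j := [set a : 'I_N.+1 |
  [&& dense_sidon a, a < 2 ^ n, a %% 64 == t, 2 ^ j <= a & isolated j a]].

Lemma card_spread_out : exists n0, forall t n j N, t \in tags -> n0 <= n -> 2 ^ n <= N.+1 ->
  j + 4 <= (37 * n) %/ 100 -> 2 ^ ((37 * n) %/ 100).-1 <= #|spread_out N t n j|.
Proof.
have [n0 h0] := dense_sidon_tagged; exists n0 => t n j N t_in le_n le_N le_j.
have := h0 t n N t_in le_n le_N; set e := (37 * n) %/ 100 in le_j *; set A1 := [set _ | _] => leA.
pose low := [set a : 'I_N.+1 | a < 2 ^ j]; pose crowd := [set a in A1 | ~~ isolated j a].
have low_le : #|low| <= 2 ^ j.
  rewrite cardE -(size_map val) -[leqRHS](size_iota 0); apply: uniq_leq_size.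
    by rewrite map_inj_uniq ?enum_uniq //; apply: val_inj.
  by move=> v /mapP[a]; rewrite mem_enum inE mem_iota => ? ->.
have crowd_le : #|crowd| <= 4 * 2 ^ j.
  apply: (card_crowded dense_sidon_sidon) => a; rewrite !inE => /andP[/and3P[Aa _ _] /asboolPn].
  move=> nI; split=> //; apply: contrapT => nex; apply: nI => b Ab ne.
  by rewrite leqNgt; apply/negP => lt; apply: nex; exists b.
have sub : A1 \subset spread_out N t n j :|: (low :|: crowd).
  apply/subsetP => a; rewrite !inE => /and3P[-> -> ->] /=.
  by case: leqP; case: (isolated j a); rewrite ?orbT.
have := subset_leq_card sub; have := (leq_card_setU (spread_out N t n j) (low :|: crowd)).1.
have := (leq_card_setU low crowd).1; have : 2 ^ e = 2 * 2 ^ e.-1 by rewrite -expnS prednK //; lia.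
have : 8 * 2 ^ j <= 2 ^ e.-1 by rewrite (_ : 8 = 2 ^ 3) // -expnD leq_exp2l //; lia.
move: low_le crowd_le leA; move: #|A1| #|_| #|_| #|_| #|_| #|_| => c1 c2 c3 c4 c5 c6.
move: #|spread_out _ _ _ _| => c7; move: (2 ^ e) (2 ^ e.-1) (2 ^ j) => x y z *; lia.
Qed.

(* Enough values [d] of weight [theta ^ k] for a random set to miss them all with probability
   at most [2 ^ - 3 k]. *)
Definition reps k := 3 * k * (2 * (13 ^ k %/ 8 ^ k).+1).

Definition swap N (x : 'I_N.+1 * 'I_N.+1) := (x.2, x.1).

Lemma fst_val_swap N (x : 'I_N.+1 * 'I_N.+1) : fst_val (swap x) = snd_val x. Proof. by []. Qed.
Lemma snd_val_swap N (x : 'I_N.+1 * 'I_N.+1) : snd_val (swap x) = fst_val x. Proof. by []. Qed.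
Lemma third_swap m N (x : 'I_N.+1 * 'I_N.+1) : third m (swap x) = third m x.
Proof. by rewrite /third fst_val_swap snd_val_swap; lia. Qed.

Lemma reps_le k : 4 * 4096 <= k ->
  reps k <= 2 ^ ((37 * (k - 3)) %/ 100).-1.-1 * 2 ^ ((37 * (15 * k %/ 16)) %/ 100).-1.-1.
Proof.
move=> le_k; apply: leq_trans (_ : 2 ^ (k %/ 300) * 2 ^ (12 * (k %/ 17) + 18) <= _).
  rewrite leq_mul ?lin_le_exp2 // addnS expnS leq_mul2l /= addnS expnS.
  by have := pow13_div k; have := expn_gt0 2 (12 * (k %/ 17) + 16); move: (_ %/ _) (2 ^ _) => x y; lia.
by rewrite -!expnD leq_exp2l //; lia.
Qed.

Lemma near_small k : 4 * 4096 <= k -> 2 ^ ((151 * k.+2) %/ 400) * (8 * 2 ^ (k %/ 4)) <=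
  2 ^ ((37 * (k - 3)) %/ 100).-1.-1 * 2 ^ ((37 * (15 * k %/ 16)) %/ 100).-1.-1.
Proof. by move=> le_k; rewrite (_ : 8 = 2 ^ 3) // -!expnD leq_exp2l //; lia. Qed.

(** Closure under [swap] lets the families, which only treat the first component, cover deletions of
    a2. The size of PP is capped so that its expected contribution stays O(k). *)
Definition selected N k m (PP : {set 'I_N.+1 * 'I_N.+1}) :=
  [/\ forall x, x \in PP -> [/\ dense_sidon (fst_val x), dense_sidon (snd_val x),
        8 * fst_val x <= m, 8 * snd_val x <= m & 2 ^ (k %/ 4) <= fst_val x],
      forall x (a : nat), x \in PP -> dense_sidon a -> a != fst_val x -> 2 ^ (k %/ 4) <= gap (fst_val x) a,
      forall x (a : nat), x \in PP -> dense_sidon a -> 2 ^ (k %/ 4) <= gap (third m x) a &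
      forall x, x \in PP -> [/\ swap x \in PP, free_tag (third m x) & minn (fst_val x) (snd_val x) <= 2 ^ (15 * k %/ 16)]]
  /\ #|PP| <= 2 * reps k /\ reps k <= #|[set third_ord m x | x in PP]|.

Lemma ex_selected : exists k0, forall k m N, k0 <= k -> 2 ^ k <= m < 2 ^ k.+1 -> m <= N ->
  exists PP : {set 'I_N.+1 * 'I_N.+1}, selected k m PP.
Proof.
have [n0 spread] := card_spread_out; have [n1 local] := dense_sidon_local.
exists (4 * 4096 + 2 * n0 + n1) => k m N le_k /andP[le_m lt_m] le_N.
(* i1 makes 8 a1 <= m, i2 bounds the smallest summand, and j is small enough for the discarded pairs
   to be a minority. *)
set j := k %/ 4; set i1 := k - 3; set i2 := 15 * k %/ 16.
have [t1 [t2 [t1_in t2_in free]]] := free_tag_cover m.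
pose L1 := spread_out N t1 i1 j; pose L2 := spread_out N t2 i2 j.
have pow_le i : i <= k -> 2 ^ i <= N.+1.
  by move=> le; apply: leq_trans (leqW le_N); apply: leq_trans le_m; rewrite leq_exp2l.
have le_i2 : i2 <= i1 by rewrite /i1 /i2; lia.
have L1_ge : 2 ^ ((37 * i1) %/ 100).-1 <= #|L1|.
  by apply: spread; rewrite // ?pow_le // /i1 /j; lia.
have L2_ge : 2 ^ ((37 * i2) %/ 100).-1 <= #|L2|.
  by apply: spread; rewrite // ?pow_le // /i1 /i2 /j; lia.
pose far (x : 'I_N.+1 * 'I_N.+1) := `[< forall a, dense_sidon a -> 2 ^ j <= gap (third m x) a >].
pose X := setX L1 L2; pose Near := [set x in X | ~~ far x]; pose Q := [set x in X | far x].
have XP x : x \in X -> [/\ dense_sidon (fst_val x) /\ dense_sidon (snd_val x), fst_val x < 2 ^ i1 /\ snd_val x < 2 ^ i2,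
    fst_val x %% 64 = t1 /\ snd_val x %% 64 = t2, 2 ^ j <= fst_val x /\ 2 ^ j <= snd_val x & isolated j (fst_val x) /\ isolated j (snd_val x)].
  case: x => x1 x2; rewrite in_setX !inE /= => /andP[/and5P[h1 h2 /eqP h3 h4 h5] /and5P[g1 g2 /eqP g3 g4 g5]].
  by split.
have pow_i1 : 8 * 2 ^ i1 <= m.
  apply: leq_trans le_m; rewrite (_ : 8 = 2 ^ 3) // -expnD leq_exp2l // /i1; lia.
have pow_i2 : 2 ^ i2 <= 2 ^ i1 by rewrite leq_exp2l.
have sum_le x : x \in X -> fst_val x + snd_val x <= m.
  by move=> /XP[_ [h1 h2] _ _ _]; lia.
have Near_le : #|Near| <= 2 ^ ((151 * k.+2) %/ 400) * (8 * 2 ^ j).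
  apply: (@card_pairs_near dense_sidon _ _ m k j) dense_sidon_sidon _ _.
    move=> s us hs; apply: (local _ 0) => //; first by lia.
    by move=> a /hs/andP[-> lt]; rewrite add0n lt addn_gt0 expn_gt0 orbT.
  move=> x; rewrite inE => /andP[xX /asboolPn nfar]; have [[A1 A2] _ _ _ _] := XP x xX.
  split=> //; first exact: sum_le.
  apply: contrapT => nex; apply: nfar => a Aa; rewrite leqNgt; apply/negP => lt; apply: nex.
  exists a => //; rewrite Aa /=; move: lt; rewrite /gap /third.
  have lek : 2 ^ j <= 2 ^ k by rewrite leq_exp2l // /j leq_div.
  by move: lt_m; rewrite !expnS; clear -lek; lia.
have Q_ge : #|X| = #|Q| + #|Near|.
  by rewrite -(cardsID [set x | far x] X); congr (_ + _); apply: eq_card => x; rewrite !inE // andbC.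
have QP x : x \in Q -> x \in X /\ far x by rewrite in_set => /andP.
pose E := [set third_ord m x | x in Q].
have third_ordE x : x \in X -> third_ord m x = third m x :> nat.
  by move=> xX; rewrite inordK // ltnS (leq_trans _ le_N) // /third; clear; lia.
have Q_le : #|Q| <= #|E| * 2.
  rewrite -card_bool -cardX; apply: (card_code (c := fun x => (third_ord m x, ord12 x))).
    move=> x y /QP[xX _] /QP[yX _] [/(congr1 val) ed eo].
    move: ed; rewrite /= !third_ordE // => ed.
    have [[A1 A2] _ _ _ _] := XP x xX; have [[A1' A2'] _ _ _ _] := XP y yX.
    have es := third_sum (sum_le x xX) (sum_le y yX) ed.
    have [h1 h2] := sidon_sum dense_sidon_sidon A1 A2 A1' A2' es eo.
    exact: pair_val_eq.
  by move=> x xQ; rewrite !inE andbT; apply: imset_f.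
have E_ge : reps k <= #|E|.
  have ge_k : 4 * 4096 <= k by apply: leq_trans le_k; rewrite -addnA leq_addr.
  apply: leq_trans (reps_le ge_k) _; rewrite -/i1 -/i2.
  have := leq_mul L1_ge L2_ge; rewrite -cardsX Q_ge; have := near_small ge_k; rewrite -/i1 -/i2 -/j.
  have d2 n : 1 < n -> 2 ^ n.-1 = 2 * 2 ^ n.-1.-1 by move=> lt; rewrite -expnS prednK //; lia.
  rewrite (d2 ((37 * i1) %/ 100)) ?(d2 ((37 * i2) %/ 100)); [|rewrite /i1; lia|rewrite /i2; lia].
  move: Near_le Q_le; clear; move: (2 ^ ((37 * i1) %/ 100).-1.-1) (2 ^ ((37 * i2) %/ 100).-1.-1) => x y.
  move: #|Q| #|E| #|Near| (2 ^ _ * _) => q e n z; rewrite mulnACA; move: (x * y) => w *; lia.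
(* Exactly [reps k] values d are retained, with one pair for each. *)
pose D := [set d in take (reps k) (enum E)].
have D_card : #|D| = reps k.
  by rewrite cardsE (card_uniqP _) ?take_uniq ?enum_uniq // size_takel // -cardE.
have exr d : exists x, d \in E -> x \in Q /\ third_ord m x = d.
  case: (boolP (d \in E)) => [/imsetP[x xQ ->]|_]; first by exists x.
  by exists (ord0, ord0).
have [f fP] := choice exr.
have DE d : d \in D -> d \in E by rewrite inE => /mem_take; rewrite mem_enum.
pose PP := [set f d | d in D] :|: [set swap (f d) | d in D].
have PPP x : x \in PP -> exists2 y, y \in Q & x = y \/ x = swap y.
  by rewrite inE => /orP[] /imsetP[d /DE/fP[yQ _] ->]; exists (f d) => //; [left | right].
exists PP; rewrite /selected -/j; split; last first.
  split.
    rewrite mul2n -addnn (leq_trans (leq_card_setU _ _)) // -D_card.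
    by rewrite leq_add // leq_imset_card.
  rewrite -D_card; apply/subset_leq_card/subsetP => d dD; apply/imsetP; exists (f d).
    by rewrite inE imset_f.
  by case: (fP d (DE d dD)).
split.
- move=> x /PPP[y /QP[/XP[[h1 h2] [g1 g2] _ [l1 l2] _] _]].
  by clear -h1 h2 g1 g2 l1 l2 pow_i1 pow_i2; case=> ->; rewrite ?fst_val_swap ?snd_val_swap; split=> //; lia.
- move=> x a /PPP[y /QP[/XP[_ _ _ _ [/asboolP i1P /asboolP i2P]] _]].
  by case=> ->; rewrite ?fst_val_swap => Aa; [apply: i1P | apply: i2P].
- by move=> x a /PPP[y /QP[_ /asboolP fy]] [] ->; rewrite ?third_swap; apply: fy.
move=> x xPP; have /PPP[y /QP[yX _] xy] := xPP; split.
- move: xPP; rewrite !inE => /orP[] /imsetP[d dD ->]; apply/orP; [right | left]; apply/imsetP; exists d => //.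
  by rewrite /swap; case: (f d).
- have -> : third m x = third m y by case: xy => ->; rewrite ?third_swap.
  apply: free; have := sum_le y yX; have [_ _ [<- <-] _ _] := XP y yX.
  rewrite -modnDmr modn_mod modnDmr -modnDml modnDmr modnDml => le; congr (_ %% _).
  by move: le; rewrite /third; clear; lia.
- have [_ [_ lt] _ _ _] := XP y yX; case: xy => ->; rewrite ?fst_val_swap ?snd_val_swap geq_min (ltnW lt) ?orbT //.
Qed.

(** * The elements that are kept *)

Section Kept.
Variables (N : nat) (C : {set 'I_N.+1}).
Local Notation I := 'I_N.+1.
Local Notation A := dense_sidon.

(** In an equation with two dense terms the larger dense one is deleted; with at most one dense
    term, the largest random one is ([bad_random]). *)
Definition bad_dense (a : nat) := exists a' c c' : I, [/\ A a', c \in C, c' \in C &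
  (a' < a /\ a + c = a' + c') \/ (a' <= a /\ a + a' = c + c')].

Definition bad_random (d : nat) := exists w1 w2 : I, [/\ w1 \in C, w2 \in C &
  (exists a : I, A a /\ ([/\ w1 < d, w2 < d & d + a = w1 + w2] \/ [/\ w1 <= d, w2 < d & d + w1 = a + w2]))
  \/ exists w3 : I, [/\ w3 \in C, w2 < d, w3 < d & d + w1 = w2 + w3]].

Definition kept (x : I) := (A x /\ ~ bad_dense x) \/ (x \in C /\ ~ bad_random x).

Hypothesis C_free : forall c, c \in C -> free_tag c.

(** Sixteen cases according to which terms are dense: four dense terms contradict the Sidon
    property, three dense terms the classes mod 64, and every other case names a deleted term. *)
Lemma kept_max (a b c d : I) : kept a -> kept b -> kept c -> kept d ->
  a + b = c + d -> c < a -> d < a -> False.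
Proof.
have blocked x y z t : A x -> A y -> A z -> t \in C -> t + z = x + y -> False.
  move=> Ax Ay Az tC e; have := C_free tC; apply/negP.
  by apply: (blocked_sum (dense_sidon_mod Ax) (dense_sidon_mod Ay) (dense_sidon_mod Az)).
case=> [[Aa na]|[Ca na]]; case=> [[Ab nb]|[Cb nb]]; case=> [[Ac nc]|[Cc nc]];
  case=> [[Ad nd]|[Cd nd]] e lc ld.
- by case: (dense_sidon_sidon Aa Ab Ac Ad e) => -[E1 E2]; move: lc ld; rewrite E1 ltnn.
- by apply: (blocked a b c d) => //; lia.
- by apply: (blocked a b d c) => //; lia.
- by apply: na; exists b, c, d; split=> //; right; lia.
- by apply: (blocked c d a b) => //; lia.
- by apply: na; exists c, b, d; split=> //; left; lia.
- by apply: na; exists d, b, c; split=> //; left; lia.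
- case: (leqP c d) => le.
    by apply: nd; exists c, b; split=> //; left; exists a; split=> //; right; split; lia.
  by apply: nc; exists d, b; split=> //; left; exists a; split=> //; right; split; lia.
- by apply: (blocked c d b a) => //; lia.
- by apply: nc; exists b, d, a; split=> //; left; lia.
- by apply: nd; exists b, c, a; split=> //; left; lia.
- by apply: na; exists c, d; split=> //; left; exists b; split=> //; left; split; lia.
- case: (leqP c d) => le.
    by apply: nd; exists c, a, b; split=> //; right; lia.
  by apply: nc; exists d, a, b; split=> //; right; lia.
- by apply: na; exists b, d; split=> //; left; exists c; split=> //; right; split; lia.
- by apply: na; exists b, c; split=> //; left; exists d; split=> //; right; split; lia.
- by apply: na; exists b, c; split=> //; right; exists d; split=> //; lia.
Qed.

Lemma kept_sidon (a b c d : I) : kept a -> kept b -> kept c -> kept d ->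
  a + b = c + d -> (a = c /\ b = d) \/ (a = d /\ b = c).
Proof.
move=> ka kb kc kd e.
case: (eqVneq a c) => [E|nac]; first by left; split=> //; apply: val_inj => /=; move: e; rewrite E; lia.
case: (eqVneq a d) => [E|nad]; first by right; split=> //; apply: val_inj => /=; move: e; rewrite E; lia.
have {}nac : a != c :> nat by [].
have {}nad : a != d :> nat by [].
exfalso; case: (ltnP c a) => h1; case: (ltnP d a) => h2.
- exact: (kept_max ka kb kc kd).
- by apply: (@kept_max d c a b) => //; lia.
- by apply: (@kept_max c d a b) => //; lia.
by apply: (@kept_max b a c d) => //; lia.
Qed.
End Kept.

Section Cover.
Variables (N k m : nat) (PP : {set 'I_N.+1 * 'I_N.+1}).
Local Notation I := 'I_N.+1.
Local Notation A := dense_sidon.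
Hypothesis sel : selected k m PP.
Hypothesis m_le : m <= N.
Variables (C C' : {set I}).
Hypothesis sub : C' \subset C.
Hypothesis freeC : forall c, c \in C -> free_tag c -> c \in C'.
Local Notation confs := (confs A m PP).

Let PPA := let: conj (And4 h _ _ _) _ := sel in h.

Lemma sel_third x : x \in PP -> third m x + fst_val x + snd_val x = m /\ third m x <= N.
Proof.
case/PPA=> _ _ l1 l2 _; rewrite /third; split; lia.
Qed.

Lemma sel_third_ord x : x \in PP -> third_ord m x = third m x :> nat.
Proof. by move=> /sel_third[_ h]; rewrite inordK. Qed.

Lemma bad_dense_conf x : x \in PP -> bad_dense C' (fst_val x) ->
  exists2 F, F \in confs & F.1 = third_ord m x /\ F.2 \subset C.
Proof.
move=> xP [a' [c [c' [Aa cC cC' h]]]].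
have s2 u v : u \in C' -> v \in C' -> [set u; v] \subset C.
  by move=> uC vC; rewrite subUset !sub1set !(subsetP sub).
case: h => -[lt e].
  exists (third_ord m x, [set c; c']); last by split=> //; apply: s2.
  rewrite !mem_cat; apply/orP; left; apply/imageP; exists (x, a', c, c') => //.
  by apply/and4P; split=> //; apply/eqP.
case: (ltngtP c c') => cc.
- exists (third_ord m x, [set c; c']); last by split=> //; apply: s2.
  rewrite !mem_cat; apply/orP; right; apply/orP; left; apply/imageP; exists (x, a', c, c') => //.
  by apply/and5P; split=> //; apply/eqP.
- exists (third_ord m x, [set c'; c]); last by split=> //; apply: s2.
  rewrite !mem_cat; apply/orP; right; apply/orP; left; apply/imageP; exists (x, a', c', c) => //.
  by apply/and5P; split=> //; apply/eqP; rewrite e addnC.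
exists (third_ord m x, [set c]); last by split=> //; rewrite sub1set (subsetP sub).
rewrite !mem_cat; do 2 (apply/orP; right); apply/orP; left; apply/imageP; exists (x, a', c) => //.
by apply/and4P; split=> //; apply/eqP; rewrite e cc; lia.
Qed.

Lemma bad_random_conf x : x \in PP -> bad_random C' (third_ord m x) ->
  exists2 F, F \in confs & F.1 = third_ord m x /\ F.2 \subset C.
Proof.
move=> xP [w1 [w2 [c1 c2]]]; rewrite !sel_third_ord // => h.
have s2 u v : u \in C' -> v \in C' -> [set u; v] \subset C.
  by move=> uC vC; rewrite subUset !sub1set !(subsetP sub).
case: h => [[a [Aa [[l1 l2 e]|[l1 l2 e]]]]|[w3 [c3 l2 l3 e]]].
- case: (ltngtP w1 w2) => cc.
  + exists (third_ord m x, [set w1; w2]); last by split=> //; apply: s2.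
    rewrite !mem_cat; do 3 (apply/orP; right); apply/orP; left; apply/imageP; exists (x, a, w1, w2) => //.
    by apply/and5P; split=> //; apply/eqP.
  + exists (third_ord m x, [set w2; w1]); last by split=> //; apply: s2.
    rewrite !mem_cat; do 3 (apply/orP; right); apply/orP; left; apply/imageP; exists (x, a, w2, w1) => //.
    by apply/and5P; split=> //; apply/eqP; rewrite e addnC.
  exists (third_ord m x, [set w1]); last by split=> //; rewrite sub1set (subsetP sub).
  rewrite !mem_cat; do 4 (apply/orP; right); apply/orP; left; apply/imageP; exists (x, a, w1) => //.
  by apply/and4P; split=> //; apply/eqP; rewrite e cc; lia.
- case: (ltngtP w1 (third m x)) => cc; [|by move: l1; rewrite leqNgt cc|].
    exists (third_ord m x, [set w1; w2]); last by split=> //; apply: s2.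
    rewrite !mem_cat; do 5 (apply/orP; right); apply/orP; left; apply/imageP; exists (x, a, w1, w2) => //.
    by apply/and5P; split=> //; apply/eqP.
  exists (third_ord m x, [set w2]); last by split=> //; rewrite sub1set (subsetP sub).
  rewrite !mem_cat; do 6 (apply/orP; right); apply/orP; left; apply/imageP; exists (x, a, w2) => //.
  by apply/and4P; split=> //; apply/eqP; rewrite -e cc; lia.
have s3 u : u \in C' -> [set u] \subset C by move=> uC; rewrite sub1set (subsetP sub).
case: (ltngtP w2 w3) => cc.
- exists (third_ord m x, w1 |: [set w2; w3]); last by split=> //; rewrite subUset s3 ?s2.
  rewrite !mem_cat; do 7 (apply/orP; right); apply/orP; left; apply/imageP; exists (x, w1, w2, w3) => //.
  by apply/and5P; split=> //; [apply/eqP | clear -e cc l3; lia].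
- exists (third_ord m x, w1 |: [set w3; w2]); last by split=> //; rewrite subUset s3 ?s2.
  rewrite !mem_cat; do 7 (apply/orP; right); apply/orP; left; apply/imageP; exists (x, w1, w3, w2) => //.
  by apply/and5P; split=> //; [apply/eqP; rewrite e addnC | clear -e cc l2; lia].
exists (third_ord m x, [set w1; w2]); last by split=> //; apply: s2.
rewrite !mem_cat; do 8 (apply/orP; right); apply/imageP; exists (x, w1, w2) => //.
by apply/and4P; split=> //; [apply/eqP; rewrite e cc; lia | clear -e cc l2; lia].
Qed.

(** If no representation survived, every available d in C would head a configuration inside C,
    whichever of a1, a2, d was deleted, and a chain would exist. *)
Lemma ex_kept_sum K : ~~ chain confs K set0 C -> 4 * K <= #|C :&: [set third_ord m x | x in PP]| ->
  exists u v w : I, [/\ kept C' u, kept C' v, kept C' w, m = u + v + w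
    & minn u (minn v w) <= 2 ^ (15 * k %/ 16)].
Proof.
move=> nch leK; apply: contrapT => nex; move/negP: nch; apply.
apply: (chain_of_destroyed (confs_small (A := A) (m := m) (PP := PP)) _ leK) => d.
rewrite inE => /andP[dC /imsetP[x xP de]]; rewrite {}de in dC *.
have [A1 A2 _ _ _] := PPA xP; have [e _] := sel_third xP.
have selS : forall y, y \in PP -> [/\ swap y \in PP, free_tag (third m y) & minn (fst_val y) (snd_val y) <= 2 ^ (15 * k %/ 16)].
  by case: sel => -[].
have [sP fd lem] := selS x xP.
case: (pselect (bad_dense C' (fst_val x))) => [|n1]; first exact: bad_dense_conf.
case: (pselect (bad_dense C' (snd_val x))) => [|n2].
  have -> : third_ord m x = third_ord m (swap x) by rewrite /third_ord third_swap.
  by rewrite -fst_val_swap; apply: bad_dense_conf.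
case: (pselect (bad_random C' (third_ord m x))) => [|n3]; first exact: bad_random_conf.
exfalso; apply: nex; exists x.1, x.2, (third_ord m x); split.
- by left.
- by left.
- by right; split=> //; apply: freeC; rewrite ?sel_third_ord.
- by rewrite sel_third_ord // -[in LHS]e -/(fst_val x) -/(snd_val x); lia.
by apply: leq_trans lem; rewrite minnA; exact: geq_minl.
Qed.
End Cover.

Local Open Scope ring_scope.

(** * Probability estimates *)

Section Numeric.
Variable R : archiRealFieldType.
Local Notation rr := (64%:R / 65%:R : R).

(** The fraction 14/37 separates 151/400 from log2 (13/10) = 0.3785; CA absorbs rounding and the
    small n. *)
Lemma dense_sidon_local_real : exists2 CA : R, 1 <= CA & forall t n (s : seq nat), uniq s ->
  (forall a, a \in s -> [/\ dense_sidon a, (a < t + 2 ^ n)%N & (t < a + 2 ^ n)%N]) ->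
  (size s)%:R <= CA * (13%:R / 10%:R) ^+ n.
Proof.
have [n1 local] := dense_sidon_local.
have s1 : (1 : R) <= 13%:R / 10%:R by lra.
have e37 : 2%:R ^+ 14 <= (13%:R / 10%:R : R) ^+ 37 by lra.
have big n : (2 ^ ((151 * n) %/ 400))%:R <= 2%:R ^+ 14 * (13%:R / 10%:R : R) ^+ n.
  apply: le_trans (_ : 2%:R ^+ (14 * (n %/ 37) + 14) <= _).
    by rewrite -natrX ler_nat leq_exp2l //; lia.
  rewrite addnC exprD ler_wpM2l ?exprn_ge0 ?ler0n // exprM.
  apply: le_trans (_ : ((13%:R / 10%:R) ^+ 37) ^+ (n %/ 37) <= _).
    by apply: lerXn2r; rewrite ?nnegrE ?exprn_ge0 ?divr_ge0 ?ler0n.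
  by rewrite -exprM; apply: ler_weXn2l => //; lia.
have s0 : 0 <= 13%:R / 10%:R :> R by lra.
exists (2%:R ^+ 14 * (13%:R / 10%:R) ^+ n1).
  by rewrite mulr_ege1 ?exprn_ege1 //; lra.
move=> t n s us hs; case: (leqP n1 n) => [le|lt].
  apply: le_trans (_ : (2 ^ ((151 * n) %/ 400))%:R <= _).
    by rewrite ler_nat; apply: local hs.
  apply: le_trans (big n) _; rewrite ler_wpM2r ?exprn_ge0 //.
  by rewrite ler_peMr ?exprn_ege1 ?exprn_ge0 ?ler0n.
apply: le_trans (_ : (2 ^ ((151 * n1) %/ 400))%:R <= _).
  rewrite ler_nat; apply: (local n1 t) => // a /hs[Aa l1 l2].
  have : (2 ^ n <= 2 ^ n1)%N by rewrite leq_exp2l // ltnW.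
  by split=> //; lia.
by apply: le_trans (big n1) _; rewrite ler_peMr ?exprn_ege1 // mulr_ge0 ?exprn_ge0 ?ler0n.
Qed.

Let rr0 : 0 <= rr. Proof. by rewrite divr_ge0 ?ler0n. Qed.
Let rr1 : rr <= 1. Proof. lra. Qed.
Let ge1 : (1 : R) <= 65%:R / 64%:R. Proof. lra. Qed.
Let inv_rr : 65%:R / 64%:R * rr = 1. Proof. lra. Qed.

Let growth_ge i : (i%:R / 64%:R : R) <= (65%:R / 64%:R) ^+ i.
Proof.
elim: i => [|n IH]; first by rewrite mul0r exprn_ge0 // divr_ge0 ?ler0n.
have : (1 : R) <= (65%:R / 64%:R) ^+ n by rewrite exprn_ege1.
by rewrite exprS -(natr1 n); move: IH; move: (_ ^+ n) (n%:R : R) => x y; lra.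
Qed.

Lemma linear_lt_power (c : R) : exists k1, forall k, (k1 <= k)%N -> c * k%:R * rr ^+ (k %/ 4) <= rr ^+ (k %/ 8).
Proof.
wlog c0 : c / 0 <= c.
  move=> gen; case: (lerP 0 c) => [/gen//|c0]; exists 0 => k _.
  apply: le_trans (_ : 0 <= _); last by rewrite exprn_ge0 // divr_ge0 ?ler0n.
  by rewrite mulr_le0_ge0 ?exprn_ge0 ?divr_ge0 ?ler0n // mulr_le0_ge0 // ltW.
have lt_b := archi_boundP (mulr_ge0 c0 (mulr_ge0 (ler0n R 31) (ler0n R 4096))).
move: (Num.bound _) lt_b => b lt_b; exists (16 * b.+1)%N => k le_k.
have [i [le_i k_le i_le]] : exists i, [/\ b < i, k <= 31 * i & i + i <= k %/ 8]%N.
  by exists (k %/ 16)%N; clear -le_k; split; lia.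
have i8 : (k %/ 8 + k %/ 8 <= k %/ 4)%N by clear; lia.
have ck : c * k%:R <= (65%:R / 64%:R) ^+ i * (65%:R / 64%:R) ^+ i.
  apply: le_trans (_ : (i%:R / 64%:R) * (i%:R / 64%:R) <= _).
    have h1 : k%:R <= 31%:R * i%:R :> R by rewrite -natrM ler_nat.
    have h2 : b%:R <= i%:R :> R by rewrite ler_nat ltnW.
    apply: le_trans (ler_wpM2l c0 h1) _.
    have i0 : 0 <= i%:R :> R by rewrite ler0n.
    have : c * (31%:R * 4096%:R) * i%:R <= i%:R * i%:R.
      by rewrite ler_wpM2r // (le_trans (ltW lt_b)).
    by move: (i%:R : R) => y; lra.
  by apply: ler_pM; rewrite ?growth_ge ?divr_ge0 ?ler0n.
apply: le_trans (ler_wpM2r (exprn_ge0 _ rr0) ck) _.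
have -> : rr ^+ (k %/ 8) = (65%:R / 64%:R) ^+ (k %/ 8) * (rr ^+ (k %/ 8) * rr ^+ (k %/ 8)).
  by rewrite mulrA -exprMn inv_rr expr1n mul1r.
rewrite -!exprD; apply: ler_pM; rewrite ?exprn_ge0 ?divr_ge0 ?ler0n //.
  by apply: ler_weXn2l.
by apply: ler_wiXn2l.
Qed.

(** 65 factors of 64/65 give 1/2 by Bernoulli, and 24 floor(k / 8) >= 2 k + 2 from k = 23 on. The
    exponent 65 * 24 becomes the length K of the chains. *)
Lemma rr_power k : (23 <= k)%N -> (rr ^+ (k %/ 8)) ^+ (65 * 24) <= 2^-1 ^+ (2 * k + 2).
Proof.
move=> le_k; have h : rr ^+ 65 <= 2^-1.
  have -> : rr = 1 - 65%:R^-1 by lra.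
  by apply: bernoulli_half; [apply/andP; split; lra | rewrite mulfV ?pnatr_eq0].
rewrite exprAC exprM -exprM.
apply: le_trans (_ : (2^-1) ^+ (24 * (k %/ 8)) <= _).
  by apply: lerXn2r; rewrite ?nnegrE ?invr_ge0 ?exprn_ge0 ?divr_ge0 ?ler0n.
by apply: ler_wiXn2l; [lra | lra | lia].
Qed.

Lemma theta_ratio k : theta R ^+ k = (8 ^ k)%:R / (13 ^ k)%:R.
Proof. by rewrite /theta expr_div_n !natrX. Qed.

Lemma reps_weight k : (0 < k)%N -> (reps k)%:R * theta R ^+ k.-1 <= 20%:R * k%:R.
Proof.
move=> k0; set q := (13 ^ k %/ 8 ^ k)%N.
have p13 : 0 < (13 ^ k)%:R :> R by rewrite ltr0n expn_gt0.
have th1 : theta R ^+ k <= 1 by rewrite exprn_ile1 ?theta_ge0 ?theta_le1.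
have qth : q%:R * theta R ^+ k <= 1.
  by rewrite theta_ratio mulrA ler_pdivrMr // mul1r -natrM ler_nat leq_divM.
have -> : theta R ^+ k.-1 = 13%:R / 8%:R * theta R ^+ k.
  by rewrite -[in RHS](prednK k0) exprS mulrA (_ : 13%:R / 8%:R * theta R = 1) ?mul1r // /theta; lra.
rewrite /reps -/q natrM (natrM _ 3 k) (natrM _ 2) -(natr1 q).
have k1 : 0 <= k%:R :> R by rewrite ler0n.
have le : (q%:R + 1) * theta R ^+ k <= 2%:R by rewrite mulrDl mul1r; lra.
rewrite [leLHS](_ : _ = 39%:R / 4%:R * k%:R * ((q%:R + 1) * theta R ^+ k)); last by field.
apply: le_trans (_ : 39%:R / 4%:R * k%:R * 2%:R <= _); last by lra.
by rewrite ler_wpM2l // mulr_ge0 // divr_ge0 ?ler0n.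
Qed.

(** Every d has intensity at least theta^k, so each of the 3 k groups of n0 factors contributes at
    most 1/2. *)
Lemma few_weight N k m (PP : {set 'I_N.+1 * 'I_N.+1}) : (m < 2 ^ k.+1)%N -> (m <= N)%N -> (0 < m)%N ->
  selected k m PP ->
  \prod_(i in [set third_ord m x | x in PP]) (1 - prI R i / 2) <= 2^-1 ^+ (3 * k).
Proof.
move=> lt_m le_N m0 [[hA _ _ hS] [_ le_reps]]; set D := [set _ | _ in _] in le_reps *.
set y := theta R ^+ k / 2%:R; set n0 := (2 * (13 ^ k %/ 8 ^ k).+1)%N.
have t0 : 0 < theta R ^+ k by rewrite exprn_gt0 ?theta_gt0.
have t1 : theta R ^+ k <= 1 by rewrite exprn_ile1 ?theta_ge0 ?theta_le1.
have y01 : 0 <= y <= 1 by rewrite /y; apply/andP; split; lra.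
have y1 : 0 <= 1 - y <= 1 by case/andP: y01 => a b; apply/andP; split; lra.
have ge_y d : d \in D -> 1 - prI R d / 2 <= 1 - y.
  case/imsetP => x xP ->; have [_ fr _] := hS x xP; have [_ _ l1 l2 _] := hA x xP.
  have dE : third_ord m x = third m x :> nat by rewrite inordK // ltnS (leq_trans _ le_N) // /third; clear; lia.
  have d0 : (0 < third m x)%N by rewrite /third; clear -l1 l2 m0; lia.
  rewrite lerD2l lerN2 /y ler_wpM2r ?invr_ge0 ?ler0n //.
  rewrite /prI dE /pr d0 fr /=; apply: theta_mono; rewrite -ltnS; apply: lev_lt => //.
  by rewrite (leq_ltn_trans _ lt_m) // /third; clear; lia.
have half : (1 - y) ^+ n0 <= 2^-1.
  apply: bernoulli_half => //; rewrite /y theta_ratio /n0 natrM.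
  have p13 : 0 < (13 ^ k)%:R :> R by rewrite ltr0n expn_gt0.
  rewrite [leRHS](_ : _ = ((13 ^ k %/ 8 ^ k).+1 * 8 ^ k)%:R / (13 ^ k)%:R).
    by rewrite ler_pdivlMr // mul1r ler_nat ltnW // ltn_ceil // expn_gt0.
  by rewrite natrM; field; exact: lt0r_neq0.
apply: le_trans (_ : \prod_(i in D) (1 - y) <= _).
  apply: ler_prod => i iD; rewrite ge_y // andbT subr_ge0.
  have /andP[_] := prI01 R i; lra.
rewrite prodr_const; apply: le_trans (_ : (1 - y) ^+ (reps k) <= _).
  by case/andP: y1 => a b; apply: ler_wiXn2l.
rewrite /reps mulnC exprM; apply: lerXn2r; rewrite ?nnegrE ?exprn_ge0 ?invr_ge0 ?ler0n //.
by case/andP: y1.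
Qed.

Definition bad_event N m (PP : {set 'I_N.+1 * 'I_N.+1}) K (C : {set 'I_N.+1}) :=
  chain (confs dense_sidon m PP) K set0 C || (#|C :&: [set third_ord m x | x in PP]| <= 4 * K)%N.

Lemma Pr_bad_event : exists K k1, forall k m N (PP : {set 'I_N.+1 * 'I_N.+1}),
  (k1 <= k)%N -> (2 ^ k <= m < 2 ^ k.+1)%N -> (m <= N)%N -> selected k m PP ->
  Pr (prI R (N:=N)) (bad_event m PP K) <= 2^-1 ^+ (2 * k + 1).
Proof.
have [CA CA1 local] := dense_sidon_local_real.
(* Makes K opaque, so that the numeral is never unfolded. *)
have [K rr_pow] := ex_intro (fun K => forall k, (23 <= k)%N -> (rr ^+ (k %/ 8)) ^+ K <= 2^-1 ^+ (2 * k + 2)) _ rr_power.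
pose h0 := (4 * K)%N; exists K.
pose c' : R := 120%:R * (h0%:R + 1) * (h0%:R + 6%:R) * (CA + h0%:R + 6%:R).
have c'0 : 0 <= c' by rewrite /c' !mulr_ge0 ?addr_ge0 ?ler0n ?(le_trans ler01).
have [k2 lin] := linear_lt_power (1700%:R * CA * 40%:R + c').
exists (k2 + 23 + (4 * K + 2))%N => k m N PP le_k m_lev le_N sel.
have [le_k2 le_23 le_K] : [/\ k2 <= k, 23 <= k & 4 * K + 2 <= k]%N by move: le_k; clear; split; lia.
clear le_k.
have k0 : (0 < k)%N by apply: leq_trans le_23.
have [[hA hg hgd hS] [leP leD]] := sel.
have lt_j : (k %/ 4 < k)%N by rewrite ltn_Pdiv.
have h2 : 0 <= 2^-1 :> R by rewrite invr_ge0 ler0n.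
have chain_le : Pr (prI R (N:=N)) (fun C => chain (confs dense_sidon m PP) K set0 C) <= 2^-1 ^+ (2 * k + 2).
  apply: le_trans (_ : Pr (prI R (N:=N)) (fun C => (set0 \subset C) && chain (confs dense_sidon m PP) K set0 C) <= _).
    by apply: Pr_le; [exact: prI01 | move=> C ->; rewrite sub0set].
  have B_le : #|PP|%:R * theta R ^+ k.-1 <= 40%:R * k%:R.
    apply: le_trans (_ : (2 * reps k)%:R * theta R ^+ k.-1 <= _).
      by rewrite ler_wpM2r ?exprn_ge0 ?theta_ge0 // ler_nat.
    by have := reps_weight k0; rewrite (natrM _ 2) -mulrA; move: (_ * theta R ^+ _) => z; lra.
  have rho_le := fun H leH => confs_rho CA1 dense_sidon_sidon local m_lev le_N lt_j hA hg hgd (H := H) (h0 := h0) leH B_le.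
  have rho0 : 0 <= (1700%:R * CA * (40%:R * k%:R) + c') * rr ^+ (k %/ 4).
    rewrite mulr_ge0 ?exprn_ge0 // addr_ge0 // !mulr_ge0 ?ler0n // (le_trans ler01) //.
  have cle : (#|(set0 : {set 'I_N.+1})| + 4 * K <= h0 + 4)%N by rewrite cards0 leq_addr.
  apply: le_trans (Pr_chain (prI01 R (N:=N)) (confs_small (A := dense_sidon) (m := m) (PP := PP)) rho0 rho_le cle) _.
  rewrite big_set0 mul1r; apply: le_trans (rr_pow _ le_23); apply: lerXn2r; rewrite ?nnegrE ?exprn_ge0 //.
  apply: le_trans (lin k le_k2); rewrite ler_wpM2r ?exprn_ge0 // [leRHS]mulrDl mulrA lerD2l.
  by rewrite ler_peMr // ler1n.
have few_le : Pr (prI R (N:=N)) (fun C => #|C :&: [set third_ord m x | x in PP]| <= 4 * K)%N <= 2^-1 ^+ (2 * k + 2).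
  apply: le_trans (Pr_few (prI01 R (N:=N)) _ _) _.
  case/andP: m_lev => le_m lt_m.
  have m0 : (0 < m)%N by rewrite (leq_trans _ le_m) ?expn_gt0.
  apply: le_trans (ler_wpM2l _ (few_weight lt_m le_N m0 sel)) _; first by rewrite exprn_ge0 ?ler0n.
  apply: le_trans (_ : 2%:R ^+ (4 * K) * 2^-1 ^+ (4 * K + (2 * k + 2)) <= _).
    rewrite ler_wpM2l ?exprn_ge0 ?ler0n //; apply: ler_wiXn2l => //; first by lra.
    by move: (4 * K)%N le_K => z; clear; lia.
  by rewrite exprD mulrA -exprMn mulfV ?pnatr_eq0 // expr1n mul1r.
apply: le_trans (Pr_or (prI01 R (N:=N)) _ _) _.
apply: le_trans (lerD chain_le few_le) _.
by rewrite addnS exprS; move: (_ ^+ _) => z; lra.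
Qed.
End Numeric.

(** * The union bound and compactness *)

Lemma free_tag0 n : free_tag n -> (0 < n)%N.
Proof. by case: n. Qed.

(** Level n has 2^n integers and contributes 2^(-n-1), so the sum telescopes. *)
Lemma lev_sum (R : realFieldType) k i :
  \sum_(2 ^ k <= m < 2 ^ (k + i)) 2^-1 ^+ (2 * lev m + 1) = 2^-1 ^+ k - 2^-1 ^+ (k + i) :> R.
Proof.
elim: i => [|i IH]; first by rewrite addn0 big_geq // subrr.
rewrite (@big_cat_nat _ _ _ (2 ^ (k + i))) /=; [|by rewrite leq_exp2l ?leq_addr //|by rewrite leq_exp2l // leq_add2l].
rewrite IH addnS (@eq_big_nat _ _ _ _ _ _ (fun=> 2^-1 ^+ (2 * (k + i) + 1))); last first.
  move=> m /andP[le lt]; congr (_ ^+ (2 * _ + 1)); apply/eqP; rewrite eqn_leq lev_ge // andbT.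
  by rewrite -ltnS lev_lt // (leq_trans _ le) // expn_gt0.
rewrite sumr_const_nat (_ : 2 ^ (k + i).+1 - 2 ^ (k + i) = 2 ^ (k + i))%N; last by rewrite expnS; lia.
rewrite -[_ *+ (2 ^ _)]mulr_natr natrX; move: (k + i)%N => n.
have -> : 2^-1 ^+ (2 * n + 1) = 2^-1 * (2^-1 ^+ n * 2^-1 ^+ n) :> R.
  by rewrite addn1 exprS mul2n -addnn exprD.
have : 2^-1 ^+ n * 2%:R ^+ n = 1 :> R by rewrite -exprMn mulVf ?pnatr_eq0 // expr1n.
rewrite exprS; move: (2^-1 ^+ n) (2%:R ^+ n) (2^-1 ^+ k) => x y z e.
by rewrite -!mulrA e; lra.
Qed.

Definition covered (S : nat -> Prop) m := exists u v w : nat,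
  [/\ S u, S v, S w, m = (u + v + w)%N & (minn u (minn v w) <= 2 ^ (15 * lev m %/ 16))%N].

Definition sidon_prop (S : nat -> Prop) := forall a b c d, S a -> S b -> S c -> S d ->
  (a + b = c + d)%N -> (a = c /\ b = d) \/ (a = d /\ b = c).

Lemma finite_cover : exists k1, forall Z, exists S : nat -> Prop,
  [/\ forall n, S n -> (0 < n)%N, sidon_prop S & forall m, (2 ^ k1 <= m < 2 ^ Z)%N -> covered S m].
Proof.
have [K [k2 bad]] := Pr_bad_event rat; have [k0 selK] := ex_selected.
exists (maxn k2 k0) => Z; set k1 := maxn k2 k0; set N := (2 ^ Z)%N.
have lvl m : (2 ^ k1 <= m)%N -> (2 ^ lev m <= m < 2 ^ (lev m).+1)%N /\ (k1 <= lev m)%N.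
  by move=> le; split; [apply: levP; apply: leq_trans le; rewrite expn_gt0 | exact: lev_ge].
have exPP m : exists PP : {set 'I_N.+1 * 'I_N.+1}, (2 ^ k1 <= m < 2 ^ Z)%N -> selected (lev m) m PP.
  case: (boolP (2 ^ k1 <= m < 2 ^ Z)%N) => [/andP[le lt]|_]; last by exists set0.
  have [lm le_k] := lvl m le.
  have [|PP PPP] := selK _ _ N _ lm (ltnW lt); last by exists PP.
  by apply: leq_trans le_k; apply: leq_maxr.
have [PP PPP] := choice exPP.
pose E (C : {set 'I_N.+1}) := has (fun m => bad_event m (PP m) K C) (index_iota (2 ^ k1) (2 ^ Z)).
have PrE : Pr (prI rat (N:=N)) E < 1.
  apply: le_lt_trans (Pr_has (prI01 rat (N:=N)) _ _) _.
  apply: le_lt_trans (_ : \sum_(2 ^ k1 <= m < 2 ^ Z) 2^-1 ^+ (2 * lev m + 1) < 1).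
    apply: ler_sum_nat => m lm; have /andP[le lt] := lm; have [lm' le_k] := lvl m le.
    apply: bad => //; [|exact: ltnW|exact: PPP].
    by apply: leq_trans le_k; apply: leq_maxl.
  case: (leqP k1 Z) => [le|/ltnW le]; last by rewrite big_geq // leq_exp2l.
  rewrite -(subnKC le) lev_sum; apply: lt_le_trans (_ : 2^-1 ^+ k1 <= _); last first.
    by rewrite exprn_ile1 ?invr_ge0 //; lra.
  by rewrite gtrBl exprn_gt0 // invr_gt0.
have [C nE] : exists C, ~~ E C.
  apply: contrapT => nex; move: PrE; rewrite ltNge => /negP; apply.
  rewrite -(Pr_true (prI rat (N:=N))); apply: Pr_le; first exact: prI01.
  by move=> C _; apply/negPn/negP => nE; apply: nex; exists C.
(* Points outside the free classes have intensity 0, but the chosen C might still contain some. *)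
pose C' := [set c in C | free_tag c].
have sub : C' \subset C by apply/subsetP => c; rewrite inE => /andP[].
have freeC c : c \in C -> free_tag c -> c \in C' by rewrite inE => -> ->.
have C'_free c : c \in C' -> free_tag c by rewrite inE => /andP[].
exists (fun n : nat => exists2 x : 'I_N.+1, kept C' x & n = x :> nat); split.
- move=> n [x kx ->]; case: kx => -[h _]; first exact: dense_sidon_gt0.
  by apply: free_tag0; apply: C'_free.
- move=> a b c d [x kx ->] [y ky ->] [z kz ->] [t kt ->] e.
  by case: (kept_sidon C'_free kx ky kz kt e) => -[-> ->]; [left | right].
move=> m lm; have /andP[le lt] := lm; have [lm' _] := lvl m le.
have mE : ~~ bad_event m (PP m) K C.
  by apply: contra nE => h; apply/hasP; exists m; rewrite // mem_index_iota.
move: mE; rewrite negb_or -ltnNge => /andP[nch /ltnW leK].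
have [u [v [w [ku kv kw e lemin]]]] := ex_kept_sum (PPP m lm) (ltnW lt) sub freeC nch leK.
by exists u, v, w; split=> //; [exists u | exists v | exists w].
Qed.

(** Koenig's lemma for 0/1 words: a word is good if it is an initial segment of T Z for arbitrarily
    large Z, and a good word always has a good extension by one letter. *)
Lemma limit_set (T : nat -> nat -> Prop) : exists S : pred nat, forall M Z0,
  exists Z, (Z0 <= Z)%N /\ forall i, (i < M)%N -> (T Z i <-> S i).
Proof.
pose agrees Z s := forall i, (i < size s)%N -> (T Z i <-> nth false s i).
pose good s := forall Z0, exists Z, (Z0 <= Z)%N /\ agrees Z s.
pose f n := iter n (fun s => rcons s `[< good (rcons s true) >]) [::].
have size_f n : size (f n) = n by elim: n => //= n IH; rewrite size_rcons IH.
have agree_rcons Z s (b : bool) : agrees Z s -> (T Z (size s) <-> b) -> agrees Z (rcons s b).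
  move=> ag hb i; rewrite size_rcons nth_rcons ltnS leq_eqVlt; case: ltnP => [lt _|_].
    exact: ag.
  by case: eqP => [->|]//.
have good_f n : good (f n).
  elim: n => [|n IH] /=; first by move=> Z0; exists Z0.
  case: asboolP => // ng Z0; move/existsNP: ng => [Z1 nZ1].
  have [Z [le ag]] := IH (maxn Z0 Z1); exists Z; split; first by apply: leq_trans le; apply: leq_maxl.
  apply: (agree_rcons Z) => //; split=> // tz; exfalso; apply: nZ1.
  exists Z; split; first by apply: leq_trans le; apply: leq_maxr.
  exact: (agree_rcons Z).
exists (fun n => nth false (f n.+1) n) => M Z0; have [Z [le ag]] := good_f M Z0.
exists Z; split=> // i lt; suff <- : nth false (f M) i = nth false (f i.+1) i by apply: ag; rewrite size_f.
elim: M lt {ag le} => // M IH; rewrite ltnS leq_eqVlt => /orP[/eqP->//|lt].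
by rewrite -(IH lt) /= nth_rcons size_f lt.
Qed.

(** Each instance of the three properties involves only finitely many integers, so it passes from
    some finite stage to the limit. *)
Lemma sidon_cover : exists S : pred nat, [/\ forall n, S n -> (0 < n)%N, sidon_pred S &
  exists m0, forall m, (m0 <= m)%N -> covered S m].
Proof.
have [k1 fin] := finite_cover; have [T TP] := choice fin; have [S SP] := limit_set T.
exists S; split.
- move=> n Sn; have [Z [_ h]] := SP n.+1 0; have [pos _ _] := TP Z.
  by apply: pos; apply/h.
- move=> a b c d Sa Sb Sc Sd; have [Z [_ h]] := SP (a + b + c + d).+1 0.
  have [_ sid _] := TP Z; apply: sid; apply/h => //; lia.
exists (2 ^ k1)%N => m le; have [Z [leZ h]] := SP m.+1 m; have [_ _ cov] := TP Z.
have lt : (m < 2 ^ Z)%N by apply: leq_trans (ltn_expl m (ltnSn 1)) _; rewrite leq_exp2l.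
have [|u [v [w [Su Sv Sw e lem]]]] := cov m; first by rewrite le lt.
by exists u, v, w; split=> //; apply/h => //; lia.
Qed.

(* The theorem with real exponents *)
From mathcomp Require Import all_boot all_order all_algebra.
From mathcomp Require Import all_classical all_reals all_analysis.
Import Order.TTheory GRing.Theory Num.Theory.
Local Open Scope classical_set_scope.
Local Open Scope ring_scope.

Theorem theorem1p1 (R : realType) (eta : R) (eta_gt0 : 0 < eta)
    (eta_lt : eta < 527%:R / 10%:R ^+ 4) :
  exists S : set nat,
    [/\ infinite_set S, sidon_set S & asymptotic_basis_3sub eta S].
Proof.
have [S0 [pos sid [m0 cov]]] := sidon_cover.
exists [set n | S0 n]; split.
(* A set bounded by M could not represent m0 + 3 M + 1. *)
- move=> /finite_seqP[s Ss].
  have bound n : S0 n -> (n <= \max_(i <- s) i)%N.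
    move=> Sn; apply: (@leq_bigmax_seq _ s xpredT id) => //.
    by have : [set n | S0 n] n by []; rewrite Ss.
  set M := \max_(i <- s) i in bound.
  have [|u [v [w [/bound Su /bound Sv /bound Sw e _]]]] := cov (m0 + 3 * M + 1)%N; lia.
- split=> [n /pos//|a b c d Sa Sb Sc Sd ab cd e].
  by case: (sid a b c d Sa Sb Sc Sd e) => -[e1 e2]; split=> //; lia.
exists m0.+1 => m le_m; have [u [v [w [Su Sv Sw e lem]]]] := cov m (ltnW le_m).
exists u, v, w; split=> //.
have m_gt0 : (0 < m)%N by apply: leq_trans le_m.
have /andP[lev_le _] := levP m_gt0.
apply: le_trans (_ : powR 2%:R ((15 * lev m %/ 16)%N)%:R <= _).
  by rewrite powR_mulrn ?ler0n // -natrX ler_nat.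
(* The exponent 15/16 = 0.9375 is below 1 - 0.0527 < 1 - eta. *)
apply: le_trans (_ : powR (2%:R `^ (lev m)%:R) (1 - eta) <= _).
  rewrite -powRrM; apply: ler_powR; first by rewrite ler1n.
  have h : (16 * (15 * lev m %/ 16))%:R <= (15 * lev m)%:R :> R.
    by rewrite ler_nat mulnC leq_divM.
  have k0 : 0 <= (lev m)%:R :> R by rewrite ler0n.
  rewrite !natrM in h; move: h; move: (_ %/ _)%:R => j h.
  have : (lev m)%:R * eta <= (lev m)%:R * (527%:R / 10%:R ^+ 4) by rewrite ler_wpM2l // ltW.
  by rewrite mulrBr mulr1; move: (_ * eta) => z; lra.
apply: ge0_ler_powR; rewrite ?nnegrE ?powR_ge0 ?ler0n //; first by lra.
by rewrite powR_mulrn ?ler0n // -natrX ler_nat.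
Qed.
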